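(* Let $j>0$ and $A>0$, and set $R_\delta=1-A\delta$. For every $\delta>0$ small enough there is a unique function $\rho_\delta:[0,1]\to[0,\infty)$, continuous on $[0,R_\delta]$ and vanishing on $(R_\delta,1]$, such that $u=j\delta D_0+\rho_\delta$ satisfies $S^{(\delta,-)}_\delta(u)=u$ with cut point $R^{(\delta)}_{G^{\rm neum}_\delta*u}=R_\delta$. Moreover, for every $r\in[0,1)$, $$\lim_{\delta\to0}\rho_\delta(r)=2j(1-r)+\frac jA.$$
   Context: $D_0$ is the Dirac delta at $0$. $G^{\rm neum}_t(r,r')$ is the Green function of $\partial_t\rho=\frac12\partial_r^2\rho$ on $[0,1]$ with Neumann boundary conditions, $G^{\rm neum}_t(r,r')=\sum_kG_t(r,r'_k)$ with $G_t(r,r')=e^{-(r-r')^2/2t}/\sqrt{2\pi t}$ and $r'_k$ the images of $r'$ under repeated reflections of $[0,1]$. For $u=cD_0+\rho$, $(G^{\rm neum}_\delta*u)(r)=cG^{\rm neum}_\delta(r,0)+\int_0^1G^{\rm neum}_\delta(r,r')\rho(r')dr'$. The cut-and-paste map is $K^{(\delta)}u=j\delta D_0+\mathbf 1_{r\in[0,R^{(\delta)}_u]}u$ with $\int_{R^{(\delta)}_u}^1u=j\delta$, and $S^{(\delta,-)}_\delta(u)=K^{(\delta)}(G^{\rm neum}_\delta*u)$. *)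

(* Defs.v *)
From Stdlib Require Import Reals.
From Coquelicot Require Import Coquelicot.
Open Scope R_scope.

Definition heatG (t r r' : R) : R :=
  exp (- (r - r') ^ 2 / (2 * t)) / sqrt (2 * PI * t).

(* Neumann Green function on [0,1]: sum over all images of r' under repeated
   reflections of [0,1], i.e. over the points 2k + r' and 2k - r', k in Z.
   Term n of the series collects k = n and k = -(n+1). *)
Definition Gneum (t r r' : R) : R :=
  Series (fun n : nat =>
    heatG t r (2 * INR n + r') + heatG t r (2 * INR n - r')
    + heatG t r (- 2 * (INR n + 1) + r') + heatG t r (- 2 * (INR n + 1) - r')).

(* (G^neum_t * u)(r) for u = c D_0 + rho. *)
Definition heat_conv (t c : R) (rho : R -> R) (r : R) : R :=
  c * Gneum t r 0 + RInt (fun r' => Gneum t r r' * rho r') 0 1.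

Definition is_cut_point (v : R -> R) (c Rc : R) : Prop :=
  0 <= Rc <= 1 /\ RInt v Rc 1 = c.

(* Density (absolutely continuous part) of K^{(delta)} v when the cut point is Rc:
   K v = j delta D_0 + 1_{[0,Rc]} v. *)
Definition cut_density (v : R -> R) (Rc : R) (r : R) : R :=
  if Rle_dec r Rc then v r else 0.

Definition stationary_density (j A delta : R) (rho : R -> R) : Prop :=
  let Rd := 1 - A * delta in
  let v := heat_conv delta (j * delta) rho in
  (forall r, 0 <= r <= 1 -> 0 <= rho r) /\
  (forall r, 0 <= r <= Rd ->
     filterlim rho (within (fun x => 0 <= x <= Rd) (locally r)) (locally (rho r))) /\
  (forall r, Rd < r <= 1 -> rho r = 0) /\
  is_cut_point v (j * delta) Rd /\
  (forall r, 0 <= r <= 1 -> cut_density v Rd r = rho r).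

(* Main.v *)
(** A stationary density is the restriction to [0, R] of a fixed point [v] of
    [v = j delta G(., 0) + int_0^R G(., s) v(s) ds].  The kernel loses mass on [0, R], so
    this is a contraction, and the cut condition follows from [int_0^1 G(r, .) = 1] by
    Fubini.  Written with the periodised Gaussian [theta], which decreases on [0, 1] for
    small times, the kernel preserves decreasing functions, hence [v] is decreasing.

    Since [v] is decreasing, the net flux through a point [a] is an integral of
    nonnegative terms bounded by the injected mass [j delta]; this makes [v] Lipschitz at
    scale [sqrt delta], uniformly in [delta].  The cut condition then forces
    [v 1 -> j / A].  Testing the fixed point equation against [phi] with [phi'' = q] (even
    about 0 and 1) and using [G phi - phi = (delta / 2) q + O(delta^(3/2))] gives
    [int_0^1 (v(s) - 2 j (1 - s)) q(s) ds -> 0] for every such [q] of mean zero.  Taking for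
    [q] a difference of tents at [a] and at 1, equicontinuity turns this into
    [v a - 2 j (1 - a) - v 1 -> 0]. *)

Require Import Defs.
From Stdlib Require Import Reals Lra Lia Psatz.
From Coquelicot Require Import Coquelicot.
Open Scope R_scope.
Set Bullet Behavior "Strict Subproofs".

(** The contraction factor on [0, R] tends to 1 as [delta] -> 0: it settles existence and uniqueness
    for each [delta] but controls nothing uniformly, so the uniform estimates rest on monotonicity
    and mass balance alone. The natural length is [h = sqrt delta], the range of one heat step. The
    cut strip, of width [A delta], is much shorter, and a fixed share of the kernel sits within a
    few [h]; a drop of [v] over one [h] thus drives a flux of order [h] times the drop, and flux at
    most [j h ^ 2] makes the drop O([h]).

    The slope [2 j] comes from the test identity. In one step mass [j delta] appears at 0 and the
    same mass disappears next to 1; the resulting change [j delta (phi 1 - phi 0)] must balance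
    [(delta / 2) int v q]. With [phi 0 = 0], [int v q] is close to
    [2 j phi 1 = int 2 j (1 - s) q(s) ds]. Evenness of [phi] about 0 and 1 forces
    [phi' 0 = phi' 1 = 0], whence mean zero for [q]: the tests see [v] only up to an additive
    constant, which the cut condition supplies. *)

(** * The Gaussian integral *)

(* [RInt_ext] leaves equations typed in a Coquelicot structure, which [ring] does not recognise. *)
Ltac eqR := lazymatch goal with |- @eq _ ?a ?b => change (@eq R a b) end.

Lemma ex_RInt_cont (f : R -> R) (a b : R) : (forall x, continuous f x) -> ex_RInt f a b.
Proof. intros H. apply (@ex_RInt_continuous R_CompleteNormedModule). intros; apply H. Qed.

Lemma continuous_of_derive (f : R -> R) (x : R) : ex_derive f x -> continuous f x.
Proof. apply (@ex_derive_continuous R_AbsRing R_NormedModule). Qed.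

Lemma RInt_lin (f : R -> R) (u v a b : R) : ex_RInt f (u * a + v) (u * b + v) ->
  RInt (fun y => u * f (u * y + v)) a b = RInt f (u * a + v) (u * b + v).
Proof. exact (RInt_comp_lin (V := R_CompleteNormedModule) f u v a b). Qed.

Lemma RInt_scal_R (f : R -> R) (k a b : R) : ex_RInt f a b ->
  RInt (fun y => k * f y) a b = k * RInt f a b.
Proof. exact (RInt_scal (V := R_CompleteNormedModule) f a b k). Qed.

Lemma RInt_plus_R (f g : R -> R) (a b : R) : ex_RInt f a b -> ex_RInt g a b ->
  RInt (fun y => f y + g y) a b = RInt f a b + RInt g a b.
Proof. exact (RInt_plus (V := R_CompleteNormedModule) f g a b). Qed.

Lemma RInt_minus_R (f g : R -> R) (a b : R) : ex_RInt f a b -> ex_RInt g a b ->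
  RInt (fun y => f y - g y) a b = RInt f a b - RInt g a b.
Proof. exact (RInt_minus (V := R_CompleteNormedModule) f g a b). Qed.

Lemma RInt_const_R (c a b : R) : RInt (fun _ => c) a b = (b - a) * c.
Proof. exact (RInt_const (V := R_CompleteNormedModule) a b c). Qed.

Definition gint (x : R) : R := RInt (fun s => exp (- s ^ 2)) 0 x.
(** The classical companion of the squared Gaussian integral: its derivative is the opposite of that
    of [gint ^ 2], so the sum stays at its value at 0, which is [atan 1]. *)
Definition gaux (x : R) : R := RInt (fun s => exp (- x ^ 2 * (1 + s ^ 2)) / (1 + s ^ 2)) 0 1.

Lemma continuous_gauss_std (x : R) : continuous (fun s => exp (- s ^ 2)) x.
Proof. apply continuous_of_derive. auto_derive; auto. Qed.

Lemma is_derive_gint (x : R) : is_derive gint x (exp (- x ^ 2)).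
Proof.
  apply (is_derive_RInt (fun s => exp (- s ^ 2)) gint 0).
  - exists (mkposreal _ Rlt_0_1); intros y _.
    apply (@RInt_correct R_CompleteNormedModule).
    apply ex_RInt_cont, continuous_gauss_std.
  - apply continuous_gauss_std.
Qed.

Lemma gint_scal (x : R) : RInt (fun s => x * exp (- (x * s) ^ 2)) 0 1 = gint x.
Proof.
  unfold gint.
  transitivity (RInt (fun s => exp (- s ^ 2)) (x * 0 + 0) (x * 1 + 0)).
  - rewrite <- RInt_lin by (apply ex_RInt_cont, continuous_gauss_std).
    apply RInt_ext; intros; now rewrite Rplus_0_r.
  - f_equal; ring.
Qed.

Lemma is_derive_gaux (x : R) : is_derive gaux x (- 2 * exp (- x ^ 2) * gint x).
Proof.
  set (f := fun x s : R => exp (- x ^ 2 * (1 + s ^ 2)) / (1 + s ^ 2)).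
  assert (pos : forall s : R, 0 < 1 + s ^ 2) by (intros; nra).
  assert (D : forall x s : R, is_derive (fun u => f u s) x (- 2 * x * exp (- x ^ 2 * (1 + s ^ 2)))).
  { intros y s; unfold f. auto_derive; [specialize (pos s); lra|].
    simpl; field; specialize (pos s); simpl in pos; nra. }
  replace (- 2 * exp (- x ^ 2) * gint x) with (RInt (fun s => Derive (fun u => f u s) x) 0 1).
  - apply (is_derive_RInt_param f 0 1 x).
    + exists (mkposreal _ Rlt_0_1); intros y _ s _. eexists; apply D.
    + intros s _.
      apply continuity_2d_pt_ext with (fun u v : R => - 2 * u * exp (- u ^ 2 * (1 + v ^ 2))).
      { intros u v; symmetry; apply is_derive_unique, D. }
      apply continuity_2d_pt_mult.
      * apply continuity_2d_pt_mult; [apply continuity_2d_pt_const | apply continuity_2d_pt_id1].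
      * apply (continuity_1d_2d_pt_comp exp); [apply derivable_continuous_pt, derivable_pt_exp|].
        apply continuity_2d_pt_mult.
        -- apply continuity_2d_pt_opp.
           apply (continuity_1d_2d_pt_comp (fun u => u ^ 2));
             [reg | apply continuity_2d_pt_id1].
        -- apply (continuity_1d_2d_pt_comp (fun u => 1 + u ^ 2));
             [reg | apply continuity_2d_pt_id2].
    + exists (mkposreal _ Rlt_0_1); intros y _. apply ex_RInt_cont.
      intros s; apply continuous_of_derive. unfold f; auto_derive. specialize (pos s); lra.
  - rewrite <- gint_scal.
    transitivity (RInt (fun s => (- 2 * exp (- x ^ 2)) * (x * exp (- (x * s) ^ 2))) 0 1).
    + apply RInt_ext; intros s _.
      transitivity (- 2 * x * exp (- x ^ 2 * (1 + s ^ 2))); [exact (is_derive_unique _ _ _ (D x s))|].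
      replace (- x ^ 2 * (1 + s ^ 2)) with (- x ^ 2 + - (x * s) ^ 2) by ring.
      rewrite exp_plus; eqR; ring.
    + rewrite RInt_scal_R; [reflexivity|].
      apply ex_RInt_cont; intros s; apply continuous_of_derive; auto_derive; auto.
Qed.

Lemma gint_sqr (x : R) : gint x ^ 2 + gaux x = PI / 4.
Proof.
  assert (H0 : gint 0 ^ 2 + gaux 0 = PI / 4).
  { unfold gint, gaux. rewrite RInt_point. change (@zero R_CompleteNormedModule) with 0.
    replace (RInt _ 0 1) with (atan 1 - atan 0).
    - rewrite atan_1, atan_0; lra.
    - symmetry; apply is_RInt_unique.
      apply (is_RInt_ext (fun s => / (1 + s ^ 2))).
      + intros s _. eqR; replace (- 0 ^ 2 * (1 + s ^ 2)) with 0 by ring.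
        rewrite exp_0; field; nra.
      + apply (is_RInt_derive atan).
        * intros s _. replace (/ (1 + s ^ 2)) with (/ (1 + Rsqr s)) by (unfold Rsqr; simpl; f_equal; ring).
          apply is_derive_atan.
        * intros s _. apply continuous_of_derive. auto_derive. nra. }
  rewrite <- H0.
  set (F := fun x => gint x ^ 2 + gaux x).
  assert (D : forall y, is_derive F y 0).
  { intros y; unfold F.
    replace 0 with (INR 2 * exp (- y ^ 2) * gint y ^ 1 + (- 2 * exp (- y ^ 2) * gint y)) by (simpl; ring).
    apply (@is_derive_plus R_AbsRing R_NormedModule).
    - apply (is_derive_pow gint 2 y). apply is_derive_gint.
    - apply is_derive_gaux. }
  change (F x = F 0).
  destruct (MVT_gen F 0 x (fun _ => 0)) as [c [_ Hc]].
  - intros; apply D.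
  - intros y _. apply continuity_pt_filterlim, (continuous_of_derive F). eexists; apply D.
  - lra.
Qed.

Lemma gaux_bound (x : R) : 0 <= gaux x <= exp (- x ^ 2).
Proof.
  assert (pos : forall s : R, 0 < 1 + s ^ 2) by (intros; nra).
  assert (E : ex_RInt (fun s => exp (- x ^ 2 * (1 + s ^ 2)) / (1 + s ^ 2)) 0 1).
  { apply ex_RInt_cont; intros s; apply continuous_of_derive. auto_derive. specialize (pos s); lra. }
  unfold gaux; split.
  - apply RInt_ge_0; [lra | exact E |].
    intros s _. apply Rlt_le, Rdiv_lt_0_compat; [apply exp_pos | apply pos].
  - replace (exp (- x ^ 2)) with (RInt (fun _ => exp (- x ^ 2)) 0 1).
    + apply RInt_le; [lra | exact E | apply ex_RInt_const |].
      intros s _. apply Rle_trans with (exp (- x ^ 2 * (1 + s ^ 2))).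
      * apply Rle_div_l; [apply pos|]. pose proof (exp_pos (- x ^ 2 * (1 + s ^ 2))). nra.
      * destruct (Req_dec (x * s) 0) as [e|e].
        -- right; f_equal. replace (- x ^ 2 * (1 + s ^ 2)) with (- x ^ 2 - (x * s) ^ 2) by ring.
           rewrite e; ring.
        -- left; apply exp_increasing. assert (0 < (x * s) ^ 2) by (apply pow2_gt_0, e). nra.
    + rewrite RInt_const_R; eqR; ring.
Qed.

Lemma exp_neg_le_inv (u : R) : 0 < u -> exp (- u) <= / u.
Proof.
  intros H. rewrite exp_Ropp. apply Rinv_le_contravar; [exact H|].
  pose proof (exp_ineq1_le u); lra.
Qed.

Lemma exp_le (x y : R) : x <= y -> exp x <= exp y.
Proof. intros [H|H]; [left; apply exp_increasing, H | right; now rewrite H]. Qed.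

Lemma gint_pos (x : R) : 0 <= x -> 0 <= gint x.
Proof.
  intros H; unfold gint; apply RInt_ge_0; [exact H| |].
  - apply ex_RInt_cont, continuous_gauss_std.
  - intros; left; apply exp_pos.
Qed.

(** [gaux x] lies between 0 and [exp (- x ^ 2)], hence vanishes at infinity and leaves [gint ^ 2] ->
    [PI / 4]. The index is shifted to [S N] so that the comparison with an inverse makes sense. *)
Lemma is_lim_seq_gint (c : R) : 0 < c ->
  is_lim_seq (fun N => gint (c * INR N)) (sqrt PI / 2).
Proof.
  intros hc.
  assert (L : is_lim_seq (fun N => PI / 4 - gaux (c * INR (S N))) (PI / 4)).
  { replace (Finite (PI / 4)) with (Rbar_minus (PI / 4) 0) by (simpl; f_equal; lra).
    apply is_lim_seq_minus'; [apply is_lim_seq_const|].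
    apply is_lim_seq_le_le with (fun _ => 0) (fun N => / c ^ 2 * / INR (S N)).
    - intros N. destruct (gaux_bound (c * INR (S N))) as [H1 H2]. split; [exact H1|].
      pose proof (lt_0_INR (S N) ltac:(lia)) as HN.
      assert (1 <= INR (S N)) by (apply (le_INR 1); lia).
      eapply Rle_trans; [exact H2|].
      eapply Rle_trans; [apply exp_neg_le_inv, pow_lt, Rmult_lt_0_compat; assumption|].
      rewrite <- Rinv_mult. pose proof (pow_lt c 2 hc). apply Rinv_le_contravar.
      + apply Rmult_lt_0_compat; assumption.
      + rewrite Rpow_mult_distr. apply Rmult_le_compat_l; nra.
    - apply is_lim_seq_const.
    - replace (Finite 0) with (Rbar_mult (/ c ^ 2) 0) by (simpl; f_equal; ring).
      apply is_lim_seq_scal_l.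
      apply is_lim_seq_incr_1 with (u := fun n => / INR n).
      replace (Finite 0) with (Rbar_inv p_infty) by reflexivity.
      apply is_lim_seq_inv; [apply is_lim_seq_INR | discriminate]. }
  apply is_lim_seq_incr_1 with (u := fun N => gint (c * INR N)).
  assert (E : sqrt (PI / 4) = sqrt PI / 2).
  { rewrite sqrt_div_alt by lra. f_equal. replace 4 with (2 * 2) by lra. apply sqrt_square; lra. }
  rewrite <- E.
  apply is_lim_seq_ext with (fun N => sqrt (PI / 4 - gaux (c * INR (S N)))).
  - intros N. rewrite <- (gint_sqr (c * INR (S N))).
    replace (_ + _ - _) with (gint (c * INR (S N)) ^ 2) by ring.
    apply sqrt_pow2. apply gint_pos.
    pose proof (pos_INR (S N)); nra.
  - apply (is_lim_seq_continuous sqrt); [|exact L].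
    apply continuity_pt_sqrt. pose proof PI_RGT_0; lra.
Qed.

(** * The periodised Gaussian *)

Definition gauss (t x : R) : R := exp (- x ^ 2 / (2 * t)) / sqrt (2 * PI * t).

Lemma sqrt_gauss_pos (t : R) : 0 < t -> 0 < sqrt (2 * PI * t).
Proof. intros; apply sqrt_lt_R0. pose proof PI_RGT_0; nra. Qed.

Lemma sqrt_le_sqrt_gauss (t : R) : 0 < t -> sqrt t <= sqrt (2 * PI * t).
Proof. intros; apply sqrt_le_1_alt. pose proof PI2_1; nra. Qed.

Lemma gauss_pos (t x : R) : 0 < t -> 0 < gauss t x.
Proof. intros; apply Rdiv_lt_0_compat; [apply exp_pos | now apply sqrt_gauss_pos]. Qed.

Lemma gauss_even (t x : R) : gauss t (- x) = gauss t x.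
Proof. unfold gauss; do 3 f_equal; ring. Qed.

Lemma gauss_le (t x y : R) : 0 < t -> x ^ 2 <= y ^ 2 -> gauss t y <= gauss t x.
Proof.
  intros ht H; unfold gauss, Rdiv. apply Rmult_le_compat_r.
  - left; apply Rinv_0_lt_compat, sqrt_gauss_pos, ht.
  - apply exp_le. apply Rmult_le_compat_r; [left; apply Rinv_0_lt_compat; lra | lra].
Qed.

Lemma is_derive_gauss (t x : R) : 0 < t -> is_derive (gauss t) x (- (x / t) * gauss t x).
Proof.
  intros ht. pose proof (sqrt_gauss_pos t ht). unfold gauss.
  auto_derive; [repeat split; lra|].
  unfold Rdiv; simpl; field; split; lra.
Qed.

Lemma continuous_gauss (t x : R) : 0 < t -> continuous (gauss t) x.
Proof. intros ht; apply continuous_of_derive; eexists; apply is_derive_gauss, ht. Qed.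

(** One constant that dominates both [gauss t] and its derivative by [exp (- x)]; the summand [/ t]
    is there for the factor [x / t] of the derivative. *)
Definition gaussC (t : R) : R := exp (2 * t) * (1 + / t) / sqrt (2 * PI * t).

Lemma gaussC_pos (t : R) : 0 < t -> 0 < gaussC t.
Proof.
  intros ht; unfold gaussC. apply Rdiv_lt_0_compat; [|apply sqrt_gauss_pos, ht].
  apply Rmult_lt_0_compat; [apply exp_pos|]. pose proof (Rinv_0_lt_compat _ ht); lra.
Qed.

(** This is [(Rabs x - 2 * t) ^ 2 >= 0]. The rate 2 leaves one factor [exp (- Rabs x)] to spare for
    the derivative. *)
Lemma gauss_exp_aux (t x : R) : 0 < t -> gauss t x <= exp (2 * t) * exp (- (2 * Rabs x)) / sqrt (2 * PI * t).
Proof.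
  intros ht; unfold gauss. apply Rmult_le_compat_r.
  - left; apply Rinv_0_lt_compat, sqrt_gauss_pos, ht.
  - rewrite <- exp_plus. apply exp_le. apply Rle_div_l; [lra|].
    rewrite <- (pow2_abs x). pose proof (pow2_ge_0 (Rabs x - 2 * t)). nra.
Qed.

Lemma gauss_le_exp (t x : R) : 0 < t -> gauss t x <= gaussC t * exp (- x).
Proof.
  intros ht; eapply Rle_trans; [apply gauss_exp_aux, ht|].
  unfold gaussC, Rdiv.
  rewrite (Rmult_assoc _ (/ sqrt _)), (Rmult_comm (/ sqrt _)), <- Rmult_assoc.
  apply Rmult_le_compat_r; [left; apply Rinv_0_lt_compat, sqrt_gauss_pos, ht|].
  rewrite Rmult_assoc. apply Rmult_le_compat_l; [left; apply exp_pos|].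
  pose proof (Rinv_0_lt_compat _ ht). pose proof (exp_pos (- x)).
  assert (exp (- (2 * Rabs x)) <= exp (- x)).
  { apply exp_le. pose proof (Rle_abs x). pose proof (Rabs_pos x). lra. }
  nra.
Qed.

(** Of the two factors [exp (- Rabs x)] given by [gauss_exp_aux], one absorbs [Rabs x] and the other
    is at most [exp (- x)]. *)
Lemma dgauss_le_exp (t x : R) : 0 < t -> Rabs (- (x / t) * gauss t x) <= gaussC t * exp (- x).
Proof.
  intros ht. pose proof (gauss_pos t x ht) as hg. pose proof (Rinv_0_lt_compat _ ht).
  rewrite Rabs_mult, Rabs_Ropp, (Rabs_pos_eq (gauss t x)) by lra.
  unfold Rdiv; rewrite Rabs_mult, (Rabs_pos_eq (/ t)) by lra.
  apply Rle_trans with (Rabs x * / t * (exp (2 * t) * exp (- (2 * Rabs x)) / sqrt (2 * PI * t))).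
  - apply Rmult_le_compat_l; [|apply gauss_exp_aux, ht].
    apply Rmult_le_pos; [apply Rabs_pos | lra].
  - unfold gaussC.
    replace (exp (2 * t) * (1 + / t) / sqrt (2 * PI * t) * exp (- x))
      with (exp (2 * t) / sqrt (2 * PI * t) * ((1 + / t) * exp (- x))) by (unfold Rdiv; ring).
    replace (Rabs x * / t * (exp (2 * t) * exp (- (2 * Rabs x)) / sqrt (2 * PI * t)))
      with (exp (2 * t) / sqrt (2 * PI * t) * (/ t * (Rabs x * exp (- (2 * Rabs x)))))
      by (unfold Rdiv; ring).
    apply Rmult_le_compat_l.
    { left; apply Rdiv_lt_0_compat; [apply exp_pos | apply sqrt_gauss_pos, ht]. }
    assert (Rabs x * exp (- (2 * Rabs x)) <= exp (- x)).
    { replace (- (2 * Rabs x)) with (- Rabs x + - Rabs x) by ring.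
      rewrite exp_plus, <- Rmult_assoc.
      assert (Rabs x * exp (- Rabs x) <= 1).
      { rewrite exp_Ropp. apply Rle_div_l; [apply exp_pos|].
        pose proof (exp_ineq1_le (Rabs x)); lra. }
      assert (exp (- Rabs x) <= exp (- x)) by (apply exp_le; pose proof (Rle_abs x); lra).
      pose proof (exp_pos (- Rabs x)). nra. }
    pose proof (exp_pos (- x)). nra.
Qed.

Lemma gauss_lip (t K x y : R) : 0 < t -> K <= x -> K <= y ->
  Rabs (gauss t x - gauss t y) <= gaussC t * exp (- K) * Rabs (x - y).
Proof.
  intros ht hx hy.
  destruct (MVT_gen (gauss t) y x (fun x => - (x / t) * gauss t x)) as [c [hc ->]].
  - intros; apply is_derive_gauss, ht.
  - intros z _; apply continuity_pt_filterlim, (continuous_gauss t z ht).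
  - rewrite Rabs_mult. apply Rmult_le_compat_r; [apply Rabs_pos|].
    eapply Rle_trans; [apply dgauss_le_exp, ht|].
    apply Rmult_le_compat_l; [left; apply gaussC_pos, ht|].
    apply exp_le. assert (K <= Rmin y x) by (now apply Rmin_glb). lra.
Qed.

Lemma exp_m2_le : exp (- 2) <= / 2.
Proof. apply exp_neg_le_inv; lra. Qed.

Lemma exp_m2_abs : Rabs (exp (- 2)) < 1.
Proof. pose proof exp_m2_le. rewrite Rabs_pos_eq; [lra | left; apply exp_pos]. Qed.

Lemma exp_shift (n : nat) (y : R) : exp (- (2 * INR n + y)) = exp (- y) * exp (- 2) ^ n.
Proof.
  rewrite <- Rpower_pow by apply exp_pos. unfold Rpower. rewrite ln_exp, <- exp_plus.
  f_equal; ring.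
Qed.

Definition gsum (t y : R) : R := Series (fun n => gauss t (2 * INR n + y)).

Lemma ex_gsum (t y : R) : 0 < t -> ex_series (fun n => gauss t (2 * INR n + y)).
Proof.
  intros ht.
  apply (@ex_series_le R_AbsRing R_CompleteNormedModule _ (fun n => gaussC t * exp (- y) * exp (- 2) ^ n)).
  - intros n. unfold norm; simpl; unfold abs; simpl.
    rewrite Rabs_pos_eq by (left; now apply gauss_pos).
    rewrite Rmult_assoc, <- exp_shift. now apply gauss_le_exp.
  - apply (@ex_series_scal R_AbsRing R_NormedModule), ex_series_geom, exp_m2_abs.
Qed.

Lemma gsum_unfold (t y : R) : 0 < t -> gsum t y = gauss t y + gsum t (2 + y).
Proof.
  intros ht; unfold gsum. rewrite Series_incr_1 by now apply ex_gsum. f_equal.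
  - f_equal; simpl; ring.
  - apply Series_ext; intros n. rewrite S_INR; f_equal; ring.
Qed.

Lemma Series_ge0 (a : nat -> R) : (forall n, 0 <= a n) -> ex_series a -> 0 <= Series a.
Proof.
  intros H E. replace 0 with (Series (fun n => 0 * a n)).
  - apply Series_le; [|exact E]. intros n; specialize (H n); lra.
  - rewrite Series_scal_l; ring.
Qed.

Lemma gsum_ge0 (t y : R) : 0 < t -> 0 <= gsum t y.
Proof. intros ht; apply Series_ge0; [intros; left; now apply gauss_pos | now apply ex_gsum]. Qed.

(** The Lipschitz constants of the terms decay like [exp (- 2) ^ n]; the factor 2 bounds the sum of
    this geometric series. *)
Lemma gsum_lip (t K x y : R) : 0 < t -> K <= x -> K <= y ->
  Rabs (gsum t x - gsum t y) <= 2 * gaussC t * exp (- K) * Rabs (x - y).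
Proof.
  intros ht hx hy. unfold gsum. rewrite <- Series_minus by now apply ex_gsum.
  set (M := gaussC t * exp (- K) * Rabs (x - y)).
  assert (M0 : 0 <= M).
  { apply Rmult_le_pos; [|apply Rabs_pos]. left; apply Rmult_lt_0_compat; [now apply gaussC_pos | apply exp_pos]. }
  assert (E : ex_series (fun n => M * exp (- 2) ^ n)).
  { apply (@ex_series_scal R_AbsRing R_NormedModule), ex_series_geom, exp_m2_abs. }
  assert (B : forall n, Rabs (gauss t (2 * INR n + x) - gauss t (2 * INR n + y)) <= M * exp (- 2) ^ n).
  { intros n. eapply Rle_trans; [apply gauss_lip with (K := 2 * INR n + K); lra|].
    rewrite exp_shift. right; unfold M.
    replace (2 * INR n + x - (2 * INR n + y)) with (x - y) by ring. ring. }
  eapply Rle_trans.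
  - apply Series_Rabs. apply (@ex_series_le R_AbsRing R_CompleteNormedModule _ (fun n => M * exp (- 2) ^ n)).
    + intros n. unfold norm; simpl; unfold abs; simpl. rewrite Rabs_Rabsolu. apply B.
    + exact E.
  - eapply Rle_trans; [apply Series_le; [intros n; split; [apply Rabs_pos | apply B] | exact E]|].
    rewrite Series_scal_l, Series_geom by apply exp_m2_abs.
    replace (2 * gaussC t * exp (- K) * Rabs (x - y)) with (M * 2) by (unfold M; ring).
    apply Rmult_le_compat_l; [exact M0|].
    pose proof exp_m2_le. rewrite <- (Rinv_inv 2). apply Rinv_le_contravar; lra.
Qed.

(** The Gaussian summed over [y + 2 Z]: by evenness of [gauss], the terms of [gsum t (2 - y)] are
    those at [y - 2], [y - 4], and so on. Two one-sided sums fit series indexed by [nat]. *)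
Definition theta (t y : R) : R := gsum t y + gsum t (2 - y).

Lemma theta_refl (t y : R) : theta t (2 - y) = theta t y.
Proof. unfold theta. replace (2 - (2 - y)) with y by ring. ring. Qed.

Lemma theta_expand (t y : R) : 0 < t -> theta t y = gauss t y + gsum t (2 + y) + gsum t (2 - y).
Proof. intros ht; unfold theta. rewrite (gsum_unfold t y ht). ring. Qed.

(** The two halves of [theta] are not exchanged by [y -> - y]. Once the central term is peeled off,
    the remaining two series are. *)
Lemma theta_even (t y : R) : 0 < t -> theta t (- y) = theta t y.
Proof.
  intros ht. rewrite !theta_expand by exact ht. rewrite gauss_even.
  replace (2 - - y) with (2 + y) by ring. replace (2 + - y) with (2 - y) by ring. ring.
Qed.

Lemma gauss_le_theta (t y : R) : 0 < t -> gauss t y <= theta t y.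
Proof.
  intros ht; rewrite theta_expand by exact ht.
  pose proof (gsum_ge0 t (2 + y) ht); pose proof (gsum_ge0 t (2 - y) ht); lra.
Qed.

Lemma theta_pos (t y : R) : 0 < t -> 0 < theta t y.
Proof. intros ht; pose proof (gauss_pos t y ht); pose proof (gauss_le_theta t y ht); lra. Qed.

Lemma theta_lip (t M : R) : 0 < t -> exists L, 0 <= L /\
  forall x y, Rabs x <= M -> Rabs y <= M -> Rabs (theta t x - theta t y) <= L * Rabs (x - y).
Proof.
  intros ht. exists (2 * gaussC t * exp (- - M) + 2 * gaussC t * exp (- (2 - M))).
  pose proof (gaussC_pos t ht); pose proof (exp_pos (- - M)); pose proof (exp_pos (- (2 - M))).
  split; [nra|]. intros x y hx hy.
  apply Rabs_le_between in hx; apply Rabs_le_between in hy.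
  unfold theta.
  replace (gsum t x + gsum t (2 - x) - (gsum t y + gsum t (2 - y)))
    with ((gsum t x - gsum t y) + (gsum t (2 - x) - gsum t (2 - y))) by ring.
  eapply Rle_trans; [apply Rabs_triang|]. rewrite Rmult_plus_distr_r. apply Rplus_le_compat.
  - apply gsum_lip; lra.
  - rewrite (Rabs_minus_sym x y). replace (y - x) with ((2 - x) - (2 - y)) by ring.
    apply gsum_lip; lra.
Qed.

Lemma continuous_lip (f : R -> R) (x L : R) :
  (forall y, Rabs (y - x) <= 1 -> Rabs (f y - f x) <= L * Rabs (y - x)) -> continuous f x.
Proof.
  intros H. apply filterlim_locally. intros eps.
  assert (hL : 0 < Rmax L 0 + 1) by (pose proof (Rmax_r L 0); lra).
  assert (hd : 0 < Rmin 1 (eps / (Rmax L 0 + 1))).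
  { apply Rmin_glb_lt; [lra|]. apply Rdiv_lt_0_compat; [apply cond_pos | exact hL]. }
  exists (mkposreal _ hd). intros y hy.
  assert (hy' : Rabs (y - x) < Rmin 1 (eps / (Rmax L 0 + 1))) by exact hy.
  pose proof (Rmin_l 1 (eps / (Rmax L 0 + 1))). pose proof (Rmin_r 1 (eps / (Rmax L 0 + 1))).
  change (Rabs (f y - f x) < eps).
  eapply Rle_lt_trans; [apply H; lra|].
  assert (Rabs (y - x) * (Rmax L 0 + 1) < eps) by (apply Rlt_div_r; lra).
  pose proof (Rmax_l L 0). pose proof (Rabs_pos (y - x)). nra.
Qed.

Lemma continuous_theta (t y : R) : 0 < t -> continuous (theta t) y.
Proof.
  intros ht. destruct (theta_lip t (Rabs y + 1) ht) as [L [_ H]].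
  apply continuous_lip with L. intros z hz. apply H; [|lra].
  replace z with ((z - y) + y) by ring. eapply Rle_trans; [apply Rabs_triang | lra].
Qed.

(** The images of [s] form [s + 2 Z] and [- s + 2 Z], which give [theta t (s - r)] and
    [theta t (- (r + s))]. The four terms grouped at index [n] are exactly the [n]-th terms of the
    four one-sided sums. *)
Lemma Gneum_theta (t r s : R) : 0 < t -> Gneum t r s = theta t (s - r) + theta t (r + s).
Proof.
  intros ht. rewrite <- (theta_even t (r + s) ht). unfold theta, gsum.
  rewrite <- !Series_plus; try apply ex_gsum; try assumption;
    try (apply (@ex_series_plus R_AbsRing R_NormedModule); now apply ex_gsum).
  apply Series_ext; intros n.
  assert (E : forall a b, heatG t a b = gauss t (b - a)).
  { intros a b; unfold heatG, gauss. do 3 f_equal; ring. }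
  rewrite !E.
  replace (2 * INR n + s - r) with (2 * INR n + (s - r)) by ring.
  replace (2 * INR n - s - r) with (2 * INR n + - (r + s)) by ring.
  replace (-2 * (INR n + 1) + s - r) with (- (2 * INR n + (2 - (s - r)))) by ring.
  replace (-2 * (INR n + 1) - s - r) with (- (2 * INR n + (2 - - (r + s)))) by ring.
  rewrite !gauss_even. ring.
Qed.

(** Since [(2 n + 1) ^ 2 >= 1 + 4 n t] for [t <= 1], each exponent is at most [- 1 / (2 t) - 2 n],
    which leaves a geometric series of ratio [exp (- 2)]. *)
Lemma gsum_tail (t x : R) : 0 < t <= 1 -> 1 <= x ->
  gsum t x <= 2 * (exp (- / (2 * t)) / sqrt (2 * PI * t)).
Proof.
  intros [ht ht1] hx. unfold gsum.
  set (M := exp (- / (2 * t)) / sqrt (2 * PI * t)).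
  pose proof (sqrt_gauss_pos t ht) as hs.
  assert (M0 : 0 < M) by (apply Rdiv_lt_0_compat; [apply exp_pos | exact hs]).
  eapply Rle_trans; [apply Series_le with (b := fun n => M * exp (- 2) ^ n)|].
  - intros n. split; [left; now apply gauss_pos|].
    pose proof (pos_INR n).
    eapply Rle_trans; [apply (gauss_le t (2 * INR n + 1)); [exact ht | nra]|].
    replace (exp (- 2) ^ n) with (exp (- (2 * INR n))).
    2:{ rewrite <- (Rmult_1_l (exp (-2) ^ n)), <- exp_0, <- Ropp_0, <- exp_shift. f_equal; ring. }
    unfold gauss, M, Rdiv.
    rewrite (Rmult_assoc (exp (- / (2 * t)))), (Rmult_comm (/ sqrt _)), <- Rmult_assoc.
    apply Rmult_le_compat_r; [left; now apply Rinv_0_lt_compat|].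
    rewrite <- exp_plus. apply exp_le.
    apply (Rle_div_l (- (2 * INR n + 1) ^ 2)); [lra|].
    replace ((- / (2 * t) + - (2 * INR n)) * (2 * t)) with (- 1 - 4 * INR n * t) by (field; lra).
    nra.
  - apply (@ex_series_scal R_AbsRing R_NormedModule), ex_series_geom, exp_m2_abs.
  - rewrite Series_scal_l, Series_geom by apply exp_m2_abs.
    rewrite (Rmult_comm 2). apply Rmult_le_compat_l; [lra|].
    pose proof exp_m2_le. rewrite <- (Rinv_inv 2). apply Rinv_le_contravar; lra.
Qed.

(** The tail is exponentially small, but order [t ^ (3/2)] suffices: it is negligible against the
    heat increment of order [t]. The 16 is the square of 4 in [exp (- / (4 * t)) <= 4 * t]. *)
Lemma exp_tail_small (t : R) : 0 < t -> exp (- / (2 * t)) / sqrt (2 * PI * t) <= 16 * t * sqrt t.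
Proof.
  intros ht. pose proof (sqrt_lt_R0 t ht). pose proof (sqrt_le_sqrt_gauss t ht).
  apply Rle_div_l; [now apply sqrt_gauss_pos|].
  assert (E : exp (- / (2 * t)) <= 16 * t ^ 2).
  { replace (- / (2 * t)) with (- / (4 * t) + - / (4 * t)) by (field; lra).
    rewrite exp_plus.
    assert (exp (- / (4 * t)) <= 4 * t).
    { rewrite <- (Rinv_inv (4 * t)) at 2. apply exp_neg_le_inv, Rinv_0_lt_compat; lra. }
    pose proof (exp_pos (- / (4 * t))). nra. }
  assert (sqrt t * sqrt t = t) by (apply sqrt_sqrt; lra).
  assert (t <= sqrt t * sqrt (2 * PI * t)) by nra. nra.
Qed.

(** Each of the two outer series is at most twice the bound [16 t sqrt t] on the tail, hence 64. *)
Lemma theta_le (t y : R) : 0 < t <= 1 -> -1 <= y <= 1 -> theta t y <= gauss t y + 64 * t * sqrt t.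
Proof.
  intros ht hy. rewrite theta_expand by lra.
  pose proof (gsum_tail t (2 + y) ht ltac:(lra)). pose proof (gsum_tail t (2 - y) ht ltac:(lra)).
  pose proof (exp_tail_small t ltac:(lra)). lra.
Qed.

Lemma gsum_le_exp (t x : R) : 0 < t -> gsum t x <= 2 * gaussC t * exp (- x).
Proof.
  intros ht. unfold gsum.
  set (M := gaussC t * exp (- x)).
  assert (M0 : 0 < M) by (apply Rmult_lt_0_compat; [now apply gaussC_pos | apply exp_pos]).
  eapply Rle_trans; [apply Series_le with (b := fun n => M * exp (- 2) ^ n)|].
  - intros n. split; [left; now apply gauss_pos|].
    unfold M; rewrite Rmult_assoc, <- exp_shift. now apply gauss_le_exp.
  - apply (@ex_series_scal R_AbsRing R_NormedModule), ex_series_geom, exp_m2_abs.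
  - rewrite Series_scal_l, Series_geom by apply exp_m2_abs.
    replace (2 * gaussC t * exp (- x)) with (M * 2) by (unfold M; ring).
    apply Rmult_le_compat_l; [lra|].
    pose proof exp_m2_le. rewrite <- (Rinv_inv 2). apply Rinv_le_contravar; lra.
Qed.

Lemma continuous_gsum (t y : R) : 0 < t -> continuous (gsum t) y.
Proof.
  intros ht. apply continuous_lip with (2 * gaussC t * exp (- (y - 1))).
  intros z hz. apply Rabs_le_between in hz. apply gsum_lip; lra.
Qed.

(** * Total mass of the periodised Gaussian *)

Lemma RInt_Chasles_R (f : R -> R) (a b c : R) : (forall x, continuous f x) ->
  RInt f a b + RInt f b c = RInt f a c.
Proof.
  intros H. apply (RInt_Chasles (V := R_CompleteNormedModule)); now apply ex_RInt_cont.
Qed.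

Lemma RInt_shift (f : R -> R) (v a b : R) : (forall x, continuous f x) ->
  RInt (fun y => f (y + v)) a b = RInt f (a + v) (b + v).
Proof.
  intros H. replace (RInt f (a + v) (b + v)) with (RInt f (1 * a + v) (1 * b + v)) by (f_equal; ring).
  rewrite <- RInt_lin by now apply ex_RInt_cont.
  apply RInt_ext; intros; eqR. now rewrite !Rmult_1_l.
Qed.

Lemma RInt_refl (f : R -> R) (v a b : R) : (forall x, continuous f x) ->
  RInt (fun y => f (v - y)) a b = RInt f (v - b) (v - a).
Proof.
  intros H. rewrite <- (opp_RInt_swap (V := R_CompleteNormedModule) f) by now apply ex_RInt_cont.
  replace (RInt f (v - a) (v - b)) with (RInt f (-1 * a + v) (-1 * b + v)) by (f_equal; ring).
  rewrite <- RInt_lin by now apply ex_RInt_cont.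
  rewrite RInt_scal_R.
  - assert (F : forall b : R, b = - (-1 * b)) by (intros; ring).
    refine (eq_trans _ (F _)).
    apply RInt_ext; intros; eqR. f_equal; ring.
  - apply ex_RInt_cont; intros x. apply (continuous_comp (fun y => -1 * y + v) f); [|apply H].
    apply continuous_of_derive. auto_derive; auto.
Qed.

Lemma RInt_gauss_gint (t X : R) : 0 < t -> RInt (gauss t) 0 X = / sqrt PI * gint (/ sqrt (2 * t) * X).
Proof.
  intros ht. pose proof PI_RGT_0 as hpi.
  pose proof (sqrt_lt_R0 PI hpi). pose proof (sqrt_lt_R0 (2 * t) ltac:(lra)).
  unfold gint.
  replace (RInt _ 0 (/ sqrt (2 * t) * X)) with
    (RInt (fun s => exp (- s ^ 2)) (/ sqrt (2 * t) * 0 + 0) (/ sqrt (2 * t) * X + 0)) by (f_equal; ring).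
  rewrite <- RInt_lin by apply ex_RInt_cont, continuous_gauss_std.
  rewrite <- RInt_scal_R.
  - apply RInt_ext; intros s _; eqR. unfold gauss.
    replace (2 * PI * t) with (PI * (2 * t)) by ring. rewrite sqrt_mult by lra.
    replace (- (/ sqrt (2 * t) * s + 0) ^ 2) with (- s ^ 2 / (2 * t)).
    + field; split; lra.
    + rewrite <- (sqrt_sqrt (2 * t)) at 1 by lra. field; lra.
  - apply ex_RInt_cont; intros s. apply continuous_of_derive. auto_derive; auto.
Qed.

Lemma is_lim_seq_gauss (t : R) : 0 < t ->
  is_lim_seq (fun N => RInt (gauss t) 0 (2 * INR N)) (1 / 2).
Proof.
  intros ht. pose proof (sqrt_lt_R0 PI PI_RGT_0). pose proof (sqrt_lt_R0 (2 * t) ltac:(lra)).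
  apply is_lim_seq_ext with (fun N => / sqrt PI * gint ((2 * / sqrt (2 * t)) * INR N)).
  - intros N. rewrite RInt_gauss_gint by exact ht. do 2 f_equal; ring.
  - replace (Finite (1 / 2)) with (Rbar_mult (/ sqrt PI) (sqrt PI / 2)) by (simpl; f_equal; field; lra).
    apply is_lim_seq_scal_l, is_lim_seq_gint.
    apply Rmult_lt_0_compat; [lra | now apply Rinv_0_lt_compat].
Qed.

(** Moving the window [0, 2] by one period peels off one term of [gsum], that is, the Gaussian
    integral over that window. *)
Lemma RInt_gsum_telescope (t : R) (N : nat) : 0 < t ->
  RInt (gsum t) 0 2 = RInt (gauss t) 0 (2 * INR N) + RInt (gsum t) (2 * INR N) (2 * INR N + 2).
Proof.
  intros ht. induction N as [|N IH].
  - simpl INR. rewrite Rmult_0_r, RInt_point. change (@zero R_CompleteNormedModule) with 0.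
    rewrite !Rplus_0_l; reflexivity.
  - rewrite IH.
    assert (E : RInt (gsum t) (2 * INR N) (2 * INR N + 2) =
      RInt (gauss t) (2 * INR N) (2 * INR N + 2) + RInt (gsum t) (2 * INR (S N)) (2 * INR (S N) + 2)).
    { replace (2 * INR (S N)) with (2 * INR N + 2) by (rewrite S_INR; ring).
      rewrite <- (RInt_shift (gsum t) 2) by (intros; now apply continuous_gsum).
      rewrite <- RInt_plus_R.
      - apply RInt_ext; intros x _; eqR. rewrite (gsum_unfold t x ht). f_equal; f_equal; ring.
      - apply ex_RInt_cont; intros; now apply continuous_gauss.
      - apply ex_RInt_cont; intros x. apply (continuous_comp (fun y => y + 2) (gsum t));
          [apply continuous_of_derive; auto_derive; auto | now apply continuous_gsum]. }
    rewrite E, <- Rplus_assoc, RInt_Chasles_R by (intros; now apply continuous_gauss).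
    f_equal. f_equal. rewrite S_INR; ring.
Qed.

(** The reflection [y -> 2 - y] turns the second half of [theta] into the integral of [gsum] over
    [1, 2]. The integral of [gsum] over [0, 2] then unrolls to the Gaussian over the half-line, with
    a geometrically small remainder. *)
Lemma RInt_theta (t : R) : 0 < t -> RInt (theta t) 0 1 = 1 / 2.
Proof.
  intros ht.
  assert (cg : forall x, continuous (gsum t) x) by (intros; now apply continuous_gsum).
  assert (E : RInt (theta t) 0 1 = RInt (gsum t) 0 2).
  { unfold theta. rewrite RInt_plus_R.
    - rewrite RInt_refl by exact cg. replace (2 - 1) with 1 by ring. rewrite Rminus_0_r.
      now apply RInt_Chasles_R.
    - now apply ex_RInt_cont.
    - apply ex_RInt_cont; intros x. apply (continuous_comp (fun y => 2 - y) (gsum t));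
          [apply continuous_of_derive; auto_derive; auto | apply cg]. }
  rewrite E.
  assert (L : is_lim_seq (fun N => RInt (gsum t) (2 * INR N) (2 * INR N + 2)) 0).
  { apply is_lim_seq_le_le with (fun _ => 0) (fun N => 4 * gaussC t * exp (- 2) ^ N).
    - intros N. split.
      + apply RInt_ge_0; [lra | now apply ex_RInt_cont|]. intros; now apply gsum_ge0.
      + replace (4 * gaussC t * exp (-2) ^ N)
          with (RInt (fun _ => 2 * gaussC t * exp (- 2) ^ N) (2 * INR N) (2 * INR N + 2))
          by (rewrite RInt_const_R; eqR; ring).
        apply RInt_le; [lra | now apply ex_RInt_cont | apply ex_RInt_const|].
        intros x hx. eapply Rle_trans; [now apply gsum_le_exp|].
        pose proof (gaussC_pos t ht). apply Rmult_le_compat_l; [lra|].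
        replace (exp (- 2) ^ N) with (exp (- (2 * INR N + 0))) by
          (rewrite exp_shift, Ropp_0, exp_0; ring).
        apply exp_le; lra.
    - apply is_lim_seq_const.
    - replace (Finite 0) with (Rbar_mult (4 * gaussC t) 0) by (simpl; f_equal; ring).
      apply is_lim_seq_scal_l, is_lim_seq_geom, exp_m2_abs. }
  assert (L2 : is_lim_seq (fun _ => RInt (gsum t) 0 2) (1 / 2 + 0)).
  { apply is_lim_seq_ext with
      (fun N => RInt (gauss t) 0 (2 * INR N) + RInt (gsum t) (2 * INR N) (2 * INR N + 2)).
    - intros N; symmetry; now apply RInt_gsum_telescope.
    - apply is_lim_seq_plus'; [now apply is_lim_seq_gauss | exact L]. }
  apply is_lim_seq_unique in L2. rewrite Lim_seq_const in L2. injection L2; lra.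
Qed.

(** * Monotonicity of the periodised Gaussian on [0, 1] *)

Lemma nonincreasing_of_derive (f df : R -> R) (a b : R) :
  (forall x, a <= x <= b -> is_derive f x (df x)) ->
  (forall x, a <= x <= b -> df x <= 0) ->
  forall x y, a <= x -> x <= y -> y <= b -> f y <= f x.
Proof.
  intros D N x y hax hxy hyb.
  destruct (MVT_gen f x y df) as [c [hc E]].
  - rewrite Rmin_left, Rmax_right by lra. intros z hz; apply D; lra.
  - rewrite Rmin_left, Rmax_right by lra. intros z hz.
    apply continuity_pt_filterlim, (continuous_of_derive f). eexists; apply D; lra.
  - rewrite Rmin_left, Rmax_right in hc by lra.
    assert (df c <= 0) by (apply N; lra). nra.
Qed.

(** Expanding the square: relative to [gauss t y], the images at [N + y] and [N - y] differ only by
    [exp (- N y / t)] and [exp (N y / t)], so signs of derivatives reduce to comparing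
    exponentials. *)
Lemma gauss_add (t N y : R) : 0 < t ->
  gauss t (N + y) = gauss t y * (exp (- (N ^ 2 / (2 * t))) * exp (- (N * y / t))).
Proof.
  intros ht. unfold gauss. rewrite <- exp_plus.
  replace (exp (- y ^ 2 / (2 * t)) / sqrt (2 * PI * t) * exp (- (N ^ 2 / (2 * t)) + - (N * y / t)))
    with (exp (- y ^ 2 / (2 * t)) * exp (- (N ^ 2 / (2 * t)) + - (N * y / t)) / sqrt (2 * PI * t))
    by (unfold Rdiv; ring).
  rewrite <- exp_plus. do 2 f_equal. field; lra.
Qed.

Lemma is_derive_gauss_plus (t N y : R) : 0 < t ->
  is_derive (fun y => gauss t (N + y)) y (- ((N + y) / t) * gauss t (N + y)).
Proof.
  intros ht. replace (- ((N + y) / t) * gauss t (N + y)) with (1 * (- ((N + y) / t) * gauss t (N + y))) by ring.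
  apply (is_derive_comp (gauss t) (fun y => N + y)); [now apply is_derive_gauss|].
  auto_derive; auto.
Qed.

Lemma is_derive_gauss_minus (t N y : R) : 0 < t ->
  is_derive (fun y => gauss t (N - y)) y ((N - y) / t * gauss t (N - y)).
Proof.
  intros ht. replace ((N - y) / t * gauss t (N - y)) with (-1 * (- ((N - y) / t) * gauss t (N - y))) by ring.
  apply (is_derive_comp (gauss t) (fun y => N - y)); [now apply is_derive_gauss|].
  auto_derive; auto; ring.
Qed.

(** The two images are symmetric about [M = N + 1], at distance [u = 1 - y]. With [a = M u / t], the
    sign of the derivative amounts to [M + u <= (M - u) exp (2 a)]; this follows from
    [exp (2 a) >= 1 + 2 a >= 1 + 4 M u], using [t <= 1 / 2], [M >= 1] and [u <= 1 / 2]. *)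
Lemma gauss_pair_decr (t N x y : R) : 0 < t <= 1 / 2 -> 0 <= N ->
  1 / 2 <= x -> x <= y -> y <= 1 ->
  gauss t (N + y) + gauss t (N + 2 - y) <= gauss t (N + x) + gauss t (N + 2 - x).
Proof.
  intros [ht ht2] hN.
  apply (nonincreasing_of_derive (fun y => gauss t (N + y) + gauss t (N + 2 - y))
    (fun y => - ((N + y) / t) * gauss t (N + y) + (N + 2 - y) / t * gauss t (N + 2 - y))).
  - intros z _. apply (@is_derive_plus R_AbsRing R_NormedModule).
    + now apply is_derive_gauss_plus.
    + now apply is_derive_gauss_minus.
  - intros z hz. set (u := 1 - z). set (M := N + 1).
    replace (N + z) with (M + - u) by (unfold u, M; ring).
    replace (N + 2 - z) with (M + u) by (unfold u, M; ring).
    rewrite !gauss_add, gauss_even by exact ht.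
    replace (- (M * - u / t)) with (M * u / t) by (field; lra).
    set (a := M * u / t). rewrite (exp_Ropp a).
    pose proof (gauss_pos t u ht) as hg. pose proof (exp_pos (- (M ^ 2 / (2 * t)))) as hE.
    pose proof (exp_pos a) as hea.
    assert (ha : 0 <= a).
    { apply Rdiv_le_0_compat; [|exact ht]. unfold M, u; nra. }
    assert (key : (M + u) <= (M + - u) * (exp a * exp a)).
    { assert (1 + 2 * a <= exp a * exp a).
      { rewrite <- exp_plus. pose proof (exp_ineq1_le (a + a)); lra. }
      assert (2 * M * u <= a).
      { unfold a. apply (Rle_div_r (2 * M * u) (M * u) t); [exact ht|]. assert (0 <= M * u) by (unfold M, u; nra). nra. }
      assert (1 <= M) by (unfold M; lra). assert (0 <= u <= 1 / 2) by (unfold u; lra).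
      apply Rle_trans with ((M + - u) * (1 + 2 * a)).
      - assert (0 <= M * u) by nra.
        apply Rle_trans with ((M + - u) * (1 + 4 * (M * u))); [nra|].
        apply Rmult_le_compat_l; nra.
      - apply Rmult_le_compat_l; nra. }
    assert (key2 : (M + u) * / exp a <= (M + - u) * exp a).
    { apply (Rle_div_l (M + u)); [exact hea|]. rewrite Rmult_assoc; exact key. }
    set (g := gauss t u) in *. set (E := exp (- (M ^ 2 / (2 * t)))) in *.
    replace (- ((M + - u) / t) * (g * (E * exp a)) + (M + u) / t * (g * (E * / exp a)))
      with (- (g * E / t) * ((M + - u) * exp a - (M + u) * / exp a)) by (field; lra).
    assert (0 < g * E / t) by (apply Rdiv_lt_0_compat; [now apply Rmult_lt_0_compat | exact ht]).
    cut (0 <= g * E / t * ((M + - u) * exp a - (M + u) * / exp a)); [lra|].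
    apply Rmult_le_pos; lra.
Qed.

(** On [0, 1 / 2] a pair of images symmetric about 0 may increase, and a share [c] of the central
    Gaussian has to compensate. With [X = N ^ 2 / (8 t)] and [a = N y / t], the increase is linear
    in [y] because [exp a - exp (- a) <= 2 a exp a]. The weight of the images is at most
    [exp (- X) ^ 2] because [y <= N / 4]; one factor absorbs [X], the other is compared with
    [c / 16]. *)
Lemma gauss_triple_decr (t N c x y : R) : 0 < t -> 2 <= N -> 16 * exp (- (N ^ 2 / (8 * t))) <= c ->
  0 <= x -> x <= y -> y <= 1 / 2 ->
  c * gauss t y + (gauss t (N + y) + gauss t (N - y)) <= c * gauss t x + (gauss t (N + x) + gauss t (N - x)).
Proof.
  intros ht hN hc.
  apply (nonincreasing_of_derive (fun y => c * gauss t y + (gauss t (N + y) + gauss t (N - y)))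
    (fun y => c * (- (y / t) * gauss t y) +
       (- ((N + y) / t) * gauss t (N + y) + (N - y) / t * gauss t (N - y)))).
  - intros z _. apply (@is_derive_plus R_AbsRing R_NormedModule);
      [|apply (@is_derive_plus R_AbsRing R_NormedModule)].
    + apply (is_derive_scal (gauss t)). now apply is_derive_gauss.
    + now apply is_derive_gauss_plus.
    + now apply is_derive_gauss_minus.
  - intros z hz. replace (gauss t (N - z)) with (gauss t (N + - z)) by (f_equal; ring).
    rewrite !gauss_add, gauss_even by exact ht.
    replace (- (N * - z / t)) with (N * z / t) by (field; lra).
    set (a := N * z / t). rewrite (exp_Ropp a).
    set (g := gauss t z). set (E := exp (- (N ^ 2 / (2 * t)))).
    assert (hg : 0 < g) by (now apply gauss_pos).
    assert (hE : 0 < E) by apply exp_pos.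
    pose proof (exp_pos a) as hea. pose proof (Rinv_0_lt_compat _ hea) as hia.
    assert (ha : 0 <= a) by (apply Rdiv_le_0_compat; [nra | exact ht]).
    assert (key : (N - z) * E * exp a - (N + z) * E * / exp a <= c * z).
    { assert (0 <= z * E * (exp a + / exp a)).
      { apply Rmult_le_pos; [apply Rmult_le_pos|]; lra. }
      apply Rle_trans with (N * E * (exp a - / exp a)); [lra|].
      assert (s : exp a - / exp a <= 2 * a * exp a).
      { replace (/ exp a) with (exp (- (2 * a)) * exp a).
        - pose proof (exp_ineq1_le (- (2 * a))). nra.
        - rewrite <- exp_plus, <- exp_Ropp. f_equal; ring. }
      apply Rle_trans with (N * E * (2 * a * exp a)).
      { apply Rmult_le_compat_l; [nra | exact s]. }
      set (X := N ^ 2 / (8 * t)) in *.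
      assert (hX : 0 <= X) by (apply Rdiv_le_0_compat; nra).
      assert (b : E * exp a <= exp (- X) * exp (- X)).
      { unfold E. rewrite <- !exp_plus. apply exp_le. unfold a, X.
        apply Rmult_le_reg_r with (4 * t); [lra|].
        replace ((- (N ^ 2 / (2 * t)) + N * z / t) * (4 * t)) with (- 2 * N ^ 2 + 4 * (N * z)) by (field; lra).
        replace ((- (N ^ 2 / (8 * t)) + - (N ^ 2 / (8 * t))) * (4 * t)) with (- N ^ 2) by (field; lra).
        nra. }
      replace (N * E * (2 * a * exp a)) with (16 * z * X * (E * exp a)) by (unfold a, X; field; lra).
      assert (X * exp (- X) <= 1).
      { rewrite exp_Ropp. apply Rle_div_l; [apply exp_pos|]. pose proof (exp_ineq1_le X); lra. }
      pose proof (exp_pos (- X)).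
      apply Rle_trans with (16 * z * X * (exp (- X) * exp (- X))).
      { apply Rmult_le_compat_l; [|exact b]. apply Rmult_le_pos; lra. }
      replace (16 * z * X * (exp (- X) * exp (- X))) with (z * (16 * exp (- X)) * (X * exp (- X))) by ring.
      assert (0 <= z * (16 * exp (- X)) <= c * z) by nra. nra. }
    replace (c * (- (z / t) * g) + (- ((N + z) / t) * (g * (E * / exp a)) + (N - z) / t * (g * (E * exp a))))
      with (- (g / t) * (c * z - ((N - z) * E * exp a - (N + z) * E * / exp a))) by (field; lra).
    assert (0 < g / t) by (now apply Rdiv_lt_0_compat).
    cut (0 <= g / t * (c * z - ((N - z) * E * exp a - (N + z) * E * / exp a))); [lra|].
    apply Rmult_le_pos; lra.
Qed.

Lemma theta_decr_right (t x y : R) : 0 < t <= 1 / 2 -> 1 / 2 <= x -> x <= y -> y <= 1 ->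
  theta t y <= theta t x.
Proof.
  intros ht h1 h2 h3. unfold theta, gsum.
  rewrite <- !Series_plus by (apply ex_gsum; lra).
  apply Series_le.
  - intros n. split.
    + pose proof (gauss_pos t (2 * INR n + y) ltac:(lra)).
      pose proof (gauss_pos t (2 * INR n + (2 - y)) ltac:(lra)). lra.
    + pose proof (pos_INR n).
      replace (2 * INR n + (2 - y)) with (2 * INR n + 2 - y) by ring.
      replace (2 * INR n + (2 - x)) with (2 * INR n + 2 - x) by ring.
      apply gauss_pair_decr; lra.
  - apply (@ex_series_plus R_AbsRing R_NormedModule); apply ex_gsum; lra.
Qed.

Lemma is_series_half : is_series (fun n => (1 / 2) ^ S n) 1.
Proof.
  assert (h : Rabs (1 / 2) < 1) by (rewrite Rabs_pos_eq; lra).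
  pose proof (is_series_scal_r (1 / 2) _ _ (is_series_geom (1 / 2) h)) as H.
  replace (/ (1 - 1 / 2) * (1 / 2)) with 1 in H by field.
  eapply is_series_ext; [|exact H]. intros n; simpl; eqR; ring.
Qed.

(** The weights [(1 / 2) ^ S n] sum to 1 and divide the central Gaussian among the image pairs
    [N = 2 n + 2], so that [gauss_triple_decr] applies term by term. *)
Lemma theta_decr_left (t x y : R) : 0 < t <= 1 / 64 -> 0 <= x -> x <= y -> y <= 1 / 2 ->
  theta t y <= theta t x.
Proof.
  intros ht h1 h2 h3.
  assert (E : forall z, theta t z =
    Series (fun n => (1 / 2) ^ S n * gauss t z + (gauss t (2 * INR n + (2 + z)) + gauss t (2 * INR n + (2 - z))))).
  { intros z. rewrite theta_expand by lra. unfold gsum.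
    rewrite Rplus_assoc, <- Series_plus by (apply ex_gsum; lra).
    rewrite (Series_plus (fun n => (1 / 2) ^ S n * gauss t z)
      (fun n => gauss t (2 * INR n + (2 + z)) + gauss t (2 * INR n + (2 - z)))).
    - rewrite Series_scal_r, (is_series_unique _ _ is_series_half). ring.
    - apply ex_series_scal_r. eexists; apply is_series_half.
    - apply (@ex_series_plus R_AbsRing R_NormedModule); apply ex_gsum; lra. }
  rewrite !E. apply Series_le.
  - intros n. split.
    + pose proof (gauss_pos t (2 * INR n + (2 + y)) ltac:(lra)).
      pose proof (gauss_pos t (2 * INR n + (2 - y)) ltac:(lra)).
      pose proof (gauss_pos t y ltac:(lra)). pose proof (pow_lt (1 / 2) (S n) ltac:(lra)). nra.
    + pose proof (pos_INR n).
      replace (2 * INR n + (2 + y)) with (2 * INR n + 2 + y) by ring.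
      replace (2 * INR n + (2 - y)) with (2 * INR n + 2 - y) by ring.
      replace (2 * INR n + (2 + x)) with (2 * INR n + 2 + x) by ring.
      replace (2 * INR n + (2 - x)) with (2 * INR n + 2 - x) by ring.
      apply gauss_triple_decr; try lra.
      (* Origin of [t <= 1 / 64]: for [N = 2 n + 2] it gives [N ^ 2 / (8 t) >= 32 (n + 1)], and
         [exp (- 32) <= 1 / 32] beats the share [(1 / 2) ^ S n] even after the factor 16. *)
      apply Rle_trans with (16 * (1 / 32) ^ S n).
      * apply Rmult_le_compat_l; [lra|].
        apply Rle_trans with (exp (- 32) ^ S n).
        -- rewrite <- (Rpower_pow (S n) (exp (- 32))) by apply exp_pos. unfold Rpower. rewrite ln_exp.
           apply exp_le. rewrite S_INR.
           assert (32 * (INR n + 1) <= (2 * INR n + 2) ^ 2 / (8 * t)).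
           { apply (Rle_div_r (32 * (INR n + 1)) ((2 * INR n + 2) ^ 2)); [lra|]. nra. }
           lra.
        -- apply pow_incr. split; [left; apply exp_pos|].
           apply Rle_trans with (/ 32); [exact (exp_neg_le_inv 32 ltac:(lra)) | lra].
      * replace (1 / 32) with (1 / 16 * (1 / 2)) by field. rewrite Rpow_mult_distr.
        pose proof (pow_lt (1 / 2) (S n) ltac:(lra)).
        assert ((1 / 16) ^ S n <= 1 / 16).
        { simpl. assert ((1 / 16) ^ n <= 1).
          { apply Rle_trans with (1 ^ n); [apply pow_incr; lra | rewrite pow1; lra]. }
          lra. }
        nra.
  - apply (@ex_series_plus R_AbsRing R_NormedModule).
    + apply ex_series_scal_r. eexists; apply is_series_half.
    + apply (@ex_series_plus R_AbsRing R_NormedModule); apply ex_gsum; lra.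
Qed.

Lemma theta_decr (t x y : R) : 0 < t <= 1 / 64 -> 0 <= x -> x <= y -> y <= 1 ->
  theta t y <= theta t x.
Proof.
  intros ht h1 h2 h3.
  destruct (Rle_lt_dec y (1 / 2)); [now apply theta_decr_left|].
  destruct (Rle_lt_dec (1 / 2) x); [apply theta_decr_right; lra|].
  apply Rle_trans with (theta t (1 / 2)).
  - apply theta_decr_right; lra.
  - apply theta_decr_left; lra.
Qed.

(** On [0, 1], [theta] decreases with the distance to [2 Z]. That distance is [Rabs (s - x)] on the
    right-hand side and the smaller of [s + x] and [2 - (s + x)] on the left, which is never
    less. *)
Lemma theta_diff_sum (t s x : R) : 0 < t <= 1 / 64 -> 0 <= s <= 1 -> 0 <= x <= 1 ->
  theta t (s + x) <= theta t (s - x).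
Proof.
  intros ht hs hx.
  assert (E : theta t (s - x) = theta t (Rabs (s - x))).
  { unfold Rabs; destruct Rcase_abs; [symmetry; apply theta_even; lra | reflexivity]. }
  rewrite E.
  destruct (Rle_lt_dec (s + x) 1).
  - apply theta_decr; [exact ht | apply Rabs_pos | apply Rabs_le; lra | lra].
  - rewrite <- (theta_refl t (s + x)).
    apply theta_decr; [exact ht | apply Rabs_pos | apply Rabs_le; lra | lra].
Qed.

(** * Riemann integration on rectangles *)

Lemma cont_plus (f g : R -> R) (x : R) : continuous f x -> continuous g x -> continuous (fun y => f y + g y) x.
Proof. apply (continuous_plus (V := R_NormedModule)). Qed.

Lemma cont_minus (f g : R -> R) (x : R) : continuous f x -> continuous g x -> continuous (fun y => f y - g y) x.
Proof. apply (continuous_minus (V := R_NormedModule)). Qed.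

Lemma cont_mult (f g : R -> R) (x : R) : continuous f x -> continuous g x -> continuous (fun y => f y * g y) x.
Proof. apply (continuous_mult (K := R_AbsRing)). Qed.

Lemma cont_opp (f : R -> R) (x : R) : continuous f x -> continuous (fun y => - f y) x.
Proof. apply (continuous_opp (V := R_NormedModule)). Qed.

Lemma cont_pow (f : R -> R) (n : nat) (x : R) : continuous f x -> continuous (fun y => f y ^ n) x.
Proof.
  intros H. induction n as [|n IH]; simpl; [apply continuous_const | now apply cont_mult].
Qed.

Lemma cont_comp (g f : R -> R) (x : R) : (forall y, continuous g y) -> continuous f x ->
  continuous (fun y => g (f y)) x.
Proof. intros Hg Hf; apply (continuous_comp f g); auto. Qed.

Lemma RInt_cont (f : R -> R) (a x : R) : (forall y, continuous f y) -> continuous (fun x => RInt f a x) x.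
Proof.
  intros H. apply continuous_of_derive. exists (f x).
  apply (is_derive_RInt f (fun x => RInt f a x) a).
  - exists (mkposreal _ Rlt_0_1); intros y _.
    apply (@RInt_correct R_CompleteNormedModule). now apply ex_RInt_cont.
  - apply H.
Qed.

Ltac cont := intros;
  repeat match goal with
    | |- continuous (fun _ => ?c) _ => apply continuous_const
    | |- continuous (fun y => y) _ => apply continuous_id
    | H : forall x, continuous ?f x |- continuous ?f _ => apply H
    | |- continuous (fun y => @?f y + @?g y) _ => apply (cont_plus f g)
    | |- continuous (fun y => @?f y - @?g y) _ => apply (cont_minus f g)
    | |- continuous (fun y => @?f y * @?g y) _ => apply (cont_mult f g)
    | |- continuous (fun y => - @?f y) _ => apply (cont_opp f)
    | |- continuous (fun y => @?f y ^ ?n) _ => apply (cont_pow f n)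
    | |- continuous (Rplus ?c) _ => apply (cont_plus (fun _ => c) (fun y => y))
    | |- continuous (Rminus ?c) _ => apply (cont_minus (fun _ => c) (fun y => y))
    | |- continuous (Rmult ?c) _ => apply (cont_mult (fun _ => c) (fun y => y))
    | H : forall x, continuous ?f x |- continuous (fun y => ?f _) _ => apply (cont_comp f); [exact H|]
  end.

Lemma is_derive_RInt_cont (f : R -> R) (a x : R) : (forall y, continuous f y) ->
  is_derive (fun x => RInt f a x) x (f x).
Proof.
  intros H. apply (is_derive_RInt f (fun x => RInt f a x) a); [|apply H].
  exists (mkposreal _ Rlt_0_1); intros y _.
  apply (@RInt_correct R_CompleteNormedModule). now apply ex_RInt_cont.
Qed.

Lemma RInt_le_cont (f g : R -> R) (a b : R) : a <= b ->
  (forall x, continuous f x) -> (forall x, continuous g x) ->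
  (forall x, a <= x <= b -> f x <= g x) -> RInt f a b <= RInt g a b.
Proof.
  intros hab Hf Hg H. apply RInt_le; try apply ex_RInt_cont; auto. intros; apply H; lra.
Qed.

Lemma RInt_ge0_cont (f : R -> R) (a b : R) : a <= b -> (forall x, continuous f x) ->
  (forall x, a <= x <= b -> 0 <= f x) -> 0 <= RInt f a b.
Proof.
  intros hab Hf H. apply RInt_ge_0; try apply ex_RInt_cont; auto. intros; apply H; lra.
Qed.

Lemma RInt_abs_le_cont (f g : R -> R) (a b : R) : a <= b ->
  (forall x, continuous f x) -> (forall x, continuous g x) ->
  (forall x, a <= x <= b -> Rabs (f x) <= g x) -> Rabs (RInt f a b) <= RInt g a b.
Proof.
  intros hab Hf Hg H. apply Rabs_le. split.
  - replace (- RInt g a b) with (RInt (fun x => (-1) * g x) a b)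
      by (rewrite RInt_scal_R by (now apply ex_RInt_cont); eqR; ring).
    apply RInt_le_cont; auto; [intros; cont|].
    intros x hx. specialize (H x hx). apply Rabs_le_between in H. lra.
  - apply RInt_le_cont; auto. intros x hx. specialize (H x hx). apply Rabs_le_between in H. lra.
Qed.

Lemma RInt_abs_le_const (f : R -> R) (a b M : R) : a <= b -> (forall x, continuous f x) ->
  (forall x, a <= x <= b -> Rabs (f x) <= M) -> Rabs (RInt f a b) <= M * (b - a).
Proof.
  intros hab Hf H. rewrite Rmult_comm, <- RInt_const_R.
  apply RInt_abs_le_cont; auto. intros; apply continuous_const.
Qed.

Lemma RInt_subinterval (f : R -> R) (a c d b : R) : a <= c <= d -> d <= b ->
  (forall x, continuous f x) -> (forall x, a <= x <= b -> 0 <= f x) -> RInt f c d <= RInt f a b.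
Proof.
  intros h1 h2 Hf H.
  rewrite <- (RInt_Chasles_R f a c b), <- (RInt_Chasles_R f c d b) by exact Hf.
  assert (0 <= RInt f a c) by (apply RInt_ge0_cont; auto; [lra | intros; apply H; lra]).
  assert (0 <= RInt f d b) by (apply RInt_ge0_cont; auto; intros; apply H; lra).
  lra.
Qed.

Lemma cont_2d_fst (h : R -> R -> R) (x y : R) : continuity_2d_pt h x y -> continuous (fun u => h u y) x.
Proof.
  intros H. apply filterlim_locally. intros eps. destruct (H eps) as [d Hd].
  exists d. intros u hu. apply Hd; [exact hu|]. rewrite Rminus_diag, Rabs_R0. apply cond_pos.
Qed.

Lemma cont_2d_snd (h : R -> R -> R) (x y : R) : continuity_2d_pt h x y -> continuous (fun v => h x v) y.
Proof.
  intros H. apply filterlim_locally. intros eps. destruct (H eps) as [d Hd].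
  exists d. intros v hv. apply Hd; [|exact hv]. rewrite Rminus_diag, Rabs_R0. apply cond_pos.
Qed.

Lemma cont_2d_swap (h : R -> R -> R) (x y : R) :
  continuity_2d_pt h x y -> continuity_2d_pt (fun u v => h v u) y x.
Proof. intros H eps. destruct (H eps) as [d Hd]. exists d. intros u v hu hv. now apply Hd. Qed.

Lemma cont_RInt_param (h : R -> R -> R) (c d x : R) : (forall x y, continuity_2d_pt h x y) ->
  continuous (fun x => RInt (h x) c d) x.
Proof.
  intros H.
  assert (cy : forall u y, continuous (h u) y) by (intros; now apply cont_2d_snd).
  assert (W : forall c d, c <= d -> continuous (fun x => RInt (h x) c d) x).
  { clear c d; intros c d hcd. apply filterlim_locally. intros eps.
    (* The [+ 1] covers [c = d] and makes the final inequality strict. *)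
    assert (he : 0 < eps / (d - c + 1)) by (apply Rdiv_lt_0_compat; [apply cond_pos | lra]).
    destruct (uniform_continuity_2d h (x - 1) (x + 1) c d (fun u v _ _ => H u v) (mkposreal _ he))
      as [del Hdel]. simpl in Hdel.
    assert (hm : 0 < Rmin 1 del) by (apply Rmin_glb_lt; [lra | apply cond_pos]).
    exists (mkposreal _ hm). intros u hu.
    assert (hu' : Rabs (u - x) < Rmin 1 del) by exact hu.
    pose proof (Rmin_l 1 del); pose proof (Rmin_r 1 del).
    assert (hu1 : x - 1 <= u <= x + 1) by (apply Rabs_lt_between in hu'; lra).
    change (Rabs (RInt (h u) c d - RInt (h x) c d) < eps).
    rewrite <- RInt_minus_R by (now apply ex_RInt_cont).
    eapply Rle_lt_trans; [apply RInt_abs_le_const with (M := eps / (d - c + 1)); [exact hcd | |]|].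
    - intros v; apply cont_minus; apply cy.
    - intros v hv. left. apply Hdel; try lra. rewrite Rminus_diag, Rabs_R0. apply cond_pos.
    - replace (eps / (d - c + 1) * (d - c)) with (eps * ((d - c) / (d - c + 1))) by (field; lra).
      rewrite <- (Rmult_1_r eps) at 2. apply Rmult_lt_compat_l; [apply cond_pos|].
      apply Rlt_div_l; lra. }
  destruct (Rle_lt_dec c d) as [l|l]; [now apply W|].
  apply (continuous_ext (fun x => - RInt (h x) d c)).
  - intros u. apply (opp_RInt_swap (V := R_CompleteNormedModule)). now apply ex_RInt_cont.
  - apply cont_opp, W; lra.
Qed.

(** As functions of the upper bound [b], both sides have the derivative [RInt (h b) c d] and both
    vanish at [b = a]. *)
Lemma RInt_fubini (h : R -> R -> R) (a b c d : R) : (forall x y, continuity_2d_pt h x y) ->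
  RInt (fun x => RInt (fun y => h x y) c d) a b = RInt (fun y => RInt (fun x => h x y) a b) c d.
Proof.
  intros H.
  assert (cx : forall y x, continuous (fun x => h x y) x) by (intros; now apply cont_2d_fst).
  assert (cp : forall x, continuous (fun x => RInt (fun y => h x y) c d) x)
    by (intros; now apply cont_RInt_param).
  set (f := fun b y => RInt (fun x => h x y) a b).
  set (D := fun b => RInt (fun x => RInt (fun y => h x y) c d) a b - RInt (f b) c d).
  assert (Df : forall u y, is_derive (fun u => f u y) u (h u y)).
  { intros u y. apply (is_derive_RInt_cont (fun x => h x y)). intros; apply cx. }
  assert (DD : forall u, is_derive D u 0).
  { intros u. replace 0 with (RInt (fun y => h u y) c d - RInt (fun y => h u y) c d) by ring.
    apply (@is_derive_minus R_AbsRing R_NormedModule); [now apply (is_derive_RInt_cont (fun x => RInt (fun y => h x y) c d) a u)|].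
    replace (RInt (fun y => h u y) c d) with (RInt (fun y => Derive (fun v => f v y) u) c d)
      by (apply RInt_ext; intros y _; apply is_derive_unique, Df).
    apply (is_derive_RInt_param f).
    - exists (mkposreal _ Rlt_0_1). intros v _ y _. eexists; apply Df.
    - intros y _. apply continuity_2d_pt_ext with h; [|apply H].
      intros; symmetry; apply is_derive_unique, Df.
    - exists (mkposreal _ Rlt_0_1). intros v _. apply ex_RInt_cont. intros y.
      apply (cont_RInt_param (fun y x => h x y)). intros; now apply cont_2d_swap. }
  assert (D0 : D a = 0).
  { unfold D, f. rewrite RInt_point.
    replace (RInt _ c d) with 0; [unfold zero; simpl; ring|].
    rewrite <- (Rmult_0_r (d - c)), <- RInt_const_R. apply RInt_ext; intros.
    now rewrite RInt_point. }
  destruct (MVT_gen D a b (fun _ => 0)) as [z [_ Hz]].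
  - intros; apply DD.
  - intros y _. apply continuity_pt_filterlim, (continuous_of_derive D). eexists; apply DD.
  - unfold D in *; fold (f b). lra.
Qed.

Lemma nonneg_of_small (x C : R) : (forall n : nat, - (C / (INR n + 1)) <= x) -> 0 <= x.
Proof.
  intros H.
  assert (L : is_lim_seq (fun n => - (C / (INR n + 1))) 0).
  { replace (Finite 0) with (Rbar_opp (Rbar_mult C 0)) by (simpl; f_equal; ring).
    apply is_lim_seq_opp with (u := fun n => C / (INR n + 1)) (l := Rbar_mult C 0).
    apply is_lim_seq_scal_l.
    apply is_lim_seq_ext with (fun n => / INR (S n)); [intros n; now rewrite S_INR|].
    apply is_lim_seq_incr_1 with (u := fun n => / INR n).
    replace (Finite 0) with (Rbar_inv p_infty) by reflexivity.
    apply is_lim_seq_inv; [apply is_lim_seq_INR | discriminate]. }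
  apply (is_lim_seq_le _ _ 0 x H L (is_lim_seq_const x)).
Qed.

(* Discrete Abel summation on a uniform mesh; the Lipschitz constant controls the mesh error. *)
Lemma RInt_abel (h p : R -> R) (b M L : R) : 0 <= b ->
  (forall x, continuous h x) -> (forall x, continuous p x) ->
  (forall x, 0 <= x <= b -> Rabs (h x) <= M) ->
  (forall x, 0 <= x <= b -> 0 <= RInt h 0 x) ->
  (forall x, 0 <= x <= b -> 0 <= p x) ->
  (forall x y, 0 <= x -> x <= y -> y <= b -> p y <= p x <= p y + L * (y - x)) ->
  0 <= RInt (fun x => h x * p x) 0 b.
Proof.
  intros hb ch cp bh Hh p0 Hp.
  assert (chp : forall x, continuous (fun x => h x * p x) x) by (intros; cont).
  assert (M0 : 0 <= M) by (eapply Rle_trans; [apply Rabs_pos | apply (bh 0); lra]).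
  apply nonneg_of_small with (M * L * b * b). intros n.
  set (m := b / (INR n + 1)). pose proof (pos_INR n) as hn.
  assert (hm : 0 <= m) by (apply Rdiv_le_0_compat; lra).
  (* Mesh induction carrying the boundary term [p x * RInt h 0 x]. On each cell, freezing [p] at the
     right end costs at most [M * L * m * m]; lowering the coefficient of the nonnegative primitive
     from [p x] to [p y] only decreases the left side. *)
  assert (K : forall k, (k <= S n)%nat ->
    p (INR k * m) * RInt h 0 (INR k * m) - INR k * (M * L * m * m)
      <= RInt (fun x => h x * p x) 0 (INR k * m)).
  { induction k as [|k IH]; intros hk.
    - simpl INR. rewrite !Rmult_0_l, !RInt_point. unfold zero; simpl; lra.
    - specialize (IH ltac:(lia)).
      assert (hkm : INR (S k) * m <= b).
      { apply le_INR in hk. rewrite (S_INR n) in hk.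
        replace b with ((INR n + 1) * m) by (unfold m; field; lra).
        apply Rmult_le_compat_r; assumption. }
      rewrite S_INR in *. pose proof (pos_INR k).
      set (x := INR k * m) in *. set (y := (INR k + 1) * m) in *.
      assert (hxy : y = x + m) by (unfold x, y; ring).
      assert (hx : 0 <= x) by (apply Rmult_le_pos; assumption).
      rewrite <- (RInt_Chasles_R (fun x => h x * p x) 0 x y), <- (RInt_Chasles_R h 0 x y) by assumption.
      assert (S : p y * RInt h x y - M * L * m * m <= RInt (fun x => h x * p x) x y).
      { rewrite <- RInt_scal_R by (now apply ex_RInt_cont).
        cut (Rabs (RInt (fun z => h z * p z - p y * h z) x y) <= M * (L * m) * (y - x)).
        - intros B. rewrite RInt_minus_R in B by (apply ex_RInt_cont; intros; cont).
          apply Rabs_le_between in B. rewrite hxy in *. lra.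
        - apply RInt_abs_le_const; [lra | intros; cont|].
          intros z hz. replace (h z * p z - p y * h z) with (h z * (p z - p y)) by ring.
          rewrite Rabs_mult. destruct (Hp z y) as [h1 h2]; try lra.
          apply Rmult_le_compat; try apply Rabs_pos; [apply bh; lra|].
          rewrite Rabs_pos_eq by lra. destruct (Hp x y) as [h3 h4]; try lra.
          destruct (Hp x z) as [h5 h6]; try lra.
          assert (p x - p y <= L * m) by (replace m with (y - x) by lra; lra). lra. }
      destruct (Hp x y) as [h1 _]; try lra.
      specialize (Hh x ltac:(lra)). nra. }
  specialize (K (S n) ltac:(lia)). rewrite S_INR in K.
  replace ((INR n + 1) * m) with b in K by (unfold m; field; lra).
  assert (0 <= p b * RInt h 0 b) by (apply Rmult_le_pos; [apply p0 | apply Hh]; lra).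
  replace (M * L * b * b / (INR n + 1)) with ((INR n + 1) * (M * L * m * m)) by (unfold m; field; lra).
  lra.
Qed.

(** * The Neumann kernel *)

Definition ker (t r s : R) : R := theta t (s - r) + theta t (r + s).

Lemma ker_sym (t r s : R) : 0 < t -> ker t r s = ker t s r.
Proof.
  intros ht. unfold ker. rewrite <- (theta_even t (s - r)) by exact ht.
  f_equal; f_equal; ring.
Qed.

Lemma ker_pos (t r s : R) : 0 < t -> 0 < ker t r s.
Proof. intros ht; apply Rplus_lt_0_compat; now apply theta_pos. Qed.

Lemma continuity_pt_theta (t y : R) : 0 < t -> continuity_pt (theta t) y.
Proof. intros ht; apply continuity_pt_filterlim. now apply (continuous_theta t y). Qed.

Lemma ker_cont_2d (t r s : R) : 0 < t -> continuity_2d_pt (ker t) r s.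
Proof.
  intros ht. unfold ker. apply continuity_2d_pt_plus.
  - apply (continuity_1d_2d_pt_comp (theta t)); [now apply continuity_pt_theta|].
    apply continuity_2d_pt_minus; [apply continuity_2d_pt_id2 | apply continuity_2d_pt_id1].
  - apply (continuity_1d_2d_pt_comp (theta t)); [now apply continuity_pt_theta|].
    apply continuity_2d_pt_plus; [apply continuity_2d_pt_id1 | apply continuity_2d_pt_id2].
Qed.

Lemma ker_cont_fst (t s r : R) : 0 < t -> continuous (fun r => ker t r s) r.
Proof. intros ht; now apply cont_2d_fst, ker_cont_2d. Qed.

Lemma ker_cont_snd (t r s : R) : 0 < t -> continuous (ker t r) s.
Proof. intros ht; now apply (cont_2d_snd (ker t)), ker_cont_2d. Qed.

Lemma cont_2d_prod (t : R) (p q : R -> R) (x y : R) : 0 < t ->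
  (forall x, continuous p x) -> (forall x, continuous q x) ->
  continuity_2d_pt (fun x y => ker t x y * p y * q x) x y.
Proof.
  intros ht hp hq. apply continuity_2d_pt_mult; [apply continuity_2d_pt_mult|].
  - now apply ker_cont_2d.
  - apply (continuity_1d_2d_pt_comp p); [apply continuity_pt_filterlim, hp | apply continuity_2d_pt_id2].
  - apply (continuity_1d_2d_pt_comp q); [apply continuity_pt_filterlim, hq | apply continuity_2d_pt_id1].
Qed.

Lemma cont_ker_int (t : R) (u : R -> R) (a b r : R) : 0 < t -> (forall x, continuous u x) ->
  continuous (fun r => RInt (fun s => ker t r s * u s) a b) r.
Proof.
  intros ht hu. apply (cont_RInt_param (fun r s => ker t r s * u s)). intros x y.
  apply continuity_2d_pt_mult; [now apply ker_cont_2d|].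
  apply (continuity_1d_2d_pt_comp u); [apply continuity_pt_filterlim, hu | apply continuity_2d_pt_id2].
Qed.

Lemma cont_ker_int1 (t a b r : R) : 0 < t -> continuous (fun r => RInt (ker t r) a b) r.
Proof. intros ht. apply cont_RInt_param. intros; now apply ker_cont_2d. Qed.

(** Self-adjointness of the heat step, with two different ranges: the density lives on [0, b], while
    it is tested on [0, 1] or on a part [0, a]. *)
Lemma ker_dual (t a b c d : R) (u phi : R -> R) : 0 < t ->
  (forall x, continuous u x) -> (forall x, continuous phi x) ->
  RInt (fun r => RInt (fun s => ker t r s * u s) c d * phi r) a b =
  RInt (fun s => u s * RInt (fun r => ker t s r * phi r) a b) c d.
Proof.
  intros ht hu hp.
  transitivity (RInt (fun r => RInt (fun s => ker t r s * u s * phi r) c d) a b).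
  { apply RInt_ext; intros r _. eqR. rewrite Rmult_comm, <- RInt_scal_R.
    - apply RInt_ext; intros s _; eqR; ring.
    - apply ex_RInt_cont; intros s. apply cont_mult; [now apply ker_cont_snd | apply hu]. }
  rewrite (RInt_fubini (fun r s => ker t r s * u s * phi r)) by (intros; now apply cont_2d_prod).
  apply RInt_ext; intros s _. eqR. rewrite <- RInt_scal_R.
  - apply RInt_ext; intros r _; eqR. rewrite (ker_sym t r s ht). ring.
  - apply ex_RInt_cont; intros r. apply cont_mult; [now apply ker_cont_snd | apply hp].
Qed.

Lemma theta_period (t y : R) : 0 < t -> theta t (y + 2) = theta t y.
Proof.
  intros ht. rewrite <- (theta_even t y ht), <- theta_refl. f_equal; ring.
Qed.

(** Method of images: for [F] even about 0 and 1, the Neumann integral is a convolution with [theta]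
    over one full period, which may be centred at [r] and then folded there. The symmetric form
    shows second differences of [F]. *)
Lemma ker_unfold (t r : R) (F : R -> R) : 0 < t -> 0 <= r <= 1 -> (forall x, continuous F x) ->
  (forall y, 0 <= y <= 1 -> F (- y) = F y) -> (forall y, 0 <= y <= 1 -> F (2 - y) = F y) ->
  RInt (fun s => ker t r s * F s) 0 1 = RInt (fun z => theta t z * (F (r + z) + F (r - z))) 0 1.
Proof.
  intros ht hr cF ev0 ev1.
  assert (ct : forall x, continuous (theta t) x) by (intros; now apply continuous_theta).
  set (k := fun y => theta t (y - r) * F y).
  assert (ck : forall x, continuous k x) by (intros; unfold k; cont).
  transitivity (RInt k (-1) 1).
  { transitivity (RInt (fun s => k s + k (0 - s)) 0 1).
    - apply RInt_ext. rewrite Rmin_left, Rmax_right by lra. intros s hs; eqR.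
      unfold ker, k. rewrite (Rminus_0_l s), ev0 by lra.
      replace (- s - r) with (- (r + s)) by ring. rewrite (theta_even t (r + s)) by exact ht. ring.
    - rewrite RInt_plus_R by (apply ex_RInt_cont; intros; cont).
      rewrite RInt_refl by exact ck. replace (0 - 1) with (-1) by ring. rewrite Rminus_0_r.
      rewrite Rplus_comm. now apply RInt_Chasles_R. }
  (* The piece [-1, r - 1] moves by one period to [1, r + 1]; there the two reflections combine to
     [F (y + 2) = F (- y) = F y]. *)
  transitivity (RInt k (r - 1) (r + 1)).
  { rewrite <- (RInt_Chasles_R k (-1) (r - 1) 1), <- (RInt_Chasles_R k (r - 1) 1 (r + 1)) by exact ck.
    rewrite Rplus_comm. f_equal.
    replace (RInt k 1 (r + 1)) with (RInt k (-1 + 2) (r - 1 + 2)) by (f_equal; ring).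
    rewrite <- RInt_shift by exact ck. apply RInt_ext.
    rewrite Rmin_left, Rmax_right by lra. intros y hy; eqR. unfold k.
    replace (y + 2 - r) with (y - r + 2) by ring. rewrite theta_period by exact ht. f_equal.
    replace (y + 2) with (2 - - y) by ring. rewrite ev1 by lra.
    rewrite <- (ev0 (- y)) by lra. f_equal; ring. }
  symmetry.
  transitivity (RInt (fun z => k (z + r) + k (r - z)) 0 1).
  - apply RInt_ext; intros z _; eqR. unfold k.
    replace (z + r - r) with z by ring. replace (r - z - r) with (- z) by ring.
    rewrite (theta_even t z ht), (Rplus_comm z r). ring.
  - rewrite RInt_plus_R by (apply ex_RInt_cont; intros; cont).
    rewrite RInt_refl, RInt_shift by exact ck. rewrite Rplus_comm, Rplus_0_l, Rminus_0_r.
    rewrite (Rplus_comm 1 r). now apply RInt_Chasles_R.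
Qed.

Lemma ker_mass (t r : R) : 0 < t -> 0 <= r <= 1 -> RInt (ker t r) 0 1 = 1.
Proof.
  intros ht hr.
  transitivity (RInt (fun s => ker t r s * 1) 0 1).
  { apply RInt_ext; intros; eqR; ring. }
  rewrite (ker_unfold t r (fun _ => 1)); auto; [|intros; apply continuous_const].
  transitivity (2 * RInt (theta t) 0 1).
  - rewrite <- RInt_scal_R.
    + apply RInt_ext; intros; eqR; ring.
    + apply ex_RInt_cont; intros; now apply continuous_theta.
  - rewrite RInt_theta by exact ht. eqR. field.
Qed.

Lemma gauss0_le (t x : R) : 0 < t -> gauss t x <= / (2 * sqrt t).
Proof.
  intros ht. apply Rle_trans with (gauss t 0); [apply gauss_le; [exact ht | nra]|].
  unfold gauss. replace (- 0 ^ 2 / (2 * t)) with 0 by (field; lra). rewrite exp_0.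
  unfold Rdiv; rewrite Rmult_1_l. pose proof (sqrt_lt_R0 t ht).
  apply Rinv_le_contravar; [lra|].
  replace 2 with (sqrt (2 * 2)) at 1 by (apply sqrt_square; lra).
  rewrite <- sqrt_mult by lra. apply sqrt_le_1_alt. pose proof PI2_1. nra.
Qed.

Lemma theta_le_sqrt (t y : R) : 0 < t <= 1 / 64 -> -1 <= y <= 2 -> theta t y <= / sqrt t.
Proof.
  intros ht.
  assert (W : forall y, -1 <= y <= 1 -> theta t y <= / sqrt t).
  { intros z hz. eapply Rle_trans; [apply theta_le; lra|].
    pose proof (gauss0_le t z ltac:(lra)). pose proof (sqrt_lt_R0 t ltac:(lra)) as hs.
    replace (/ sqrt t) with (/ (2 * sqrt t) + / (2 * sqrt t)) by (field; lra).
    assert (64 * t * sqrt t <= / (2 * sqrt t)); [|lra].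
    apply Rmult_le_reg_r with (2 * sqrt t); [lra|]. rewrite Rinv_l by lra.
    replace (64 * t * sqrt t * (2 * sqrt t)) with (128 * t * (sqrt t * sqrt t)) by ring.
    rewrite sqrt_sqrt by lra. nra. }
  intros hy. destruct (Rle_lt_dec y 1); [apply W; lra|].
  rewrite <- theta_refl. apply W; lra.
Qed.

Lemma ker_le (t r s : R) : 0 < t <= 1 / 64 -> 0 <= r <= 1 -> 0 <= s <= 1 -> ker t r s <= 2 * / sqrt t.
Proof.
  intros ht hr hs. unfold ker.
  pose proof (theta_le_sqrt t (s - r) ht ltac:(lra)). pose proof (theta_le_sqrt t (r + s) ht ltac:(lra)). lra.
Qed.

(** The value of [sqrt t * gauss t (4 * sqrt t)]. Four diffusion lengths cover every pair of points
    used in the flux bounds; the largest distance there is [3 h] plus the cut strip of at most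
    [h / 4]. *)
Definition kerc : R := exp (- 8) / sqrt (2 * PI).

Lemma kerc_pos : 0 < kerc.
Proof.
  apply Rdiv_lt_0_compat; [apply exp_pos|]. apply sqrt_lt_R0. pose proof PI_RGT_0; lra.
Qed.

Lemma ker_ge (t r s : R) : 0 < t -> Rabs (s - r) <= 4 * sqrt t -> kerc * / sqrt t <= ker t r s.
Proof.
  intros ht h. pose proof (sqrt_lt_R0 t ht) as hs. pose proof PI_RGT_0.
  apply Rle_trans with (theta t (s - r)).
  - eapply Rle_trans; [|apply gauss_le_theta; exact ht].
    eapply Rle_trans; [|apply (gauss_le t (s - r) (4 * sqrt t)); [exact ht|]].
    + right. unfold kerc, gauss. rewrite (sqrt_mult (2 * PI) t) by lra.
      replace (- (4 * sqrt t) ^ 2 / (2 * t)) with (-8).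
      * field. split; [lra|]. apply Rgt_not_eq, sqrt_lt_R0; lra.
      * replace ((4 * sqrt t) ^ 2) with (16 * (sqrt t * sqrt t)) by ring.
        rewrite sqrt_sqrt by lra. field; lra.
    + rewrite <- (pow2_abs (s - r)). apply pow_incr. split; [apply Rabs_pos | exact h].
  - unfold ker. pose proof (theta_pos t (r + s) ht). lra.
Qed.

Lemma ker_lip (t : R) : 0 < t -> exists L, 0 <= L /\
  forall r r' s, 0 <= r <= 1 -> 0 <= r' <= 1 -> 0 <= s <= 1 ->
    Rabs (ker t r s - ker t r' s) <= L * Rabs (r - r').
Proof.
  intros ht. destruct (theta_lip t 2 ht) as [L [hL H]]. exists (2 * L). split; [lra|].
  intros r r' s hr hr' hs. unfold ker.
  replace (theta t (s - r) + theta t (r + s) - (theta t (s - r') + theta t (r' + s)))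
    with ((theta t (s - r) - theta t (s - r')) + (theta t (r + s) - theta t (r' + s))) by ring.
  eapply Rle_trans; [apply Rabs_triang|].
  replace (2 * L * Rabs (r - r')) with (L * Rabs (r - r') + L * Rabs (r - r')) by ring.
  apply Rplus_le_compat.
  - rewrite (Rabs_minus_sym r r'). replace (r' - r) with (s - r - (s - r')) by ring.
    apply H; apply Rabs_le; lra.
  - replace (r - r') with (r + s - (r' + s)) by ring. apply H; apply Rabs_le; lra.
Qed.

(** Both parts of the kernel assemble into the integral of [theta] over the window [r - x, r + x].
    Moving [r] to the right gains [theta] at [s + x] and loses it at [s - x], which is larger by
    [theta_diff_sum]. *)
Lemma ker_cdf_decr (t r r' x : R) : 0 < t <= 1 / 64 -> 0 <= r -> r <= r' -> r' <= 1 -> 0 <= x <= 1 ->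
  0 <= RInt (fun s => ker t r s - ker t r' s) 0 x.
Proof.
  intros ht h1 h2 h3 hx. assert (ht0 : 0 < t) by lra.
  assert (ct : forall x, continuous (theta t) x) by (intros; now apply continuous_theta).
  assert (E : forall r, RInt (ker t r) 0 x = RInt (theta t) (r - x) (r + x)).
  { intros q. unfold ker. rewrite RInt_plus_R by (apply ex_RInt_cont; intros; cont).
    replace (RInt (fun y => theta t (y - q)) 0 x) with (RInt (fun y => theta t (q - y)) 0 x).
    - replace (RInt (fun y => theta t (q + y)) 0 x) with (RInt (fun y => theta t (y + q)) 0 x)
        by (apply RInt_ext; intros; eqR; f_equal; ring).
      rewrite RInt_refl, RInt_shift by exact ct. rewrite Rminus_0_r, Rplus_0_l, (Rplus_comm x q).
      now apply RInt_Chasles_R.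
    - apply RInt_ext; intros; eqR. rewrite <- theta_even by exact ht0. f_equal; ring. }
  rewrite RInt_minus_R by (apply ex_RInt_cont; intros; now apply ker_cont_snd).
  rewrite !E.
  replace (RInt (theta t) (r - x) (r + x) - RInt (theta t) (r' - x) (r' + x)) with
    (RInt (theta t) (r - x) (r' - x) - RInt (theta t) (r + x) (r' + x)).
  - replace (RInt (theta t) (r - x) (r' - x)) with (RInt (fun y => theta t (y + - x)) r r')
      by (rewrite RInt_shift by exact ct; reflexivity).
    rewrite <- RInt_shift by exact ct. rewrite <- RInt_minus_R by (apply ex_RInt_cont; intros; cont).
    apply RInt_ge0_cont; [lra | intros; cont|].
    intros s hs. pose proof (theta_diff_sum t s x ht ltac:(lra) hx).
    replace (s + - x) with (s - x) by ring. lra.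
  - pose proof (RInt_Chasles_R (theta t) (r - x) (r' - x) (r' + x) ct).
    pose proof (RInt_Chasles_R (theta t) (r - x) (r + x) (r' + x) ct). lra.
Qed.

(** * The cut heat step *)

(** Composition with this projection extends a function continuous on an interval to one continuous
    on the whole line, the form in which all integrands are handled. *)
Definition clamp (a b x : R) : R := Rmax a (Rmin b x).

Lemma clamp_in (a b x : R) : a <= b -> a <= clamp a b x <= b.
Proof. intros; unfold clamp, Rmax, Rmin; repeat destruct Rle_dec; lra. Qed.

Lemma clamp_id (a b x : R) : a <= x <= b -> clamp a b x = x.
Proof. intros; unfold clamp, Rmax, Rmin; repeat destruct Rle_dec; lra. Qed.

Lemma clamp_lip (a b x y : R) : Rabs (clamp a b x - clamp a b y) <= Rabs (x - y).
Proof.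
  unfold clamp, Rmax, Rmin, Rabs; repeat destruct Rle_dec; repeat destruct Rcase_abs; lra.
Qed.

Lemma continuous_clamp (a b x : R) : continuous (clamp a b) x.
Proof.
  apply continuous_lip with 1. intros; rewrite Rmult_1_l; apply clamp_lip.
Qed.

(** One heat step before the cut. Restricting the integral to [0, b], rather than cutting [u], keeps
    every function involved continuous. *)
Definition heat_cut (t c b : R) (u : R -> R) (r : R) : R :=
  c * ker t r 0 + RInt (fun s => ker t r s * u s) 0 b.

Lemma cont_heat_cut (t c b : R) (u : R -> R) (r : R) : 0 < t -> (forall x, continuous u x) ->
  continuous (heat_cut t c b u) r.
Proof.
  intros ht hu. unfold heat_cut. apply cont_plus; [apply cont_mult|].
  - apply continuous_const.
  - now apply (ker_cont_fst t 0).
  - now apply cont_ker_int.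
Qed.

Lemma heat_cut_ext (t c b : R) (u v : R -> R) (r : R) : 0 <= b ->
  (forall s, 0 <= s <= b -> u s = v s) -> heat_cut t c b u r = heat_cut t c b v r.
Proof.
  intros hb H. unfold heat_cut. f_equal. apply RInt_ext.
  rewrite Rmin_left, Rmax_right by exact hb. intros s hs. rewrite H by lra. reflexivity.
Qed.

Lemma heat_cut_minus (t c b : R) (u v : R -> R) (r : R) : 0 < t ->
  (forall x, continuous u x) -> (forall x, continuous v x) ->
  heat_cut t c b u r - heat_cut t c b v r = RInt (fun s => ker t r s * (u s - v s)) 0 b.
Proof.
  intros ht hu hv. unfold heat_cut.
  assert (ck : forall x, continuous (ker t r) x) by (intros; now apply ker_cont_snd).
  match goal with |- ?a + ?x - (?a + ?y) = _ => replace (a + x - (a + y)) with (x - y) by ring end.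
  rewrite <- RInt_minus_R by (apply ex_RInt_cont; intros; cont).
  apply RInt_ext; intros; eqR; ring.
Qed.

Lemma ker_ge_gauss1 (t r s : R) : 0 < t -> 0 <= r <= 1 -> 0 <= s <= 1 -> gauss t 1 <= ker t r s.
Proof.
  intros ht hr hs. unfold ker. pose proof (theta_pos t (r + s) ht).
  pose proof (gauss_le_theta t (s - r) ht).
  assert (gauss t 1 <= gauss t (s - r)) by (apply gauss_le; [exact ht | nra]). lra.
Qed.

(** Points of [0, 1] are at distance at most 1, so each step sends at least mass
    [gauss t 1 * (1 - b)] from any point into [b, 1]; what remains bounds the contraction factor on
    [0, b]. *)
Definition kap (t b : R) : R := 1 - gauss t 1 * (1 - b).

Lemma ker_int_le_kap (t b r : R) : 0 < t -> 0 <= b < 1 -> 0 <= r <= 1 ->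
  0 <= RInt (ker t r) 0 b <= kap t b.
Proof.
  intros ht hb hr.
  assert (ck : forall x, continuous (ker t r) x) by (intros; now apply ker_cont_snd).
  split.
  - apply RInt_ge0_cont; [lra | exact ck|]. intros; left; now apply ker_pos.
  - pose proof (RInt_Chasles_R (ker t r) 0 b 1 ck) as E. rewrite ker_mass in E by assumption.
    assert ((1 - b) * gauss t 1 <= RInt (ker t r) b 1).
    { rewrite <- RInt_const_R. apply RInt_le_cont; [lra | intros; cont | exact ck|].
      intros; apply ker_ge_gauss1; lra. }
    unfold kap; lra.
Qed.

Lemma kap_bound (t b : R) : 0 < t -> 0 <= b < 1 -> 0 <= kap t b < 1.
Proof.
  intros ht hb. split.
  - destruct (ker_int_le_kap t b 0 ht hb ltac:(lra)); lra.
  - unfold kap. pose proof (gauss_pos t 1 ht). nra.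
Qed.

Lemma ker_int_abs_le (t b r D : R) (w : R -> R) : 0 < t -> 0 <= b < 1 -> 0 <= r <= 1 ->
  (forall x, continuous w x) -> (forall s, 0 <= s <= b -> Rabs (w s) <= D) ->
  Rabs (RInt (fun s => ker t r s * w s) 0 b) <= kap t b * D.
Proof.
  intros ht hb hr cw H.
  assert (ck : forall x, continuous (ker t r) x) by (intros; now apply ker_cont_snd).
  assert (D0 : 0 <= D) by (eapply Rle_trans; [apply Rabs_pos | apply (H 0); lra]).
  apply Rle_trans with (RInt (fun s => D * ker t r s) 0 b).
  - apply RInt_abs_le_cont; [lra | intros; cont | intros; cont|].
    intros s hs. pose proof (ker_pos t r s ht). rewrite Rabs_mult, Rabs_pos_eq, Rmult_comm by lra.
    apply Rmult_le_compat_r; [lra | apply H, hs].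
  - rewrite RInt_scal_R, Rmult_comm by (apply ex_RInt_cont; intros; cont).
    apply Rmult_le_compat_r; [exact D0|]. apply ker_int_le_kap; assumption.
Qed.

(** At a maximum point of [Rabs (u - v)] on [0, b] the contraction bounds the maximum by [kap t b]
    times itself. *)
Lemma heat_cut_unique (t c b : R) (u v : R -> R) : 0 < t -> 0 <= b < 1 ->
  (forall x, continuous u x) -> (forall x, continuous v x) ->
  (forall r, 0 <= r <= b -> u r = heat_cut t c b u r) ->
  (forall r, 0 <= r <= b -> v r = heat_cut t c b v r) ->
  forall r, 0 <= r <= b -> u r = v r.
Proof.
  intros ht hb cu cv Hu Hv.
  set (w := fun s => u s - v s).
  assert (cw : forall x, continuous w x) by (intros; unfold w; cont).
  destruct (continuity_ab_maj (fun s => Rabs (w s)) 0 b) as [x0 [Hmax hx0]]; [lra| |].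
  { intros x _. apply continuity_pt_filterlim.
    apply (continuous_comp w Rabs); [apply cw | apply continuous_Rabs]. }
  assert (E : w x0 = RInt (fun s => ker t x0 s * w s) 0 b).
  { unfold w at 1. rewrite Hu, Hv by lra. now apply heat_cut_minus. }
  pose proof (ker_int_abs_le t b x0 (Rabs (w x0)) w ht hb ltac:(lra) cw Hmax) as B.
  rewrite <- E in B. destruct (kap_bound t b ht hb).
  pose proof (Rabs_pos (w x0)).
  assert (Rabs (w x0) = 0) by nra.
  intros r hr. specialize (Hmax r hr). simpl in Hmax.
  assert (Rabs (w r) = 0) by (pose proof (Rabs_pos (w r)); lra).
  apply Rabs_eq_0 in H3. unfold w in H3; lra.
Qed.

Lemma ker_r0 (t r : R) : 0 < t -> ker t r 0 = 2 * theta t r.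
Proof.
  intros ht; unfold ker. rewrite Rplus_0_r. unfold Rminus; rewrite Rplus_0_l, theta_even by exact ht. ring.
Qed.

(** The source term decreases by [theta_decr]. For the integral, the difference of the kernels at
    [r] and [r'] changes sign, but its primitive is nonnegative by [ker_cdf_decr], so it pairs
    nonnegatively with a decreasing [u >= 0]. *)
Lemma heat_cut_decr (t c b L : R) (u : R -> R) (r r' : R) : 0 < t <= 1 / 64 -> 0 <= c -> 0 <= b <= 1 ->
  (forall x, continuous u x) -> (forall x, 0 <= x <= b -> 0 <= u x) ->
  (forall x y, 0 <= x -> x <= y -> y <= b -> u y <= u x <= u y + L * (y - x)) ->
  0 <= r -> r <= r' -> r' <= 1 -> heat_cut t c b u r' <= heat_cut t c b u r.
Proof.
  intros ht hc hb cu u0 ud h1 h2 h3. assert (ht0 : 0 < t) by lra.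
  assert (ck : forall q x, continuous (ker t q) x) by (intros; now apply ker_cont_snd).
  unfold heat_cut. rewrite !ker_r0 by exact ht0.
  pose proof (theta_decr t r r' ht h1 h2 h3).
  cut (0 <= RInt (fun s => (ker t r s - ker t r' s) * u s) 0 b).
  - intros P.
    assert (E : RInt (fun s => (ker t r s - ker t r' s) * u s) 0 b =
      RInt (fun s => ker t r s * u s) 0 b - RInt (fun s => ker t r' s * u s) 0 b).
    { rewrite <- RInt_minus_R by (apply ex_RInt_cont; intros; apply cont_mult; [apply ck | apply cu]).
      apply RInt_ext; intros; eqR; ring. }
    rewrite E in P. nra.
  - apply RInt_abel with (M := 2 * / sqrt t + 2 * / sqrt t) (L := L); auto; try lra.
    + intros; apply cont_minus; apply ck.
    + intros x hx. pose proof (ker_le t r x ht ltac:(lra) ltac:(lra)).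
      pose proof (ker_le t r' x ht ltac:(lra) ltac:(lra)).
      pose proof (ker_pos t r x ht0). pose proof (ker_pos t r' x ht0). apply Rabs_le; lra.
    + intros x hx. apply ker_cdf_decr; lra.
Qed.

(** * Existence of a decreasing fixed point by Picard iteration *)

Fixpoint picard (t c b : R) (n : nat) : R -> R :=
  match n with
  | O => fun _ => 0
  | S n => heat_cut t c b (picard t c b n)
  end.

Lemma cont_picard (t c b : R) (n : nat) (x : R) : 0 < t -> continuous (picard t c b n) x.
Proof.
  intros ht. revert x; induction n as [|n IH]; intros x; simpl.
  - apply continuous_const.
  - now apply cont_heat_cut.
Qed.

(** The solution of [B = c * (2 * / sqrt t) + kap t b * B], where [2 * / sqrt t] bounds the kernel:
    an a priori bound that the iteration preserves. *)
Definition picardB (t c b : R) : R := c * (2 * / sqrt t) / (1 - kap t b).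

Lemma picard_bound (t c b : R) (n : nat) (r : R) : 0 < t <= 1 / 64 -> 0 <= c -> 0 <= b < 1 ->
  0 <= r <= 1 -> 0 <= picard t c b n r <= picardB t c b.
Proof.
  intros ht hc hb. assert (ht0 : 0 < t) by lra.
  destruct (kap_bound t b ht0 hb) as [k0 k1].
  pose proof (Rinv_0_lt_compat _ (sqrt_lt_R0 t ht0)) as hs.
  assert (B0 : 0 <= picardB t c b) by (apply Rdiv_le_0_compat; nra).
  revert r; induction n as [|n IH]; intros r hr; simpl; [lra|].
  assert (cu : forall x, continuous (picard t c b n) x) by (intros; now apply cont_picard).
  assert (ck : forall x, continuous (ker t r) x) by (intros; now apply ker_cont_snd).
  unfold heat_cut. pose proof (ker_pos t r 0 ht0). pose proof (ker_le t r 0 ht hr ltac:(lra)).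
  split.
  - apply Rplus_le_le_0_compat; [nra|].
    apply RInt_ge0_cont; [lra | intros; cont|].
    intros s hs'. apply Rmult_le_pos; [left; now apply ker_pos | apply IH; lra].
  - assert (P : Rabs (RInt (fun s => ker t r s * picard t c b n s) 0 b) <= kap t b * picardB t c b).
    { apply ker_int_abs_le; auto. intros s hs'. destruct (IH s ltac:(lra)). rewrite Rabs_pos_eq; lra. }
    apply Rabs_le_between in P.
    assert (picardB t c b = c * (2 * / sqrt t) + kap t b * picardB t c b) by (unfold picardB; field; split; [apply Rgt_not_eq, sqrt_lt_R0; lra | lra]).
    nra.
Qed.

(** Every iterate is a kernel integral of a bounded function, so [L] is independent of [n]. It
    yields the continuity of the limit and the modulus that [heat_cut_decr] asks for; it depends on
    [t], so it gives nothing uniform in the time step. *)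
Lemma picard_lip (t c b : R) : 0 < t <= 1 / 64 -> 0 <= c -> 0 <= b < 1 ->
  exists L, 0 <= L /\ forall n r r', 0 <= r <= 1 -> 0 <= r' <= 1 ->
    Rabs (picard t c b n r - picard t c b n r') <= L * Rabs (r - r').
Proof.
  intros ht hc hb. assert (ht0 : 0 < t) by lra.
  destruct (ker_lip t ht0) as [L [hL HL]].
  assert (B0 : 0 <= picardB t c b).
  { destruct (picard_bound t c b 0 0 ht hc hb); lra. }
  exists (c * L + L * picardB t c b). split; [nra|].
  intros n r r' hr hr'. pose proof (Rabs_pos (r - r')).
  destruct n as [|n]; simpl.
  { rewrite Rminus_diag, Rabs_R0. apply Rmult_le_pos; nra. }
  set (u := picard t c b n).
  assert (cu : forall x, continuous u x) by (intros; now apply cont_picard).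
  assert (ck : forall q x, continuous (ker t q) x) by (intros; now apply ker_cont_snd).
  unfold heat_cut.
  replace (c * ker t r 0 + RInt (fun s => ker t r s * u s) 0 b -
     (c * ker t r' 0 + RInt (fun s => ker t r' s * u s) 0 b)) with
    (c * (ker t r 0 - ker t r' 0) + RInt (fun s => (ker t r s - ker t r' s) * u s) 0 b).
  - eapply Rle_trans; [apply Rabs_triang|]. rewrite Rmult_plus_distr_r. apply Rplus_le_compat.
    + rewrite Rabs_mult, (Rabs_pos_eq c), Rmult_assoc by exact hc.
      apply Rmult_le_compat_l; [exact hc|]. apply HL; lra.
    + apply Rle_trans with (L * Rabs (r - r') * picardB t c b * (b - 0)).
      * apply RInt_abs_le_const; [lra | intros; apply cont_mult; [apply cont_minus; apply ck | apply cu]|].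
        intros s hs. rewrite Rabs_mult. apply Rmult_le_compat; try apply Rabs_pos.
        -- apply HL; lra.
        -- destruct (picard_bound t c b n s ht hc hb ltac:(lra)). unfold u; rewrite Rabs_pos_eq; lra.
      * assert (0 <= L * Rabs (r - r') * picardB t c b) by (apply Rmult_le_pos; [nra | exact B0]).
        nra.
  - replace (RInt (fun s => (ker t r s - ker t r' s) * u s) 0 b) with
      (RInt (fun s => ker t r s * u s) 0 b - RInt (fun s => ker t r' s * u s) 0 b); [ring|].
    rewrite <- RInt_minus_R by (apply ex_RInt_cont; intros; apply cont_mult; [apply ck | apply cu]).
    apply RInt_ext; intros; eqR; ring.
Qed.

Lemma picard_decr (t c b : R) (n : nat) (r r' : R) : 0 < t <= 1 / 64 -> 0 <= c -> 0 <= b < 1 ->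
  0 <= r -> r <= r' -> r' <= 1 -> picard t c b n r' <= picard t c b n r.
Proof.
  intros ht hc hb. destruct (picard_lip t c b ht hc hb) as [L [hL HL]].
  revert r r'; induction n as [|n IH]; intros r r' h1 h2 h3; simpl; [lra|].
  apply heat_cut_decr with L; auto; try lra.
  - intros; apply cont_picard; lra.
  - intros; apply picard_bound; lra.
  - intros x y hx hxy hy. split; [apply IH; lra|].
    specialize (HL n x y ltac:(lra) ltac:(lra)). apply Rabs_le_between in HL.
    rewrite Rabs_minus_sym, (Rabs_pos_eq (y - x)) in HL by lra. lra.
Qed.

(** Starting from 0, the iterates increase because the kernel is positive, and each step multiplies
    the gap by at most [kap t b]. *)
Lemma picard_cauchy (t c b : R) (k n : nat) (r : R) : 0 < t <= 1 / 64 -> 0 <= c -> 0 <= b < 1 ->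
  0 <= r <= 1 -> 0 <= picard t c b (n + k) r - picard t c b n r <= kap t b ^ n * picardB t c b.
Proof.
  intros ht hc hb. assert (ht0 : 0 < t) by lra.
  revert r; induction n as [|n IH]; intros r hr.
  - simpl. pose proof (picard_bound t c b k r ht hc hb hr). lra.
  - cbn [Nat.add picard].
    assert (cu : forall m x, continuous (picard t c b m) x) by (intros; now apply cont_picard).
    assert (ck : forall x, continuous (ker t r) x) by (intros; now apply ker_cont_snd).
    rewrite heat_cut_minus by auto. split.
    + apply RInt_ge0_cont; [lra | intros; apply cont_mult; [apply ck | apply cont_minus; apply cu]|].
      intros s hs. apply Rmult_le_pos; [left; now apply ker_pos | apply IH; lra].
    + assert (P : Rabs (RInt (fun s => ker t r s * (picard t c b (n + k) s - picard t c b n s)) 0 b)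
        <= kap t b * (kap t b ^ n * picardB t c b)).
      { apply ker_int_abs_le; auto; [intros; apply cont_minus; apply cu|].
        intros s hs. destruct (IH s ltac:(lra)). rewrite Rabs_pos_eq; lra. }
      apply Rabs_le_between in P. simpl. lra.
Qed.

Lemma heat_cut_fixpoint (t c b : R) : 0 < t <= 1 / 64 -> 0 <= c -> 0 <= b < 1 ->
  exists v : R -> R, (forall x, continuous v x) /\ (forall r, v r = heat_cut t c b v r) /\
    (forall r, 0 <= r <= 1 -> 0 <= v r) /\
    (forall r r', 0 <= r -> r <= r' -> r' <= 1 -> v r' <= v r).
Proof.
  intros ht hc hb. assert (ht0 : 0 < t) by lra.
  destruct (kap_bound t b ht0 hb) as [k0 k1].
  (* The bounds on the iterates hold on [0, 1] only; the clamp makes [w] constant outside. *)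
  set (w := fun r => real (Lim_seq (fun n => picard t c b n (clamp 0 1 r)))).
  assert (lw : forall r, 0 <= r <= 1 -> is_lim_seq (fun n => picard t c b n r) (w r)).
  { intros r hr. unfold w. rewrite clamp_id by exact hr.
    apply Lim_seq_correct'. apply ex_finite_lim_seq_incr with (picardB t c b).
    - intros n. pose proof (picard_cauchy t c b 1 n r ht hc hb hr) as P.
      rewrite Nat.add_1_r in P. lra.
    - intros n. apply picard_bound; auto. }
  destruct (picard_lip t c b ht hc hb) as [L [hL HL]].
  assert (cw : forall x, continuous w x).
  { intros x. apply continuous_lip with L. intros y _.
    assert (E : forall z, w z = w (clamp 0 1 z)).
    { intros z; unfold w. rewrite (clamp_id 0 1 (clamp 0 1 z)); [reflexivity | apply clamp_in; lra]. }
    rewrite (E y), (E x).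
    apply Rle_trans with (L * Rabs (clamp 0 1 y - clamp 0 1 x)).
    2:{ apply Rmult_le_compat_l; [exact hL | apply clamp_lip]. }
    pose proof (clamp_in 0 1 y ltac:(lra)) as hy. pose proof (clamp_in 0 1 x ltac:(lra)) as hx.
    assert (Lm := is_lim_seq_minus' _ _ _ _ (lw _ hy) (lw _ hx)).
    apply is_lim_seq_abs in Lm.
    apply (is_lim_seq_le _ _ _ _ (fun n => HL n _ _ hy hx) Lm (is_lim_seq_const _)). }
  assert (err : forall n r, 0 <= r <= 1 -> Rabs (w r - picard t c b n r) <= kap t b ^ n * picardB t c b).
  { intros n r hr.
    assert (Lm : is_lim_seq (fun k => picard t c b (n + k) r - picard t c b n r) (w r - picard t c b n r)).
    { apply is_lim_seq_minus'; [|apply is_lim_seq_const].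
      apply is_lim_seq_ext with (fun k => picard t c b (k + n) r);
        [intros k; now rewrite Nat.add_comm|].
      apply (is_lim_seq_incr_n (fun k => picard t c b k r) n), lw, hr. }
    apply is_lim_seq_abs in Lm. refine (is_lim_seq_le _ _ _ _ _ Lm (is_lim_seq_const _)).
    intros k. pose proof (picard_cauchy t c b k n r ht hc hb hr). rewrite Rabs_pos_eq; lra. }
  assert (fw : forall r, 0 <= r <= 1 -> heat_cut t c b w r = w r).
  { intros r hr.
    assert (G : is_lim_seq (fun n => kap t b * (kap t b ^ n * picardB t c b)) 0).
    { replace (Finite 0) with (Rbar_mult (kap t b) (Rbar_mult 0 (picardB t c b))) by (simpl; f_equal; ring).
      apply is_lim_seq_scal_l, is_lim_seq_scal_r, is_lim_seq_geom. rewrite Rabs_pos_eq; lra. }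
    assert (L1 : is_lim_seq (fun n => picard t c b (S n) r) (heat_cut t c b w r)).
    { apply is_lim_seq_spec. intros eps.
      apply is_lim_seq_spec in G. destruct (G eps) as [N HN]. exists N. intros n hn.
      specialize (HN n hn). rewrite Rminus_0_r in HN.
      eapply Rle_lt_trans; [|eapply Rle_lt_trans; [apply Rle_abs | exact HN]].
      simpl picard. rewrite heat_cut_minus by (auto; intros; now apply cont_picard).
      apply ker_int_abs_le; auto.
      - intros; apply cont_minus; [now apply cont_picard | apply cw].
      - intros s hs. rewrite Rabs_minus_sym. apply err; lra. }
    assert (L2 := proj1 (is_lim_seq_incr_1 (fun n => picard t c b n r) (w r)) (lw r hr)).
    apply is_lim_seq_unique in L1. apply is_lim_seq_unique in L2. rewrite L1 in L2. now injection L2. }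
  (* [w] solves the equation on [0, 1]. One more application agrees with [w] there and solves it at
     every real point. *)
  exists (heat_cut t c b w). split; [|split; [|split]].
  - intros; now apply cont_heat_cut.
  - intros r. apply heat_cut_ext; [lra|]. intros s hs. symmetry; apply fw; lra.
  - intros r hr. rewrite fw by exact hr.
    apply (is_lim_seq_le (fun _ => 0) _ 0 (w r)) with (2 := is_lim_seq_const 0) (3 := lw r hr).
    intros n; apply picard_bound; auto.
  - intros r r' h1 h2 h3. rewrite !fw by lra.
    apply (is_lim_seq_le _ _ (w r') (w r)) with (2 := lw r' ltac:(lra)) (3 := lw r ltac:(lra)).
    intros n; now apply picard_decr.
Qed.

Lemma heat_cut_mass (t c b : R) (v : R -> R) : 0 < t -> 0 <= b <= 1 ->
  (forall x, continuous v x) -> (forall r, v r = heat_cut t c b v r) -> RInt v b 1 = c.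
Proof.
  intros ht hb cv fv.
  assert (ck : forall q x, continuous (ker t q) x) by (intros; now apply ker_cont_snd).
  assert (c1 : forall x : R, continuous (fun _ : R => 1) x) by (intros; apply continuous_const).
  assert (E : RInt v 0 1 = c + RInt v 0 b).
  { transitivity (RInt (fun r => c * ker t 0 r + RInt (fun s => ker t r s * v s) 0 b * 1) 0 1).
    - apply RInt_ext; intros r _; eqR. rewrite fv at 1. unfold heat_cut. rewrite (ker_sym t r 0) by exact ht. ring.
    - assert (ci : forall r, continuous (fun r => RInt (fun s => ker t r s * v s) 0 b) r)
        by (intros; now apply cont_ker_int).
      rewrite RInt_plus_R.
      + rewrite RInt_scal_R, ker_mass by (try apply ex_RInt_cont; auto; lra).
        rewrite (ker_dual t 0 1 0 b v (fun _ => 1)) by auto.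
        eqR. f_equal; [ring|]. apply RInt_ext. rewrite Rmin_left, Rmax_right by lra. intros s hs; eqR.
        replace (RInt (fun r => ker t s r * 1) 0 1) with (RInt (ker t s) 0 1)
          by (apply RInt_ext; intros; eqR; ring).
        rewrite ker_mass by (auto; lra). ring.
      + apply ex_RInt_cont; intros; apply cont_mult; [apply continuous_const | apply ck].
      + apply ex_RInt_cont; intros; cont. }
  pose proof (RInt_Chasles_R v 0 b 1 cv). lra.
Qed.

(** * Flux bounds *)

Record profile (j A t : R) (v : R -> R) : Prop := {
  profile_cont : forall x, continuous v x;
  profile_fix : forall r, v r = heat_cut t (j * t) (1 - A * t) v r;
  profile_ge0 : forall r, 0 <= r <= 1 -> 0 <= v r;
  profile_decr : forall r r', 0 <= r -> r <= r' -> r' <= 1 -> v r' <= v r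
}.

(** The first bound is the one of [theta_decr]; the second says that the cut strip, of width
    [A * t], is at most a quarter of the diffusion length [sqrt t]. *)
Definition small (A t : R) : Prop := 0 < t <= 1 / 64 /\ 4 * A * sqrt t <= 1.

Lemma sqrt_small (t : R) : 0 < t <= 1 / 64 -> 0 < sqrt t <= 1 / 8 /\ sqrt t * sqrt t = t.
Proof.
  intros ht. split; [split|].
  - apply sqrt_lt_R0; lra.
  - replace (1 / 8) with (sqrt (1 / 64)); [apply sqrt_le_1_alt; lra|].
    replace (1 / 64) with (1 / 8 * (1 / 8)) by field. apply sqrt_square; lra.
  - apply sqrt_sqrt; lra.
Qed.

Lemma RInt_ker_minus (t r a b k : R) (v : R -> R) : 0 < t -> (forall x, continuous v x) ->
  RInt (fun s => ker t r s * (v s - k)) a b = RInt (fun s => ker t r s * v s) a b - k * RInt (ker t r) a b.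
Proof.
  intros ht cv.
  assert (ck : forall x, continuous (ker t r) x) by (intros; now apply ker_cont_snd).
  rewrite <- RInt_scal_R by (now apply ex_RInt_cont).
  rewrite <- RInt_minus_R by (apply ex_RInt_cont; intros; cont).
  apply RInt_ext; intros; eqR; ring.
Qed.

Section Profile.
Variables (j A t : R) (v : R -> R).
Hypotheses (hj : 0 < j) (hA : 0 < A) (hs : small A t) (pv : profile j A t v).

Let h := sqrt t.
Let b := 1 - A * t.

Lemma small_facts : 0 < t <= 1 / 64 /\ 0 < h <= 1 / 8 /\ h * h = t /\ 4 * A * h <= 1 /\
  0 < A * t <= h / 4 /\ b = 1 - A * t.
Proof.
  destruct hs as [ht hAh]. destruct (sqrt_small t ht) as [h1 h2]. fold h in h1, h2, hAh.
  repeat split; try lra; try reflexivity; rewrite <- h2; nra.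
Qed.

Lemma cont_ker (r x : R) : continuous (ker t r) x.
Proof. destruct small_facts as [ht _]. apply ker_cont_snd; lra. Qed.

(** At [r = 0] the equation says that the kernel average of [v 0 - v s] equals the source term minus
    lost mass, hence is at most [2 j h]. Only the window [h, 2 h], where the kernel is at least
    [kerc / h], is kept for the lower bound. This covers the layer that [profile_step] cannot
    reach. *)
Lemma profile_start : v 0 - v h <= 2 * j / kerc * h.
Proof.
  destruct small_facts as (ht & hh & hht & hAh & hAt & hb).
  pose proof kerc_pos as hk. pose proof (Rinv_0_lt_compat h ltac:(lra)) as hi.
  assert (cf : forall k x, continuous (fun s => ker t 0 s * (k - v s)) x).
  { intros k x. apply cont_mult; [apply cont_ker | apply cont_minus; [apply continuous_const | apply pv]]. }
  assert (E : RInt (fun s => ker t 0 s * (v 0 - v s)) 0 b <= 2 * j * h).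
  { replace (RInt (fun s => ker t 0 s * (v 0 - v s)) 0 b)
      with (- RInt (fun s => ker t 0 s * (v s - v 0)) 0 b).
    - rewrite RInt_ker_minus by (try apply pv; lra).
      pose proof (profile_fix _ _ _ _ pv 0) as F. unfold heat_cut in F. fold b in F.
      pose proof (RInt_Chasles_R (ker t 0) 0 b 1 (cont_ker 0)) as M.
      rewrite ker_mass in M by lra.
      assert (0 <= RInt (ker t 0) b 1).
      { apply RInt_ge0_cont; [lra | apply cont_ker|]. intros; left; apply ker_pos; lra. }
      pose proof (profile_ge0 _ _ _ _ pv 0 ltac:(lra)).
      pose proof (ker_le t 0 0 ht ltac:(lra) ltac:(lra)) as K. fold h in K.
      assert (j * t * ker t 0 0 <= 2 * j * h).
      { apply Rle_trans with (j * t * (2 * / h)); [apply Rmult_le_compat_l; nra|].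
        rewrite <- hht. right; field; lra. }
      nra.
    - rewrite <- (Rmult_1_l (RInt _ 0 b)), Ropp_mult_distr_l, <- RInt_scal_R.
      + apply RInt_ext; intros; eqR; ring.
      + apply ex_RInt_cont. intros x. apply cont_mult; [apply cont_ker|].
        apply cont_minus; [apply pv | apply continuous_const]. }
  assert (LB : kerc * (v 0 - v h) <= RInt (fun s => ker t 0 s * (v 0 - v s)) 0 b).
  { apply Rle_trans with (RInt (fun s => ker t 0 s * (v 0 - v s)) h (2 * h)).
    - apply Rle_trans with (RInt (fun _ => kerc * / h * (v 0 - v h)) h (2 * h)).
      + rewrite RInt_const_R. right; field; lra.
      + apply RInt_le_cont; [lra | intros; apply continuous_const | apply cf|].
        intros s hs'. pose proof (profile_decr _ _ _ _ pv 0 h ltac:(lra) ltac:(lra) ltac:(lra)).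
        pose proof (profile_decr _ _ _ _ pv h s ltac:(lra) ltac:(lra) ltac:(lra)).
        apply Rmult_le_compat; try lra.
        * apply Rmult_le_pos; lra.
        * apply ker_ge; [lra|]. fold h. apply Rabs_le; lra.
    - apply RInt_subinterval; [lra | lra | apply cf|].
      intros s hs'. apply Rmult_le_pos; [left; apply ker_pos; lra|].
      pose proof (profile_decr _ _ _ _ pv 0 s ltac:(lra) ltac:(lra) ltac:(lra)). lra. }
  replace (2 * j / kerc * h) with (2 * j * h / kerc) by (field; lra).
  apply (Rle_div_r (v 0 - v h)); lra.
Qed.

Lemma profile_mass : RInt v b 1 = j * t.
Proof.
  destruct small_facts as (ht & hh & hht & hAh & hAt & hb).
  apply (heat_cut_mass t); [lra | lra | apply pv | apply pv].
Qed.

(** The cut mass [j t] spread over a strip of width [A t] has mean [j / A], and [v] is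
    decreasing. *)
Lemma profile_cut : v 1 <= j / A <= v b.
Proof.
  destruct small_facts as (ht & hh & hht & hAh & hAt & hb).
  pose proof profile_mass as M.
  assert (A * t * v 1 <= j * t).
  { rewrite <- M. replace (A * t) with (1 - b) by lra. rewrite <- RInt_const_R.
    apply RInt_le_cont; [lra | intros; apply continuous_const | apply pv|].
    intros; apply (profile_decr _ _ _ _ pv); lra. }
  assert (j * t <= A * t * v b).
  { rewrite <- M. replace (A * t) with (1 - b) by lra. rewrite <- RInt_const_R.
    apply RInt_le_cont; [lra | apply pv | intros; apply continuous_const|].
    intros; apply (profile_decr _ _ _ _ pv); lra. }
  split; [apply Rle_div_r | apply Rle_div_l]; nra.
Qed.

Lemma ker_int_end : RInt (ker t 1) b 1 <= 2 * A * h.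
Proof.
  destruct small_facts as (ht & hh & hht & hAh & hAt & hb).
  apply Rle_trans with (RInt (fun _ => 2 * / h) b 1).
  - apply RInt_le_cont; [lra | apply cont_ker | intros; apply continuous_const|].
    intros; apply ker_le; lra.
  - rewrite RInt_const_R. replace (1 - b) with (A * (h * h)) by (rewrite hht; lra).
    right; field; lra.
Qed.

(** At [r = 1], dropping the source, the equation gives [v 1 >= v b * (1 - RInt (ker t 1) b 1) + I]
    with [I] the third quantity, and the mass lost is at most [2 A h <= 1 / 2]. First
    [v b <= 2 * v 1], then [v b - v 1 + I <= v b * 2 A h <= 4 j h]. *)
Lemma profile_end : v b <= 2 * j / A /\ v b - v 1 <= 4 * j * h /\
  RInt (fun s => ker t 1 s * (v s - v b)) 0 b <= 4 * j * h.
Proof.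
  destruct small_facts as (ht & hh & hht & hAh & hAt & hb).
  destruct profile_cut as [c1 c2]. pose proof ker_int_end as K.
  pose proof (profile_fix _ _ _ _ pv 1) as F. unfold heat_cut in F. fold b in F.
  assert (0 <= j * t * ker t 1 0).
  { apply Rmult_le_pos; [nra|]. left; apply ker_pos; lra. }
  pose proof (RInt_Chasles_R (ker t 1) 0 b 1 (cont_ker 1)) as M. rewrite ker_mass in M by lra.
  pose proof (RInt_ker_minus t 1 0 b (v b) v ltac:(lra) (profile_cont _ _ _ _ pv)) as E.
  assert (P : 0 <= RInt (fun s => ker t 1 s * (v s - v b)) 0 b).
  { apply RInt_ge0_cont; [lra | |].
    - intros x. apply cont_mult; [apply cont_ker|]. apply cont_minus; [apply pv | apply continuous_const].
    - intros s hs'. apply Rmult_le_pos; [left; apply ker_pos; lra|].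
      pose proof (profile_decr _ _ _ _ pv s b ltac:(lra) ltac:(lra) ltac:(lra)). lra. }
  assert (B0 : 0 <= v b) by (apply pv; lra).
  assert (hja : A * (j / A) = j) by (field; lra).
  assert (hja0 : 0 < j / A) by (apply Rdiv_lt_0_compat; lra).
  assert (Q : v b * (1 - 2 * A * h) <= v 1 - RInt (fun s => ker t 1 s * (v s - v b)) 0 b).
  { assert (v b * RInt (ker t 1) b 1 <= v b * (2 * A * h)) by (apply Rmult_le_compat_l; lra). nra. }
  assert (B : v b <= 2 * (j / A)) by nra.
  assert (v b * (2 * A * h) <= 4 * j * h).
  { apply Rle_trans with (2 * (j / A) * (2 * A * h)); [apply Rmult_le_compat_r; nra|]. 
    right. replace (2 * (j / A) * (2 * A * h)) with (4 * (A * (j / A)) * h) by ring. rewrite hja; ring. }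
  repeat split; [unfold Rdiv in *; lra | lra | lra].
Qed.

(** The integral bounded in [profile_end] is restricted to [b - 3 h, b - 2 h], which is within [4 h]
    of 1 because [1 - b <= h / 4]. *)
Lemma profile_last : v (b - 2 * h) - v b <= 4 * j / kerc * h.
Proof.
  destruct small_facts as (ht & hh & hht & hAh & hAt & hb).
  pose proof kerc_pos as hk. pose proof (Rinv_0_lt_compat h ltac:(lra)) as hi.
  destruct profile_end as (_ & _ & E).
  assert (cf : forall k x, continuous (fun s => ker t 1 s * (v s - k)) x).
  { intros k x. apply cont_mult; [apply cont_ker | apply cont_minus; [apply pv | apply continuous_const]]. }
  assert (LB : kerc * (v (b - 2 * h) - v b) <= RInt (fun s => ker t 1 s * (v s - v b)) 0 b).
  { apply Rle_trans with (RInt (fun s => ker t 1 s * (v s - v b)) (b - 3 * h) (b - 2 * h)).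
    - apply Rle_trans with (RInt (fun _ => kerc * / h * (v (b - 2 * h) - v b)) (b - 3 * h) (b - 2 * h)).
      + rewrite RInt_const_R. right; field; lra.
      + apply RInt_le_cont; [lra | intros; apply continuous_const | apply cf|].
        intros s hs'. pose proof (profile_decr _ _ _ _ pv (b - 2 * h) b ltac:(lra) ltac:(lra) ltac:(lra)).
        pose proof (profile_decr _ _ _ _ pv s (b - 2 * h) ltac:(lra) ltac:(lra) ltac:(lra)).
        apply Rmult_le_compat; try lra.
        * apply Rmult_le_pos; lra.
        * apply ker_ge; [lra|]. fold h. apply Rabs_le; lra.
    - apply RInt_subinterval; [lra | lra | apply cf|].
      intros s hs'. apply Rmult_le_pos; [left; apply ker_pos; lra|].
      pose proof (profile_decr _ _ _ _ pv s b ltac:(lra) ltac:(lra) ltac:(lra)). lra. }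
  replace (4 * j / kerc * h) with (4 * j * h / kerc) by (field; lra).
  apply (Rle_div_r (v (b - 2 * h) - v b)); lra.
Qed.

(* The net flux through [a] in one step is at most the injected mass [j t]. *)
Lemma profile_flux (a : R) : 0 <= a <= b ->
  RInt (fun s => (v s - v a) * RInt (ker t s) a 1) 0 a <= j * t.
Proof.
  intros ha. destruct small_facts as (ht & hh & hht & hAh & hAt & hb).
  assert (ht0 : 0 < t) by lra.
  assert (cv : forall x, continuous v x) by apply pv.
  (* The share of a unit mass at [s] that lands in [0, a]. *)
  set (P := fun s => RInt (ker t s) 0 a).
  assert (cP : forall x, continuous P x) by (intros x; exact (cont_ker_int1 t 0 a x ht0)).
  assert (c1 : forall x : R, continuous (fun _ : R => 1) x) by (intros; apply continuous_const).
  assert (P0 : forall s, 0 <= P s).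
  { intros s. apply RInt_ge0_cont; [lra | apply cont_ker|]. intros; left; now apply ker_pos. }
  assert (Q : forall s, 0 <= s <= 1 -> RInt (ker t s) a 1 = 1 - P s).
  { intros s hs'. pose proof (RInt_Chasles_R (ker t s) 0 a 1 (cont_ker s)) as E.
    rewrite ker_mass in E by assumption. unfold P; lra. }
  assert (E1 : RInt v 0 a = j * t * P 0 + RInt (fun s => v s * P s) 0 b).
  { transitivity (RInt (fun r => j * t * ker t 0 r + RInt (fun s => ker t r s * v s) 0 b * 1) 0 a).
    - apply RInt_ext; intros r _; eqR. rewrite (profile_fix _ _ _ _ pv r) at 1.
      unfold heat_cut. fold b. rewrite (ker_sym t r 0) by exact ht0. ring.
    - assert (ci : forall r, continuous (fun r => RInt (fun s => ker t r s * v s) 0 b) r)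
        by (intros; now apply cont_ker_int).
      rewrite RInt_plus_R.
      + rewrite RInt_scal_R by (apply ex_RInt_cont, cont_ker).
        rewrite (ker_dual t 0 a 0 b v (fun _ => 1)) by auto.
        f_equal. apply RInt_ext; intros s _; eqR. f_equal.
        apply RInt_ext; intros; eqR; ring.
      + apply ex_RInt_cont; intros; apply cont_mult; [apply continuous_const | apply cont_ker].
      + apply ex_RInt_cont; intros; cont. }
  (* Kernel symmetry: a uniform density sends as much mass out of [0, a] as it brings in from
     [a, 1]. This is what lets the constant [v a] be subtracted. *)
  assert (E2 : RInt (fun s => 1 - P s) 0 a = RInt P a 1).
  { transitivity (RInt (fun r => RInt (fun s => ker t r s * 1) a 1 * 1) 0 a).
    - apply RInt_ext. rewrite Rmin_left, Rmax_right by lra. intros s hs'; eqR.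
      rewrite <- Q by lra. rewrite Rmult_1_r. apply RInt_ext; intros; eqR; ring.
    - rewrite (ker_dual t 0 a a 1 (fun _ => 1) (fun _ => 1)) by auto.
      apply RInt_ext; intros s _; eqR. unfold P. rewrite Rmult_1_l.
      apply RInt_ext; intros; eqR; ring. }
  assert (E3 : RInt (fun s => (v s - v a) * RInt (ker t s) a 1) 0 a =
    RInt v 0 a - RInt (fun s => v s * P s) 0 a - v a * RInt P a 1).
  { rewrite <- E2. rewrite <- RInt_scal_R by (apply ex_RInt_cont; intros; cont).
    rewrite <- !RInt_minus_R by (apply ex_RInt_cont; intros; cont).
    apply RInt_ext. rewrite Rmin_left, Rmax_right by lra. intros s hs'; eqR.
    rewrite Q by lra. ring. }
  (* Monotonicity enters here: [a, b] sends into [0, a] at most what the constant density [v a] on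
     [a, 1] would. *)
  assert (E4 : RInt (fun s => v s * P s) a b <= v a * RInt P a 1).
  { apply Rle_trans with (v a * RInt P a b).
    - rewrite <- RInt_scal_R by (now apply ex_RInt_cont).
      apply RInt_le_cont; [lra | intros; cont | intros; cont|].
      intros s hs'. apply Rmult_le_compat_r; [apply P0|]. apply (profile_decr _ _ _ _ pv); lra.
    - apply Rmult_le_compat_l; [apply pv; lra|].
      apply RInt_subinterval; [lra | lra | exact cP | intros; apply P0]. }
  assert (P01 : P 0 <= 1).
  { rewrite <- (ker_mass t 0) by lra. unfold P.
    apply RInt_subinterval; [lra | lra | apply cont_ker | intros; left; now apply ker_pos]. }
  assert (cvP : forall x, continuous (fun s => v s * P s) x) by (intros; cont).
  pose proof (RInt_Chasles_R (fun s => v s * P s) 0 a b cvP) as E5.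
  assert (j * t * P 0 <= j * t).
  { rewrite <- (Rmult_1_r (j * t)) at 2. apply Rmult_le_compat_l; [|exact P01].
    apply Rmult_le_pos; lra. }
  lra.
Qed.

(** In the flux through [x + h], only mass going from [x - h, x] to [x + h, x + 2 h] is kept. These
    points are at most [3 h] apart, so it contributes at least [h * kerc] times the drop, against a
    total of [j t = j h ^ 2]. *)
Lemma profile_step (x : R) : h <= x <= b - 2 * h -> v x - v (x + h) <= j / kerc * h.
Proof.
  intros hx. destruct small_facts as (ht & hh & hht & hAh & hAt & hb).
  pose proof kerc_pos as hk. pose proof (Rinv_0_lt_compat h ltac:(lra)) as hi.
  set (a := x + h).
  pose proof (profile_flux a ltac:(unfold a; lra)) as E.
  assert (cf : forall y, continuous (fun s => (v s - v a) * RInt (ker t s) a 1) y).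
  { intros y. apply cont_mult; [apply cont_minus; [apply pv | apply continuous_const]|].
    apply cont_ker_int1; lra. }
  assert (LB : h * ((v x - v a) * kerc) <= RInt (fun s => (v s - v a) * RInt (ker t s) a 1) 0 a).
  { apply Rle_trans with (RInt (fun s => (v s - v a) * RInt (ker t s) a 1) (x - h) x).
    - replace (h * ((v x - v a) * kerc)) with (RInt (fun _ => (v x - v a) * kerc) (x - h) x)
        by (rewrite RInt_const_R; eqR; ring).
      apply RInt_le_cont; [lra | intros; apply continuous_const | apply cf|].
      intros s hs'. pose proof (profile_decr _ _ _ _ pv s x ltac:(lra) ltac:(lra) ltac:(lra)).
      pose proof (profile_decr _ _ _ _ pv x a ltac:(lra) ltac:(unfold a; lra) ltac:(unfold a; lra)).
      apply Rmult_le_compat; try lra.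
      apply Rle_trans with (RInt (ker t s) a (a + h)).
      + replace kerc with (RInt (fun _ => kerc * / h) a (a + h))
          by (rewrite RInt_const_R; eqR; field; lra).
        apply RInt_le_cont; [lra | intros; apply continuous_const | apply cont_ker|].
        intros r hr. apply ker_ge; [lra|]. fold h. unfold a in hr. apply Rabs_le; lra.
      + apply RInt_subinterval; [lra | unfold a; lra | apply cont_ker|].
        intros; left; apply ker_pos; lra.
    - unfold a. apply RInt_subinterval; [lra | lra | apply cf|].
      intros s hs'. apply Rmult_le_pos.
      + pose proof (profile_decr _ _ _ _ pv s a ltac:(lra) ltac:(unfold a; lra) ltac:(unfold a; lra)).
        fold a; lra.
      + apply RInt_ge0_cont; [lra | apply cont_ker|]. intros; left; apply ker_pos; lra. }
  replace (j / kerc * h) with (j * h / kerc) by (field; lra).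
  apply (Rle_div_r (v x - v a)); [exact hk|].
  apply Rmult_le_reg_l with h; [lra|]. nra.
Qed.

(** A common upper bound for the constants of the start, step, last and end estimates. *)
Definition profC : R := 4 * j / kerc + 4 * j.

Lemma profC_ge : 0 < profC /\ 2 * j / kerc <= profC /\ 4 * j / kerc <= profC /\ j / kerc <= profC /\ 4 * j <= profC.
Proof.
  pose proof kerc_pos as hk. assert (0 < j / kerc) by (now apply Rdiv_lt_0_compat).
  unfold profC. unfold Rdiv in *. repeat split; lra.
Qed.

Lemma profile_chain (n : nat) (x y : R) : h <= x -> x <= y -> y <= b - 2 * h -> y <= x + INR n * h ->
  v x - v y <= INR n * (profC * h).
Proof.
  destruct small_facts as (ht & hh & hht & hAh & hAt & hb).
  destruct profC_ge as (g0 & g1 & g2 & g3 & g4).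
  revert x; induction n as [|n IH]; intros x h1 h2 h3 h4.
  - simpl in h4. replace y with x by lra. simpl; lra.
  - rewrite S_INR in *.
    assert (S : v x - v (x + h) <= profC * h).
    { eapply Rle_trans; [apply profile_step; lra|]. apply Rmult_le_compat_r; lra. }
    destruct (Rle_lt_dec y (x + h)).
    + pose proof (profile_decr _ _ _ _ pv y (x + h) ltac:(lra) ltac:(lra) ltac:(lra)).
      pose proof (pos_INR n). assert (0 <= INR n * (profC * h)) by (apply Rmult_le_pos; nra). lra.
    + specialize (IH (x + h) ltac:(lra) ltac:(lra) h3 ltac:(lra)). lra.
Qed.

(** Both points are clamped to [h, b - 2 h], where [profile_chain] applies. The [4 h] counts one
    unit for the left layer, two for the right one (up to [b], then up to 1) and one for rounding up
    the number of steps. *)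
Lemma profile_modulus (x y : R) : 0 <= x -> x <= y -> y <= 1 ->
  v x - v y <= profC * ((y - x) + 4 * h).
Proof.
  intros h1 h2 h3. destruct small_facts as (ht & hh & hht & hAh & hAt & hb).
  destruct profC_ge as (g0 & g1 & g2 & g3 & g4).
  set (x' := clamp h (b - 2 * h) x). set (y' := clamp h (b - 2 * h) y).
  pose proof (clamp_in h (b - 2 * h) x ltac:(lra)) as hx. fold x' in hx.
  pose proof (clamp_in h (b - 2 * h) y ltac:(lra)) as hy. fold y' in hy.
  assert (hxy : x' <= y' /\ y' - x' <= y - x).
  { unfold x', y', clamp, Rmax, Rmin; repeat destruct Rle_dec; lra. }
  assert (X : v x - v x' <= profC * h).
  { destruct (Rle_lt_dec x h).
    - replace x' with h by (unfold x', clamp, Rmax, Rmin; repeat destruct Rle_dec; lra).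
      pose proof (profile_decr _ _ _ _ pv 0 x ltac:(lra) ltac:(lra) ltac:(lra)).
      pose proof profile_start. assert (2 * j / kerc * h <= profC * h) by (apply Rmult_le_compat_r; lra). lra.
    - assert (x' <= x) by (unfold x', clamp, Rmax, Rmin; repeat destruct Rle_dec; lra).
      pose proof (profile_decr _ _ _ _ pv x' x ltac:(lra) ltac:(lra) ltac:(lra)). nra. }
  assert (Y : v y' - v y <= 2 * (profC * h)).
  { destruct (Rle_lt_dec y (b - 2 * h)).
    - assert (y <= y') by (unfold y', clamp, Rmax, Rmin; repeat destruct Rle_dec; lra).
      pose proof (profile_decr _ _ _ _ pv y y' ltac:(lra) ltac:(lra) ltac:(lra)). nra.
    - replace y' with (b - 2 * h) by (unfold y', clamp, Rmax, Rmin; repeat destruct Rle_dec; lra).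
      pose proof (profile_decr _ _ _ _ pv y 1 ltac:(lra) ltac:(lra) ltac:(lra)).
      pose proof profile_last. destruct profile_end as (_ & e & _).
      assert (4 * j / kerc * h <= profC * h) by (apply Rmult_le_compat_r; lra).
      assert (4 * j * h <= profC * h) by (apply Rmult_le_compat_r; lra). lra. }
  destruct (nfloor_ex ((y' - x') / h)) as [n [n1 n2]]; [apply Rdiv_le_0_compat; lra|].
  assert (n1' : INR n * h <= y' - x') by (apply Rle_div_r; lra).
  assert (n2' : y' - x' < (INR n + 1) * h) by (apply Rlt_div_l; lra).
  pose proof (profile_chain (S n) x' y' ltac:(lra) ltac:(lra) ltac:(lra)) as C.
  rewrite S_INR in C. specialize (C ltac:(lra)).
  assert ((INR n + 1) * (profC * h) <= profC * (y - x + h)); nra.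
Qed.

Lemma profile_bound (x : R) : 0 <= x <= 1 -> 0 <= v x <= j / A + 2 * profC.
Proof.
  intros hx. destruct small_facts as (ht & hh & hht & hAh & hAt & hb).
  destruct profC_ge as (g0 & _). split; [now apply pv|].
  pose proof (profile_modulus x 1 ltac:(lra) ltac:(lra) ltac:(lra)).
  destruct profile_cut. nra.
Qed.

Lemma profile_at_one : Rabs (v 1 - j / A) <= profC * h.
Proof.
  destruct small_facts as (ht & hh & hht & hAh & hAt & hb).
  destruct profC_ge as (g0 & g1 & g2 & g3 & g4).
  destruct profile_cut. destruct profile_end as (_ & e & _).
  assert (4 * j * h <= profC * h) by (apply Rmult_le_compat_r; lra).
  apply Rabs_le; lra.
Qed.

End Profile.

(** * Test functions *)

Lemma gauss_one_le (t : R) : 0 < t -> gauss t 1 <= 16 * t * sqrt t.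
Proof.
  intros ht. eapply Rle_trans; [|apply exp_tail_small; exact ht].
  right; unfold gauss. do 2 f_equal. field; lra.
Qed.

Lemma RInt_gauss_01 (t : R) : 0 < t <= 1 / 64 ->
  1 / 2 - 64 * t * sqrt t <= RInt (gauss t) 0 1 <= 1 / 2.
Proof.
  intros ht. assert (ht0 : 0 < t) by lra.
  assert (ct : forall x, continuous (theta t) x) by (intros; now apply continuous_theta).
  assert (cg : forall x, continuous (gauss t) x) by (intros; now apply continuous_gauss).
  rewrite <- (RInt_theta t ht0). split.
  - apply Rle_trans with (RInt (fun z => theta t z - 64 * t * sqrt t) 0 1).
    + rewrite RInt_minus_R by (apply ex_RInt_cont; intros; cont). rewrite RInt_const_R. right; ring.
    + apply RInt_le_cont; [lra | intros; cont | intros; cont|].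
      intros z hz. pose proof (theta_le t z ltac:(lra) ltac:(lra)). lra.
  - apply RInt_le_cont; [lra | exact cg | exact ct |]. intros; now apply gauss_le_theta.
Qed.

Lemma RInt_gauss_z2 (t : R) : 0 < t ->
  RInt (fun z => gauss t z * z ^ 2) 0 1 = t * RInt (gauss t) 0 1 - t * gauss t 1.
Proof.
  intros ht.
  assert (cg : forall x, continuous (gauss t) x) by (intros; now apply continuous_gauss).
  rewrite <- RInt_scal_R by now apply ex_RInt_cont.
  assert (E : RInt (fun z => gauss t z * z ^ 2 - t * gauss t z) 0 1 = - t * 1 * gauss t 1 - - t * 0 * gauss t 0).
  { apply is_RInt_unique.
    apply (is_RInt_derive (fun z => - t * z * gauss t z)).
    - intros z _. replace (gauss t z * z ^ 2 - t * gauss t z)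
        with (- t * gauss t z + - t * z * (- (z / t) * gauss t z)) by (field; lra).
      apply (is_derive_mult (fun z => - t * z) (gauss t)).
      + auto_derive; auto; ring.
      + now apply is_derive_gauss.
      + intros; apply Rmult_comm.
    - intros z _; cont. }
  rewrite RInt_minus_R in E by (apply ex_RInt_cont; intros; cont). lra.
Qed.

Lemma RInt_gauss_z3 (t : R) : 0 < t -> RInt (fun z => gauss t z * z ^ 3) 0 1 <= t * sqrt t.
Proof.
  intros ht.
  assert (cg : forall x, continuous (gauss t) x) by (intros; now apply continuous_gauss).
  assert (E : RInt (fun z => gauss t z * z ^ 3) 0 1 =
    - t * (1 ^ 2 + 2 * t) * gauss t 1 - - t * (0 ^ 2 + 2 * t) * gauss t 0).
  { apply is_RInt_unique.
    apply (is_RInt_derive (fun z => - t * (z ^ 2 + 2 * t) * gauss t z)).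
    - intros z _. replace (gauss t z * z ^ 3)
        with (- t * (2 * z) * gauss t z + - t * (z ^ 2 + 2 * t) * (- (z / t) * gauss t z)) by (field; lra).
      apply (is_derive_mult (fun z => - t * (z ^ 2 + 2 * t)) (gauss t)).
      + auto_derive; auto; ring.
      + now apply is_derive_gauss.
      + intros; apply Rmult_comm.
    - intros z _; cont. }
  rewrite E. pose proof (gauss_pos t 1 ht). pose proof (gauss0_le t 0 ht) as G.
  pose proof (sqrt_lt_R0 t ht).
  assert (t * (2 * t) * gauss t 0 <= t * sqrt t).
  { apply Rle_trans with (t * (2 * t) * / (2 * sqrt t)); [apply Rmult_le_compat_l; nra|].
    right. rewrite <- (sqrt_sqrt t) at 2 by lra. field; lra. }
  assert (0 <= t * (1 ^ 2 + 2 * t) * gauss t 1) by (apply Rmult_le_pos; nra). nra.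
Qed.

(** The error adds 64 for the images, 64 for the Gaussian mass missing from [0, 1] and 16 for the
    boundary term of the integration by parts. *)
Lemma theta_moment2 (t : R) : 0 < t <= 1 / 64 ->
  Rabs (RInt (fun z => theta t z * z ^ 2) 0 1 - t / 2) <= 144 * t * sqrt t.
Proof.
  intros ht. assert (ht0 : 0 < t) by lra.
  assert (ct : forall x, continuous (theta t) x) by (intros; now apply continuous_theta).
  assert (cg : forall x, continuous (gauss t) x) by (intros; now apply continuous_gauss).
  pose proof (sqrt_lt_R0 t ht0) as hs.
  pose proof (RInt_gauss_z2 t ht0) as E. pose proof (RInt_gauss_01 t ht) as G.
  pose proof (gauss_one_le t ht0). pose proof (gauss_pos t 1 ht0).
  assert (lo : RInt (fun z => gauss t z * z ^ 2) 0 1 <= RInt (fun z => theta t z * z ^ 2) 0 1).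
  { apply RInt_le_cont; [lra | intros; cont | intros; cont|].
    intros z hz. apply Rmult_le_compat_r; [apply pow2_ge_0 | now apply gauss_le_theta]. }
  assert (up : RInt (fun z => theta t z * z ^ 2) 0 1 <= RInt (fun z => gauss t z * z ^ 2) 0 1 + 64 * t * sqrt t).
  { apply Rle_trans with (RInt (fun z => gauss t z * z ^ 2 + 64 * t * sqrt t) 0 1).
    - apply RInt_le_cont; [lra | intros; cont | intros; cont|].
      intros z hz. pose proof (theta_le t z ltac:(lra) ltac:(lra)).
      assert (0 <= z ^ 2 <= 1) by nra.
      assert (0 < t * sqrt t) by nra. nra.
    - rewrite RInt_plus_R by (apply ex_RInt_cont; intros; cont). rewrite RInt_const_R. right; ring. }
  assert (0 < t * sqrt t) by nra.
  apply Rabs_le. nra.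
Qed.

Lemma theta_moment3 (t : R) : 0 < t <= 1 / 64 ->
  RInt (fun z => theta t z * z ^ 3) 0 1 <= 65 * t * sqrt t.
Proof.
  intros ht. assert (ht0 : 0 < t) by lra.
  assert (ct : forall x, continuous (theta t) x) by (intros; now apply continuous_theta).
  assert (cg : forall x, continuous (gauss t) x) by (intros; now apply continuous_gauss).
  pose proof (sqrt_lt_R0 t ht0) as hs. pose proof (RInt_gauss_z3 t ht0).
  apply Rle_trans with (RInt (fun z => gauss t z * z ^ 3 + 64 * t * sqrt t) 0 1).
  - apply RInt_le_cont; [lra | intros; cont | intros; cont|].
    intros z hz. pose proof (theta_le t z ltac:(lra) ltac:(lra)).
    assert (0 <= z ^ 3 <= 1).
    { split; [apply pow_le; lra|]. rewrite <- (pow1 3). apply pow_incr; lra. }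
    assert (0 < t * sqrt t) by nra. nra.
  - rewrite RInt_plus_R by (apply ex_RInt_cont; intros; cont). rewrite RInt_const_R.
    change (RInt (fun z => gauss t z * z ^ 3) 0 1 + (1 - 0) * (64 * t * sqrt t) <= 65 * t * sqrt t). lra.
Qed.

(** [q] plays the role of [phi'']. Evenness and mean zero are what make its double primitive even
    about 0 and 1, hence a Neumann test function to which [ker_unfold] applies. *)
Record test_second_derivative (q : R -> R) (L M : R) : Prop := {
  test_lip : forall x y, Rabs (q x - q y) <= L * Rabs (x - y);
  test_bound : forall x, 0 <= x <= 1 -> Rabs (q x) <= M;
  test_even0 : forall y, 0 <= y <= 1 -> q (- y) = q y;
  test_even1 : forall y, 0 <= y <= 1 -> q (2 - y) = q y;
  test_mean : RInt q 0 1 = 0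
}.

Section Test.
Variables (q : R -> R) (L M : R).
Hypothesis (hq : test_second_derivative q L M).

Let cq : forall x, continuous q x.
Proof. intros x; apply continuous_lip with L. intros; apply (test_lip _ _ _ hq). Qed.

Let L0 : 0 <= L.
Proof.
  pose proof (test_lip _ _ _ hq 1 0) as H. pose proof (Rabs_pos (q 1 - q 0)).
  rewrite Rminus_0_r, Rabs_R1 in H. lra.
Qed.

Let M0 : 0 <= M.
Proof. pose proof (test_bound _ _ _ hq 0 ltac:(lra)). pose proof (Rabs_pos (q 0)). lra. Qed.

Definition test_prim (x : R) : R := RInt q 0 x.
(** The double primitive [int_0^x (x - s) q(s) ds], which vanishes at 0 together with its
    derivative, split so that the product rule differentiates it. *)
Definition test_fun (x : R) : R := x * test_prim x - RInt (fun s => s * q s) 0 x.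

Let csq : forall x, continuous (fun s => s * q s) x.
Proof. intros; cont. Qed.

Let cprim : forall x, continuous test_prim x.
Proof. intros; now apply RInt_cont. Qed.

Let ctf : forall x, continuous test_fun x.
Proof.
  intros x; unfold test_fun. apply cont_minus; [apply cont_mult|].
  - apply continuous_id.
  - apply cprim.
  - now apply RInt_cont.
Qed.

Lemma is_derive_test_fun (x : R) : is_derive test_fun x (test_prim x).
Proof.
  unfold test_fun. replace (test_prim x) with ((1 * test_prim x + x * q x) - x * q x) by ring.
  apply (@is_derive_minus R_AbsRing R_NormedModule).
  - apply (is_derive_mult (fun x => x) test_prim).
    + auto_derive; auto.
    + now apply is_derive_RInt_cont.
    + intros; apply Rmult_comm.
  - now apply (is_derive_RInt_cont (fun s => s * q s)).
Qed.

Lemma test_fun_0 : test_fun 0 = 0.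
Proof. unfold test_fun. rewrite RInt_point. unfold zero; simpl; ring. Qed.

Lemma test_fun_1 : test_fun 1 = - RInt (fun s => s * q s) 0 1.
Proof. unfold test_fun, test_prim. rewrite (test_mean _ _ _ hq). ring. Qed.

Lemma RInt_swap (f : R -> R) (a b : R) : (forall x, continuous f x) -> RInt f a b = - RInt f b a.
Proof.
  intros H. symmetry. apply (opp_RInt_swap (V := R_CompleteNormedModule)). now apply ex_RInt_cont.
Qed.

Lemma test_fun_even0 (y : R) : 0 <= y <= 1 -> test_fun (- y) = test_fun y.
Proof.
  intros hy.
  assert (P : test_prim (- y) = - test_prim y).
  { unfold test_prim. rewrite RInt_swap by exact cq. f_equal.
    replace (RInt q (- y) 0) with (RInt q (0 - y) (0 - 0)) by (f_equal; ring).
    rewrite <- RInt_refl by exact cq. apply RInt_ext.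
    rewrite Rmin_left, Rmax_right by lra. intros s hs; eqR.
    rewrite Rminus_0_l. apply (test_even0 _ _ _ hq); lra. }
  assert (K : RInt (fun s => s * q s) 0 (- y) = RInt (fun s => s * q s) 0 y).
  { rewrite RInt_swap by exact csq.
    replace (RInt (fun s => s * q s) (- y) 0) with (RInt (fun s => s * q s) (0 - y) (0 - 0)) by (f_equal; ring).
    rewrite <- (RInt_refl (fun s => s * q s)) by exact csq.
    match goal with |- - ?a = _ => replace (- a) with (-1 * a) by ring end.
    rewrite <- RInt_scal_R by (apply ex_RInt_cont; intros; cont).
    apply RInt_ext.
    rewrite Rmin_left, Rmax_right by lra. intros s hs; eqR.
    rewrite Rminus_0_l, (test_even0 _ _ _ hq) by lra. ring. }
  unfold test_fun. rewrite P, K. ring.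
Qed.

(** Mean zero gives [test_prim 1 = 0], so [test_prim] is odd about 1 and its primitive even. *)
Lemma test_fun_even1 (y : R) : 0 <= y <= 1 -> test_fun (2 - y) = test_fun y.
Proof.
  intros hy.
  pose proof (RInt_Chasles_R q 0 y 1 cq) as Q1. rewrite (test_mean _ _ _ hq) in Q1.
  assert (P : test_prim (2 - y) = - test_prim y).
  { unfold test_prim. rewrite <- (RInt_Chasles_R q 0 1 (2 - y)) by exact cq.
    rewrite (test_mean _ _ _ hq).
    replace (RInt q 1 (2 - y)) with (RInt q (2 - 1) (2 - y)) by (f_equal; ring).
    rewrite <- RInt_refl by exact cq.
    replace (RInt (fun y => q (2 - y)) y 1) with (RInt q y 1); [lra|].
    apply RInt_ext. rewrite Rmin_left, Rmax_right by lra. intros s hs; eqR.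
    symmetry; apply (test_even1 _ _ _ hq); lra. }
  assert (K : RInt (fun s => s * q s) 0 (2 - y) = RInt (fun s => s * q s) 0 y - 2 * test_prim y).
  { rewrite <- (RInt_Chasles_R (fun s => s * q s) 0 1 (2 - y)) by exact csq.
    rewrite <- (RInt_Chasles_R (fun s => s * q s) 0 y 1) by exact csq.
    replace (RInt (fun s => s * q s) 1 (2 - y)) with (RInt (fun s => s * q s) (2 - 1) (2 - y)) by (f_equal; ring).
    rewrite <- (RInt_refl (fun s => s * q s)) by exact csq.
    replace (RInt (fun s => (2 - s) * q (2 - s)) y 1) with (2 * RInt q y 1 - RInt (fun s => s * q s) y 1).
    - unfold test_prim. lra.
    - rewrite <- RInt_scal_R by (now apply ex_RInt_cont).
      rewrite <- RInt_minus_R by (apply ex_RInt_cont; intros; cont).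
      apply RInt_ext. rewrite Rmin_left, Rmax_right by lra. intros s hs; eqR.
      rewrite (test_even1 _ _ _ hq) by lra. ring. }
  unfold test_fun. rewrite P, K. ring.
Qed.

(** One mean value step in [z]: the derivative of the remainder is the integral of [q s - q r] over
    [r - z, r + z], at most [2 L z ^ 2] since [q] is Lipschitz. *)
Lemma test_second_difference (r z : R) : 0 <= z ->
  Rabs (test_fun (r + z) + test_fun (r - z) - 2 * test_fun r - z ^ 2 * q r) <= 2 * L * z ^ 3.
Proof.
  intros hz.
  set (D := fun z => test_fun (r + z) + test_fun (r - z) - 2 * test_fun r - z ^ 2 * q r).
  set (dD := fun z => test_prim (r + z) - test_prim (r - z) - 2 * z * q r).
  assert (HD : forall x, is_derive D x (dD x)).
  { intros x. unfold D, dD.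
    replace (test_prim (r + x) - test_prim (r - x) - 2 * x * q r)
      with (1 * test_prim (r + x) + -1 * test_prim (r - x) - 0 - 2 * x * q r) by ring.
    apply (@is_derive_minus R_AbsRing R_NormedModule);
      [apply (@is_derive_minus R_AbsRing R_NormedModule);
        [apply (@is_derive_plus R_AbsRing R_NormedModule)|]|].
    - apply (is_derive_comp test_fun (fun z => r + z)); [apply is_derive_test_fun|].
      auto_derive; auto.
    - apply (is_derive_comp test_fun (fun z => r - z)); [apply is_derive_test_fun|].
      auto_derive; auto; ring.
    - apply (@is_derive_const R_AbsRing R_NormedModule).
    - auto_derive; auto; ring. }
  destruct (MVT_gen D 0 z dD) as [x [hx E]].
  - intros; apply HD.
  - intros; apply continuity_pt_filterlim, (continuous_of_derive D). eexists; apply HD.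
  - rewrite Rmin_left, Rmax_right in hx by lra.
    replace (D 0) with 0 in E.
    2:{ unfold D. rewrite Rplus_0_r, Rminus_0_r. ring. }
    change (Rabs (D z) <= 2 * L * z ^ 3).
    rewrite Rminus_0_r in E. rewrite E, Rabs_mult, Rminus_0_r, (Rabs_pos_eq z) by lra.
    assert (B : Rabs (dD x) <= L * x * ((r + x) - (r - x))).
    { replace (dD x) with (RInt (fun s => q s - q r) (r - x) (r + x)).
      - apply RInt_abs_le_const; [lra | intros; cont|].
        intros s hs. eapply Rle_trans; [apply (test_lip _ _ _ hq)|].
        apply Rmult_le_compat_l; [exact L0 | apply Rabs_le; lra].
      - rewrite RInt_minus_R by (apply ex_RInt_cont; intros; cont). rewrite RInt_const_R.
        unfold dD, test_prim. pose proof (RInt_Chasles_R q 0 (r - x) (r + x) cq). lra. }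
    apply Rle_trans with (L * x * (r + x - (r - x)) * z); [apply Rmult_le_compat_r; lra|].
    replace (L * x * (r + x - (r - x)) * z) with (2 * L * (x * x * z)) by ring.
    apply Rmult_le_compat_l; [lra|].
    replace (z ^ 3) with (z * z * z) by ring. apply Rmult_le_compat_r; [lra|]. apply Rmult_le_compat; lra.
Qed.

(** 144 is the error of the second moment, and 130 is twice the bound 65 on the third. *)
Definition testC : R := 144 * M + 130 * L.

Lemma testC_ge0 : 0 <= testC.
Proof. unfold testC; pose proof M0; pose proof L0; lra. Qed.

(** After unfolding, the integrand is a second difference of [test_fun]. Since [theta] has mass 1 /
    2 on [0, 1], the term [2 * test_fun r] reproduces [test_fun r]; the second moment gives
    [t / 2 * q r], and the third controls the rest. *)
Lemma heat_test_fun (t r : R) : 0 < t <= 1 / 64 -> 0 <= r <= 1 ->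
  Rabs (RInt (fun s => ker t r s * test_fun s) 0 1 - test_fun r - t / 2 * q r) <= testC * (t * sqrt t).
Proof.
  intros ht hr. assert (ht0 : 0 < t) by lra. pose proof (sqrt_lt_R0 t ht0) as hs.
  assert (ct : forall x, continuous (theta t) x) by (intros; now apply continuous_theta).
  assert (cphi := ctf).
  rewrite (ker_unfold t r test_fun ht0 hr ctf test_fun_even0 test_fun_even1).
  set (I2 := RInt (fun z => theta t z * z ^ 2) 0 1).
  assert (E : RInt (fun z => theta t z * (test_fun (r + z) + test_fun (r - z))) 0 1 - test_fun r - t / 2 * q r =
    RInt (fun z => theta t z * (test_fun (r + z) + test_fun (r - z) - 2 * test_fun r - z ^ 2 * q r)) 0 1
    + q r * (I2 - t / 2)).
  { replace (RInt (fun z => theta t z * (test_fun (r + z) + test_fun (r - z) - 2 * test_fun r - z ^ 2 * q r)) 0 1)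
      with (RInt (fun z => theta t z * (test_fun (r + z) + test_fun (r - z))) 0 1
            - 2 * test_fun r * RInt (theta t) 0 1 - q r * I2).
    - rewrite RInt_theta by exact ht0. field.
    - unfold I2. rewrite <- !RInt_scal_R by (apply ex_RInt_cont; intros; cont).
      rewrite <- !RInt_minus_R by (apply ex_RInt_cont; intros; cont).
      apply RInt_ext; intros; eqR; ring. }
  rewrite E. eapply Rle_trans; [apply Rabs_triang|].
  unfold testC. rewrite Rmult_plus_distr_r, Rplus_comm. apply Rplus_le_compat.
  - rewrite Rabs_mult. replace (144 * M * (t * sqrt t)) with (M * (144 * t * sqrt t)) by ring.
    apply Rmult_le_compat; try apply Rabs_pos; [now apply (test_bound _ _ _ hq) | now apply theta_moment2].
  - apply Rle_trans with (RInt (fun z => 2 * L * (theta t z * z ^ 3)) 0 1).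
    + apply RInt_abs_le_cont; [lra | intros; cont | intros; cont|].
      intros z hz. rewrite Rabs_mult, (Rabs_pos_eq (theta t z)) by (left; now apply theta_pos).
      replace (2 * L * (theta t z * z ^ 3)) with (theta t z * (2 * L * z ^ 3)) by ring.
      apply Rmult_le_compat_l; [left; now apply theta_pos|]. apply test_second_difference; lra.
    + rewrite RInt_scal_R by (apply ex_RInt_cont; intros; cont).
      pose proof (theta_moment3 t ht). pose proof L0.
      apply Rle_trans with (2 * L * (65 * t * sqrt t)); [apply Rmult_le_compat_l; lra | lra].
Qed.

Lemma profile_test (j A : R) : 0 < j -> 0 < A -> exists C, 0 <= C /\
  forall t v, small A t -> profile j A t v ->
    Rabs (RInt (fun s => (v s - 2 * j * (1 - s)) * q s) 0 1) <= C * sqrt t.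
Proof.
  intros hj hA. set (B := j / A + 2 * profC j).
  assert (B0 : 0 <= B).
  { destruct (profC_ge j hj) as [g _]. assert (0 < j / A) by (now apply Rdiv_lt_0_compat). unfold B; lra. }
  pose proof testC_ge0 as T0. pose proof M0 as M0'.
  (* After division by [t / 2] and [t <= sqrt t]: the first term comes half from [e0] and half from
     [e3], the others from [e0], [e1] and [e2] in this order. *)
  exists (2 * j * M + 2 * j * testC + 2 * M * A * j + 2 * B * testC).
  split; [assert (0 <= j * M) by nra; assert (0 <= j * testC) by nra;
          assert (0 <= M * A * j) by (apply Rmult_le_pos; nra); nra|].
  intros t v hs pv.
  destruct (small_facts A t hA hs) as (ht & hh & hht & hAh & hAt & _).
  set (h := sqrt t) in *. assert (ht0 : 0 < t) by lra. set (b := 1 - A * t).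
  assert (cv : forall x, continuous v x) by apply pv. assert (cphi := ctf).
  assert (ck : forall r x, continuous (ker t r) x) by (intros; now apply ker_cont_snd).
  set (Gf := fun r => RInt (fun s => ker t r s * test_fun s) 0 1).
  assert (cG : forall x, continuous Gf x) by (intros x; exact (cont_ker_int t test_fun 0 1 x ht0 ctf)).
  (* The source sits at 0, where [test_fun] vanishes, so it contributes only O([t ^ 2]). *)
  assert (e0 : Rabs (j * t * Gf 0) <= j * t * (M * t / 2 + testC * (t * h))).
  { rewrite Rabs_mult, (Rabs_pos_eq (j * t)) by nra. apply Rmult_le_compat_l; [nra|].
    pose proof (heat_test_fun t 0 ht ltac:(lra)) as G. rewrite test_fun_0 in G. fold (Gf 0) in G.
    pose proof (test_bound _ _ _ hq 0 ltac:(lra)) as Q.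
    replace (Gf 0) with ((Gf 0 - 0 - t / 2 * q 0) + t / 2 * q 0) by ring.
    eapply Rle_trans; [apply Rabs_triang|]. rewrite (Rabs_mult (t / 2)), (Rabs_pos_eq (t / 2)) by lra.
    fold h in G. assert (t / 2 * Rabs (q 0) <= t / 2 * M) by (apply Rmult_le_compat_l; lra). lra. }
  (* Balance of one step tested against [test_fun]: what is cut off equals the injected part plus
     the gain by heat flow on [0, b]. *)
  assert (I : RInt (fun s => v s * test_fun s) b 1 =
    j * t * Gf 0 + RInt (fun s => v s * (Gf s - test_fun s)) 0 b).
  { assert (E : RInt (fun s => v s * test_fun s) 0 1 = j * t * Gf 0 + RInt (fun s => v s * Gf s) 0 b).
    { transitivity (RInt (fun r => j * t * (ker t 0 r * test_fun r) +
          RInt (fun s => ker t r s * v s) 0 b * test_fun r) 0 1).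
      - apply RInt_ext; intros r _; eqR. rewrite (profile_fix _ _ _ _ pv r) at 1.
        unfold heat_cut. fold b. rewrite (ker_sym t r 0) by exact ht0. ring.
      - assert (ci : forall r, continuous (fun r => RInt (fun s => ker t r s * v s) 0 b) r)
          by (intros; now apply cont_ker_int).
        assert (ck0 := ck 0).
        rewrite RInt_plus_R by (apply ex_RInt_cont; intros; cont).
        rewrite RInt_scal_R by (apply ex_RInt_cont; intros; cont).
        rewrite (ker_dual t 0 1 0 b v test_fun) by auto. reflexivity. }
    assert (c2 : forall x, continuous (fun s => v s * test_fun s) x) by (intros; cont).
    pose proof (RInt_Chasles_R (fun s => v s * test_fun s) 0 b 1 c2) as Ch.
    replace (RInt (fun s => v s * (Gf s - test_fun s)) 0 b)
      with (RInt (fun s => v s * Gf s) 0 b - RInt (fun s => v s * test_fun s) 0 b); [lra|].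
    rewrite <- RInt_minus_R by (apply ex_RInt_cont; intros; cont).
    apply RInt_ext; intros; eqR; ring. }
  (* The cut strip carries mass [j * t], and [test_fun] varies on it by at most [M] times its
     width. *)
  assert (e1 : Rabs (RInt (fun s => v s * test_fun s) b 1 - test_fun 1 * (j * t)) <= M * (A * t) * (j * t)).
  { rewrite <- (profile_mass j A t v hA hs pv). fold b.
    rewrite <- !RInt_scal_R by (now apply ex_RInt_cont).
    rewrite <- RInt_minus_R by (apply ex_RInt_cont; intros; cont).
    apply RInt_abs_le_cont; [unfold b; lra | intros; cont | intros; cont|].
    intros s hs'. replace (v s * test_fun s - test_fun 1 * v s) with ((test_fun s - test_fun 1) * v s) by ring.
    assert (0 <= v s) by (apply pv; unfold b in hs'; lra).
    rewrite Rabs_mult, (Rabs_pos_eq (v s)) by assumption. apply Rmult_le_compat_r; [assumption|].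
    destruct (MVT_gen test_fun s 1 test_prim) as [x [hx E]].
    - intros; apply is_derive_test_fun.
    - intros; apply continuity_pt_filterlim, ctf.
    - rewrite Rmin_left, Rmax_right in hx by lra. rewrite Rabs_minus_sym, E, Rabs_mult.
      unfold b in hs'. rewrite (Rabs_pos_eq (1 - s)) by lra.
      apply Rmult_le_compat; try apply Rabs_pos; try lra.
      unfold test_prim. apply Rle_trans with (M * (x - 0)).
      + apply RInt_abs_le_const; [lra | exact cq|]. intros; apply (test_bound _ _ _ hq); lra.
      + nra. }
  assert (e2 : Rabs (RInt (fun s => v s * (Gf s - test_fun s)) 0 b - t / 2 * RInt (fun s => v s * q s) 0 b)
    <= B * (testC * (t * h))).
  { rewrite <- RInt_scal_R by (apply ex_RInt_cont; intros; cont).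
    rewrite <- RInt_minus_R by (apply ex_RInt_cont; intros; cont).
    apply Rle_trans with (B * (testC * (t * h)) * (b - 0)).
    - apply RInt_abs_le_const; [unfold b; lra | intros; cont|].
      intros s hs'. unfold b in hs'.
      replace (v s * (Gf s - test_fun s) - t / 2 * (v s * q s))
        with (v s * (Gf s - test_fun s - t / 2 * q s)) by ring.
      rewrite Rabs_mult. apply Rmult_le_compat; try apply Rabs_pos.
      + destruct (profile_bound j A t v hj hA hs pv s ltac:(lra)). rewrite Rabs_pos_eq by assumption. exact H0.
      + exact (heat_test_fun t s ht ltac:(lra)).
    - assert (0 <= B * (testC * (t * h))) by (apply Rmult_le_pos; [exact B0 | apply Rmult_le_pos; nra]).
      unfold b; nra. }
  assert (e3 : Rabs (RInt (fun s => v s * q s) b 1) <= M * (j * t)).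
  { rewrite <- (profile_mass j A t v hA hs pv). fold b.
    rewrite <- RInt_scal_R by (now apply ex_RInt_cont).
    apply RInt_abs_le_cont; [unfold b; lra | intros; cont | intros; cont|].
    intros s hs'. unfold b in hs'. rewrite Rabs_mult, Rmult_comm, (Rabs_pos_eq (v s)) by (apply pv; lra).
    apply Rmult_le_compat_r; [apply pv; lra | apply (test_bound _ _ _ hq); lra]. }
  (* Mean zero turns the pairing of [2 j (1 - s)] with [q] into [2 * j * test_fun 1], the term left
     by the balance. *)
  assert (F : RInt (fun s => (v s - 2 * j * (1 - s)) * q s) 0 1 =
    RInt (fun s => v s * q s) 0 b + RInt (fun s => v s * q s) b 1 - 2 * j * test_fun 1).
  { assert (c3 : forall x, continuous (fun s => v s * q s) x) by (intros; cont).
    rewrite RInt_Chasles_R by exact c3. rewrite test_fun_1.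
    replace (RInt (fun s => v s * q s) 0 1 - 2 * j * - RInt (fun s => s * q s) 0 1)
      with (RInt (fun s => v s * q s) 0 1 - 2 * j * RInt q 0 1 + 2 * j * RInt (fun s => s * q s) 0 1)
      by (rewrite (test_mean _ _ _ hq); ring).
    rewrite <- !RInt_scal_R by (apply ex_RInt_cont; intros; cont).
    rewrite <- RInt_minus_R by (apply ex_RInt_cont; intros; cont).
    rewrite <- RInt_plus_R by (apply ex_RInt_cont; intros; cont).
    apply RInt_ext; intros; eqR; ring. }
  rewrite F. rewrite I in e1.
  set (X := RInt (fun s => v s * q s) 0 b) in *. set (Y := RInt (fun s => v s * q s) b 1) in *.
  set (Z := RInt (fun s => v s * (Gf s - test_fun s)) 0 b) in *.
  set (W := j * t * Gf 0) in *.
  assert (N : t / 2 * Rabs (X - 2 * j * test_fun 1) <=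
     j * t * (M * t / 2 + testC * (t * h)) + M * (A * t) * (j * t) + B * (testC * (t * h))).
  { rewrite <- (Rabs_pos_eq (t / 2)) at 1 by lra. rewrite <- Rabs_mult.
    replace (t / 2 * (X - 2 * j * test_fun 1))
      with (- W + (W + Z - test_fun 1 * (j * t)) + - (Z - t / 2 * X)) by field.
    eapply Rle_trans; [apply Rabs_triang|]. rewrite Rabs_Ropp.
    eapply Rle_trans; [apply Rplus_le_compat_r, Rabs_triang|]. rewrite Rabs_Ropp. lra. }
  assert (N' : Rabs (X - 2 * j * test_fun 1) <=
     2 * j * (M * t / 2 + testC * (t * h)) + 2 * (M * (A * t) * j) + 2 * (B * (testC * h))).
  { apply Rmult_le_reg_l with (t / 2); [lra|]. eapply Rle_trans; [exact N|]. right; field. }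
  replace (X + Y - 2 * j * test_fun 1) with ((X - 2 * j * test_fun 1) + Y) by ring.
  eapply Rle_trans; [apply Rabs_triang|].
  assert (th : t <= h) by nra. assert (thh : t * h <= h) by nra.
  assert (j * M * t <= j * M * h) by (apply Rmult_le_compat_l; nra).
  assert (j * testC * (t * h) <= j * testC * h) by (apply Rmult_le_compat_l; nra).
  assert (M * A * j * t <= M * A * j * h).
  { apply Rmult_le_compat_l; [apply Rmult_le_pos; nra | exact th]. }
  lra.
Qed.

End Test.

(** * The limit profile *)

(* Reflection of [-1, 2] onto [0, 1]. *)
Definition fold01 (y : R) : R := Rmin (Rabs y) (2 - y).

(** Folding builds in the evenness about 0 and 1 required of a test second derivative, also for a
    tent centred at the endpoint 1. *)
Definition tent (eta a y : R) : R := Rmax 0 (1 - Rabs (fold01 y - a) / eta).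

Lemma fold01_id (y : R) : 0 <= y <= 1 -> fold01 y = y.
Proof. intros; unfold fold01. rewrite Rabs_pos_eq, Rmin_left; lra. Qed.

Lemma fold01_opp (y : R) : 0 <= y <= 1 -> fold01 (- y) = y.
Proof. intros; unfold fold01. rewrite Rabs_Ropp, Rabs_pos_eq, Rmin_left; lra. Qed.

Lemma fold01_refl (y : R) : 0 <= y <= 1 -> fold01 (2 - y) = y.
Proof. intros; unfold fold01. rewrite Rabs_pos_eq, Rmin_right; lra. Qed.

Lemma fold01_lip (x y : R) : Rabs (fold01 x - fold01 y) <= Rabs (x - y).
Proof.
  unfold fold01, Rmin, Rabs; repeat destruct Rle_dec; repeat destruct Rcase_abs; lra.
Qed.

Lemma tent_lip (eta a x y : R) : 0 < eta -> Rabs (tent eta a x - tent eta a y) <= / eta * Rabs (x - y).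
Proof.
  intros he. pose proof (Rinv_0_lt_compat _ he) as hi.
  apply Rle_trans with (/ eta * Rabs (fold01 x - fold01 y)).
  2:{ apply Rmult_le_compat_l; [lra | apply fold01_lip]. }
  set (p := fold01 x). set (q := fold01 y).
  apply Rle_trans with (Rabs (Rabs (p - a) / eta - Rabs (q - a) / eta)).
  - unfold tent. fold p q. set (u := Rabs (p - a) / eta). set (w := Rabs (q - a) / eta).
    unfold Rmax, Rabs; repeat destruct Rle_dec; repeat destruct Rcase_abs; lra.
  - unfold Rdiv. rewrite <- Rmult_minus_distr_r, Rabs_mult, Rmult_comm, (Rabs_pos_eq (/ eta)) by lra.
    apply Rmult_le_compat_l; [lra|]. eapply Rle_trans; [apply Rabs_triang_inv2|].
    right; f_equal; ring.
Qed.

Lemma continuous_tent (eta a x : R) : 0 < eta -> continuous (tent eta a) x.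
Proof. intros; apply continuous_lip with (/ eta). intros; now apply tent_lip. Qed.

Lemma tent_bound (eta a y : R) : 0 < eta -> 0 <= tent eta a y <= 1.
Proof.
  intros he. unfold tent. split; [apply Rmax_l|]. apply Rmax_lub; [lra|].
  assert (0 <= Rabs (fold01 y - a) / eta) by (apply Rdiv_le_0_compat; [apply Rabs_pos | exact he]). lra.
Qed.

Lemma tent_support (eta a y : R) : 0 < eta -> 0 <= y <= 1 -> tent eta a y <> 0 -> Rabs (y - a) <= eta.
Proof.
  intros he hy H. destruct (Rle_lt_dec (Rabs (y - a)) eta) as [l|l]; [exact l|].
  exfalso; apply H. unfold tent. rewrite fold01_id by exact hy. apply Rmax_left.
  assert (1 <= Rabs (y - a) / eta) by (apply (Rle_div_r 1); lra). lra.
Qed.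

(** At least one side of [a] has room for an interval of length [eta / 2] inside [0, 1], and the
    tent is at least 1 / 2 on it. *)
Lemma tent_mass (eta a : R) : 0 < eta <= 1 / 2 -> 0 <= a <= 1 ->
  eta / 4 <= RInt (tent eta a) 0 1 <= 1.
Proof.
  intros he ha.
  assert (ct : forall x, continuous (tent eta a) x) by (intros; apply continuous_tent; lra).
  split.
  - assert (W : exists p, 0 <= p /\ p + eta / 2 <= 1 /\ p <= a <= p + eta / 2).
    { destruct (Rle_lt_dec a (1 / 2)); [exists a | exists (a - eta / 2)]; lra. }
    destruct W as [p [p0 [p1 p2]]].
    apply Rle_trans with (RInt (tent eta a) p (p + eta / 2)).
    + apply Rle_trans with (RInt (fun _ => 1 / 2) p (p + eta / 2)).
      * rewrite RInt_const_R. right; field.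
      * apply RInt_le_cont; [lra | cont | exact ct|].
        intros y hy. unfold tent. rewrite fold01_id by lra. eapply Rle_trans; [|apply Rmax_r].
        assert (Rabs (y - a) / eta <= 1 / 2); [|lra].
        apply (Rle_div_l (Rabs (y - a))); [lra|]. apply Rabs_le; lra.
    + apply RInt_subinterval; [lra | lra | exact ct|]. intros; apply tent_bound; lra.
  - apply Rle_trans with (RInt (fun _ => 1) 0 1); [|rewrite RInt_const_R; right; ring].
    apply RInt_le_cont; [lra | exact ct | cont |]. intros; apply tent_bound; lra.
Qed.

(** Weighting each tent by the mass of the other gives mean zero without division; as the masses are
    at most 1, the bounds 1 and [2 / eta] follow. *)
Lemma tent_pair_test (eta a : R) : 0 < eta <= 1 / 2 -> 0 <= a <= 1 ->
  test_second_derivative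
    (fun y => RInt (tent eta 1) 0 1 * tent eta a y - RInt (tent eta a) 0 1 * tent eta 1 y)
    (2 * / eta) 1.
Proof.
  intros he ha. pose proof (Rinv_0_lt_compat eta ltac:(lra)) as hi.
  pose proof (tent_mass eta a he ha) as [_ Ma]. pose proof (tent_mass eta a he ha) as [ma _].
  pose proof (tent_mass eta 1 he ltac:(lra)) as [m1 M1].
  set (ca := RInt (tent eta a) 0 1) in *. set (c1 := RInt (tent eta 1) 0 1) in *.
  constructor.
  - intros x y.
    replace (c1 * tent eta a x - ca * tent eta 1 x - (c1 * tent eta a y - ca * tent eta 1 y))
      with (c1 * (tent eta a x - tent eta a y) + - (ca * (tent eta 1 x - tent eta 1 y))) by ring.
    eapply Rle_trans; [apply Rabs_triang|]. rewrite Rabs_Ropp, !Rabs_mult.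
    rewrite (Rabs_pos_eq c1), (Rabs_pos_eq ca) by lra.
    pose proof (tent_lip eta a x y ltac:(lra)). pose proof (tent_lip eta 1 x y ltac:(lra)).
    pose proof (Rabs_pos (tent eta a x - tent eta a y)). pose proof (Rabs_pos (tent eta 1 x - tent eta 1 y)).
    assert (c1 * Rabs (tent eta a x - tent eta a y) <= 1 * Rabs (tent eta a x - tent eta a y))
      by (apply Rmult_le_compat_r; lra).
    assert (ca * Rabs (tent eta 1 x - tent eta 1 y) <= 1 * Rabs (tent eta 1 x - tent eta 1 y))
      by (apply Rmult_le_compat_r; lra).
    lra.
  - intros x hx. pose proof (tent_bound eta a x ltac:(lra)). pose proof (tent_bound eta 1 x ltac:(lra)).
    assert (0 <= c1 * tent eta a x <= 1) by nra. assert (0 <= ca * tent eta 1 x <= 1) by nra.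
    apply Rabs_le; lra.
  - intros y hy. unfold tent. rewrite fold01_opp, fold01_id by exact hy. reflexivity.
  - intros y hy. unfold tent. rewrite fold01_refl, fold01_id by exact hy. reflexivity.
  - assert (ct : forall b x, continuous (tent eta b) x) by (intros; apply continuous_tent; lra).
    rewrite RInt_minus_R by (apply ex_RInt_cont; intros; apply cont_mult; [apply continuous_const | apply ct]).
    rewrite !RInt_scal_R by (apply ex_RInt_cont, ct). fold ca c1. apply Rminus_diag_eq, Rmult_comm.
Qed.

Lemma tent_average (eta a D : R) (E : R -> R) : 0 < eta -> 0 <= D -> (forall x, continuous E x) ->
  (forall s, 0 <= s <= 1 -> Rabs (s - a) <= eta -> Rabs (E s - E a) <= D) ->
  Rabs (RInt (fun s => E s * tent eta a s) 0 1 - RInt (tent eta a) 0 1 * E a) <= D * RInt (tent eta a) 0 1.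
Proof.
  intros he hD cE H.
  assert (ct : forall x, continuous (tent eta a) x) by (intros; now apply continuous_tent).
  rewrite (Rmult_comm _ (E a)).
  rewrite <- !RInt_scal_R by (now apply ex_RInt_cont).
  rewrite <- RInt_minus_R by (apply ex_RInt_cont; cont).
  apply RInt_abs_le_cont; [lra | cont | cont|].
  intros s hs. pose proof (tent_bound eta a s he).
  replace (E s * tent eta a s - E a * tent eta a s) with ((E s - E a) * tent eta a s) by ring.
  rewrite Rabs_mult, (Rabs_pos_eq (tent eta a s)) by lra.
  destruct (Req_dec (tent eta a s) 0) as [e|e]; [rewrite e; lra|].
  apply Rmult_le_compat_r; [lra|]. apply H; [exact hs|]. now apply tent_support.
Qed.

Lemma profile_limit (j A a eps : R) : 0 < j -> 0 < A -> 0 <= a <= 1 -> 0 < eps ->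
  exists d, 0 < d /\ forall t v, t < d -> small A t -> profile j A t v ->
    Rabs (v a - (2 * j * (1 - a) + j / A)) < eps.
Proof.
  intros hj hA ha heps. destruct (profC_ge j hj) as [g0 _].
  (* The final error is [K * eta + (B - 1) * h]. The width [eta] is fixed first because [C], hence
     [B], depends on it; then [t] is made small. *)
  set (C1 := profC j) in *. set (K := 2 * C1 + 4 * j).
  assert (K0 : 0 < K) by (unfold K; lra).
  set (eta := Rmin (1 / 2) (eps / (2 * K))).
  assert (he : 0 < eta <= 1 / 2).
  { split; [apply Rmin_glb_lt; [lra | apply Rdiv_lt_0_compat; lra] | apply Rmin_l]. }
  assert (heK : K * eta <= eps / 2).
  { apply Rle_trans with (K * (eps / (2 * K))); [apply Rmult_le_compat_l; [lra | apply Rmin_r]|].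
    right; field; lra. }
  destruct (profile_test _ _ _ (tent_pair_test eta a he ha) j A hj hA) as [C [C0 HC]].
  (* Of [9 * C1], eight come from [2 * D] and one from [profile_at_one]; [16 / eta ^ 2] bounds the
     inverse of the product of the tent masses, each at least [eta / 4]. *)
  set (B := 9 * C1 + 16 * C / eta ^ 2 + 1).
  assert (hB : 0 < B).
  { assert (0 <= 16 * C / eta ^ 2) by (apply Rdiv_le_0_compat; [lra | apply pow_lt; lra]). unfold B; lra. }
  assert (hx : 0 < eps / (2 * B)) by (apply Rdiv_lt_0_compat; lra).
  exists ((eps / (2 * B)) ^ 2). split; [now apply pow_lt|].
  intros t v htd hs pv.
  destruct (small_facts A t hA hs) as (ht & hh & hht & hAh & hAt & _).
  set (h := sqrt t) in *.
  assert (hB2 : B * h < eps / 2).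
  { assert (h < eps / (2 * B)).
    { apply Rnot_le_lt; intros n. assert ((eps / (2 * B)) ^ 2 <= h ^ 2) by (apply pow_incr; lra).
      simpl in *. nra. }
    apply Rlt_le_trans with (B * (eps / (2 * B))); [apply Rmult_lt_compat_l; lra | right; field; lra]. }
  assert (cv : forall x, continuous v x) by apply pv.
  set (E := fun s => v s - 2 * j * (1 - s)).
  assert (cE : forall x, continuous E x) by (unfold E; cont).
  set (D := C1 * (eta + 4 * h) + 2 * j * eta).
  assert (D0 : 0 <= D) by (unfold D; nra).
  assert (mod_E : forall x s, 0 <= x <= 1 -> 0 <= s <= 1 -> Rabs (s - x) <= eta -> Rabs (E s - E x) <= D).
  { assert (W : forall x y, 0 <= x -> x <= y -> y <= 1 -> y - x <= eta -> Rabs (E x - E y) <= D).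
    { intros x y h1 h2 h3 h4. unfold E.
      pose proof (profile_modulus j A t v hj hA hs pv x y h1 h2 h3) as Md. fold h C1 in Md.
      pose proof (profile_decr _ _ _ _ pv x y h1 h2 h3).
      assert (C1 * (y - x + 4 * h) <= C1 * (eta + 4 * h)) by (apply Rmult_le_compat_l; lra).
      assert (2 * j * (y - x) <= 2 * j * eta) by (apply Rmult_le_compat_l; lra).
      assert (0 <= 2 * j * (y - x)) by (apply Rmult_le_pos; lra).
      assert (0 <= C1 * (eta + 4 * h)) by nra.
      unfold D. apply Rabs_le; lra. }
    intros x s hx' hs' d. apply Rabs_le_between in d.
    destruct (Rle_lt_dec s x); [apply W; lra|]. rewrite Rabs_minus_sym. apply W; lra. }
  pose proof (tent_mass eta a he ha) as [ma _]. pose proof (tent_mass eta 1 he ltac:(lra)) as [m1 _].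
  pose proof (tent_average eta a D E ltac:(lra) D0 cE (fun s hs' d => mod_E a s ha hs' d)) as Aa.
  pose proof (tent_average eta 1 D E ltac:(lra) D0 cE
    (fun s hs' d => mod_E 1 s (conj Rle_0_1 (Rle_refl 1)) hs' d)) as A1.
  specialize (HC t v hs pv). fold h in HC.
  set (ca := RInt (tent eta a) 0 1) in *. set (c1 := RInt (tent eta 1) 0 1) in *.
  assert (S : RInt (fun s => (v s - 2 * j * (1 - s)) * (c1 * tent eta a s - ca * tent eta 1 s)) 0 1 =
    c1 * RInt (fun s => E s * tent eta a s) 0 1 - ca * RInt (fun s => E s * tent eta 1 s) 0 1).
  { assert (ct : forall b x, continuous (tent eta b) x) by (intros; apply continuous_tent; lra).
    assert (cta := ct a). assert (ct1 := ct 1).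
    rewrite <- !RInt_scal_R by (apply ex_RInt_cont; cont).
    rewrite <- RInt_minus_R by (apply ex_RInt_cont; cont).
    apply RInt_ext; intros; eqR. unfold E; ring. }
  rewrite S in HC.
  set (Ia := RInt (fun s => E s * tent eta a s) 0 1) in *.
  set (I1 := RInt (fun s => E s * tent eta 1 s) 0 1) in *.
  assert (P : c1 * ca * Rabs (E a - E 1) <= C * h + 2 * D * (c1 * ca)).
  { assert (0 < c1 * ca) by (apply Rmult_lt_0_compat; lra).
    rewrite <- (Rabs_pos_eq (c1 * ca)) at 1 by lra. rewrite <- Rabs_mult.
    replace (c1 * ca * (E a - E 1))
      with ((c1 * Ia - ca * I1) + (- (c1 * (Ia - ca * E a)) + ca * (I1 - c1 * E 1))) by ring.
    eapply Rle_trans; [apply Rabs_triang|]. apply Rplus_le_compat; [exact HC|].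
    eapply Rle_trans; [apply Rabs_triang|].
    rewrite Rabs_Ropp, !Rabs_mult, (Rabs_pos_eq c1), (Rabs_pos_eq ca) by lra.
    assert (c1 * Rabs (Ia - ca * E a) <= c1 * (D * ca)) by (apply Rmult_le_compat_l; lra).
    assert (ca * Rabs (I1 - c1 * E 1) <= ca * (D * c1)) by (apply Rmult_le_compat_l; lra).
    lra. }
  assert (Q : Rabs (E a - E 1) <= 16 * C / eta ^ 2 * h + 2 * D).
  { assert (eta ^ 2 / 16 <= c1 * ca).
    { replace (eta ^ 2 / 16) with (eta / 4 * (eta / 4)) by field. apply Rmult_le_compat; lra. }
    assert (e2 : 0 < eta ^ 2) by (apply pow_lt; lra).
    apply Rmult_le_reg_l with (c1 * ca); [nra|]. eapply Rle_trans; [exact P|].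
    rewrite Rmult_plus_distr_l. apply Rplus_le_compat; [|lra].
    apply Rle_trans with (eta ^ 2 / 16 * (16 * C / eta ^ 2 * h)); [right; field; lra|].
    apply Rmult_le_compat_r; [|lra].
    apply Rmult_le_pos; [apply Rdiv_le_0_compat; lra | lra]. }
  pose proof (profile_at_one j A t v hj hA hs pv) as O. fold h C1 in O.
  replace (v a - (2 * j * (1 - a) + j / A)) with ((E a - E 1) + (v 1 - j / A)) by (unfold E; ring).
  eapply Rle_lt_trans; [apply Rabs_triang|].
  assert (16 * C / eta ^ 2 * h + 2 * D + C1 * h = K * eta + (B - 1) * h) by (unfold D, K, B; ring).
  lra.
Qed.

(** * Stationary densities as cut profiles *)

(** [rho] may jump at [b], so the integral over [0, 1] is split there; this is the bridge from the
    cut density to the continuous [u]. *)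
Lemma heat_conv_cut (t c b : R) (rho u : R -> R) (r : R) : 0 < t -> 0 <= b <= 1 ->
  (forall x, continuous u x) -> (forall s, 0 <= s <= b -> rho s = u s) ->
  (forall s, b < s <= 1 -> rho s = 0) -> heat_conv t c rho r = heat_cut t c b u r.
Proof.
  intros ht hb cu H1 H2. unfold heat_conv, heat_cut. rewrite Gneum_theta by exact ht.
  fold (ker t r 0). f_equal.
  assert (ck : forall x, continuous (ker t r) x) by (intros; now apply ker_cont_snd).
  apply is_RInt_unique.
  replace (RInt (fun s => ker t r s * u s) 0 b) with (plus (RInt (fun s => ker t r s * u s) 0 b) (@zero R_NormedModule))
    by apply plus_zero_r.
  apply (is_RInt_Chasles (V := R_NormedModule)) with b.
  - apply (is_RInt_ext (fun s => ker t r s * u s)).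
    + rewrite Rmin_left, Rmax_right by lra. intros s hs.
      rewrite Gneum_theta, H1 by lra. reflexivity.
    + apply (RInt_correct (V := R_CompleteNormedModule)). apply ex_RInt_cont; cont.
  - apply (is_RInt_ext (fun s => 0)).
    + rewrite Rmin_left, Rmax_right by lra. intros s hs. rewrite H2 by lra. eqR; ring.
    + replace (@zero R_NormedModule) with (scal (1 - b) (@zero R_NormedModule)) by exact (Rmult_0_r (1 - b)).
      apply (is_RInt_const (V := R_NormedModule)).
Qed.

Lemma profile_exists (j A t : R) : 0 < j -> 0 < A -> small A t -> exists v, profile j A t v.
Proof.
  intros hj hA hs. destruct (small_facts A t hA hs) as (ht & hh & hht & hAh & hAt & _).
  destruct (heat_cut_fixpoint t (j * t) (1 - A * t)) as (v & v1 & v2 & v3 & v4); [lra | nra | lra|].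
  now exists v.
Qed.

Lemma profile_stationary (j A t : R) (v : R -> R) : 0 < j -> 0 < A -> small A t -> profile j A t v ->
  stationary_density j A t (cut_density v (1 - A * t)).
Proof.
  intros hj hA hs pv. destruct (small_facts A t hA hs) as (ht & hh & hht & hAh & hAt & _).
  set (b := 1 - A * t). assert (ht0 : 0 < t) by lra.
  assert (in_b : forall r, r <= b -> cut_density v b r = v r)
    by (intros r hr; unfold cut_density; destruct Rle_dec; lra).
  assert (out_b : forall r, b < r -> cut_density v b r = 0)
    by (intros r hr; unfold cut_density; destruct Rle_dec; lra).
  assert (E : forall r, heat_conv t (j * t) (cut_density v b) r = v r).
  { intros r. rewrite (profile_fix _ _ _ _ pv r). apply heat_conv_cut; auto.
    - unfold b; lra.
    - apply pv.
    - intros s hs'; apply in_b, hs'.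
    - intros s hs'; apply out_b; unfold b; apply hs'. }
  unfold stationary_density. fold b. split; [|split; [|split; [|split]]].
  - intros r hr. destruct (Rle_lt_dec r b); [rewrite in_b by assumption; now apply pv | rewrite out_b; lra].
  - intros r hr. rewrite (in_b r) by lra. apply filterlim_locally. intros eps.
    pose proof (proj1 (filterlim_locally _ _) (profile_cont _ _ _ _ pv r) eps) as [d Hd].
    exists d. intros y hy hyb. rewrite in_b by lra. now apply Hd.
  - intros r hr; apply out_b; lra.
  - split; [unfold b; lra|].
    transitivity (RInt v b 1); [apply RInt_ext; intros; apply E|]. now apply (profile_mass j A t v).
  - intros r hr. unfold cut_density at 1 3. destruct Rle_dec; [apply E | reflexivity].
Qed.

Lemma stationary_eq_profile (j A t : R) (rho v : R -> R) : 0 < j -> 0 < A -> small A t -> profile j A t v ->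
  stationary_density j A t rho -> forall r, 0 <= r <= 1 -> rho r = cut_density v (1 - A * t) r.
Proof.
  intros hj hA hs pv st. destruct (small_facts A t hA hs) as (ht & hh & hht & hAh & hAt & _).
  set (b := 1 - A * t). assert (hb : 0 <= b < 1) by (unfold b; lra). assert (ht0 : 0 < t) by lra.
  destruct st as (_ & cr & r0 & _ & fr). fold b in cr, r0, fr.
  (* Relative continuity of [rho] on [0, b] becomes continuity on the whole line, as
     [heat_cut_unique] asks. *)
  set (u := fun x => rho (clamp 0 b x)).
  assert (cu : forall x, continuous u x).
  { intros x. unfold continuous, u.
    apply (filterlim_comp _ _ _ (clamp 0 b) rho (locally x)
      (within (fun x => 0 <= x <= b) (locally (clamp 0 b x)))).
    - intros P HP. pose proof (continuous_clamp 0 b x _ HP) as H.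
      unfold filtermap in *. eapply filter_imp; [|exact H]. intros y hy; apply hy, clamp_in; lra.
    - apply cr, clamp_in; lra. }
  assert (uid : forall s, 0 <= s <= b -> rho s = u s) by (intros s hs'; unfold u; now rewrite clamp_id).
  assert (E : forall r, heat_conv t (j * t) rho r = heat_cut t (j * t) b u r)
    by (intros r; apply heat_conv_cut; auto; lra).
  assert (uv : forall r, 0 <= r <= b -> u r = v r).
  { apply (heat_cut_unique t (j * t) b); auto.
    - apply pv.
    - intros r hr. rewrite <- uid by exact hr. rewrite <- (fr r) by lra.
      unfold cut_density. destruct Rle_dec; [apply E | lra].
    - intros r _. apply (profile_fix _ _ _ _ pv). }
  intros r hr. unfold cut_density. destruct Rle_dec; [|apply r0; lra].
  rewrite uid by lra. apply uv; lra.
Qed.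

Theorem theorem3p5 (j A : R) (hj : 0 < j) (hA : 0 < A) :
  exists delta0 : R, 0 < delta0 /\
    (forall delta : R, 0 < delta < delta0 ->
       (exists rho : R -> R, stationary_density j A delta rho) /\
       (forall rho1 rho2 : R -> R,
          stationary_density j A delta rho1 -> stationary_density j A delta rho2 ->
          forall r, 0 <= r <= 1 -> rho1 r = rho2 r)) /\
    (forall rhof : R -> R -> R,
       (forall delta : R, 0 < delta < delta0 -> stationary_density j A delta (rhof delta)) ->
       forall r : R, 0 <= r < 1 ->
         filterlim (fun delta => rhof delta r) (at_right 0)
           (locally (2 * j * (1 - r) + j / A))).
Proof.
  assert (hi : 0 < / (4 * A)) by (apply Rinv_0_lt_compat; lra).
  (* The second entry is [4 * A * sqrt t <= 1] solved for [t]. *)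
  set (d0 := Rmin (1 / 64) ((/ (4 * A)) ^ 2)).
  assert (hd0 : 0 < d0) by (apply Rmin_glb_lt; [lra | now apply pow_lt]).
  assert (sm : forall t, 0 < t < d0 -> small A t).
  { intros t ht. pose proof (Rmin_l (1 / 64) ((/ (4 * A)) ^ 2)). pose proof (Rmin_r (1 / 64) ((/ (4 * A)) ^ 2)).
    fold d0 in H, H0. split; [lra|].
    assert (sqrt t <= / (4 * A)).
    { rewrite <- (sqrt_pow2 (/ (4 * A))) by lra. apply sqrt_le_1_alt; lra. }
    apply Rle_trans with (4 * A * / (4 * A)); [apply Rmult_le_compat_l; lra | right; field; lra]. }
  exists d0. split; [exact hd0|]. split.
  - intros t ht. destruct (profile_exists j A t hj hA (sm t ht)) as [v pv]. split.
    + exists (cut_density v (1 - A * t)). now apply profile_stationary; [| |apply sm|].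
    + intros rho1 rho2 s1 s2 r hr.
      rewrite (stationary_eq_profile j A t rho1 v hj hA (sm t ht) pv s1 r hr).
      now rewrite (stationary_eq_profile j A t rho2 v hj hA (sm t ht) pv s2 r hr).
  - intros rhof st r hr. apply filterlim_locally. intros eps.
    destruct (profile_limit j A r eps hj hA ltac:(lra) (cond_pos eps)) as [d [hd H]].
    (* The entry [(1 - r) / A] places [r] to the left of the cut point [1 - A * t], so that the
       density at [r] is [v r]; it is positive because [r < 1]. *)
    assert (hm : 0 < Rmin d (Rmin d0 ((1 - r) / A))).
    { apply Rmin_glb_lt; [exact hd|]. apply Rmin_glb_lt; [exact hd0|].
      apply Rdiv_lt_0_compat; lra. }
    exists (mkposreal _ hm). intros t ht tpos.
    assert (ht' : t < Rmin d (Rmin d0 ((1 - r) / A))).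
    { assert (Rabs (t - 0) < Rmin d (Rmin d0 ((1 - r) / A))) by exact ht.
      rewrite Rminus_0_r, Rabs_pos_eq in H0 by lra. exact H0. }
    pose proof (Rmin_l d (Rmin d0 ((1 - r) / A))). pose proof (Rmin_r d (Rmin d0 ((1 - r) / A))).
    pose proof (Rmin_l d0 ((1 - r) / A)). pose proof (Rmin_r d0 ((1 - r) / A)).
    assert (htd : 0 < t < d0) by lra.
    assert (t * A < 1 - r) by (apply Rlt_div_r; lra).
    destruct (profile_exists j A t hj hA (sm t htd)) as [v pv].
    change (Rabs (rhof t r - (2 * j * (1 - r) + j / A)) < eps).
    rewrite (stationary_eq_profile j A t _ v hj hA (sm t htd) pv (st t htd) r) by lra.
    unfold cut_density. destruct Rle_dec; [|lra].
    apply (H t); [lra | apply sm, htd | exact pv].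
Qed.
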